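(* Let $A\in\{0,1\}$ and assume: (consistency) $Y=Y(A)$; (latent ignorability) for each $a$, $Y(a)$ is conditionally independent of $\{A,Z\}$ given $(U,L)$; (IV independence) $Z$ is conditionally independent of $U$ given $L$; (strong IV relevance) there is $\epsilon_0>0$ such that for any $l\in\mathcal{L}$ and $a\in\{0,1\}$, $\mathrm{Var}\{\Pr(A=a\mid Z,L)\mid L=l\}\ge\epsilon_0$. Let $\pi_*^o(Z,L):=\Pr(A=1\mid Z,L)$ and $$\psi_*^o:=\mathbb{E}[\gamma^o(L)],\qquad \gamma^o(L):=\frac{\mathrm{Cov}\{Y,\pi_*^o(Z,L)\mid L\}}{\mathrm{Cov}\{A,\pi_*^o(Z,L)\mid L\}}.$$ Then, in the nonparametric model for the law of $O=(Z,A,Y,L)$ (with $\pi_*^o$ unknown), the efficient influence function for $\psi_*^o$ is $\varphi(O;\psi_*^o,\beta^o)$, where $$\varphi(O;\psi_*,\beta):=\frac{\pi_*(Z,L)-\delta(L)}{\kappa(L)}Y-\psi_*+\frac{\gamma(L)}{\kappa(L)}\left\{\kappa(L)+(A-\pi_*(Z,L))^2-(A-\delta(L))^2\right\}+\frac{1}{\kappa(L)}\left\{\xi(Z,L)(A-\pi_*(Z,L))-\eta(L)(A-\delta(L))\right\},$$ $\beta=[\pi_*,\delta,\kappa,\xi,\eta,\gamma]$, and $\beta^o=[\pi_*^o,\delta^o,\kappa^o,\xi^o,\eta^o,\gamma^o]$ is the vector of true nuisance functions.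
   Context: $Z$ is an instrument (multi-categorical or continuous), $U$ unmeasured confounders, $L\in\mathcal{L}$ observed covariates, $Y\in\mathbb{R}$ the outcome, $Y(a)$ potential outcomes. True nuisance functions: $\delta^o(L)=\mathbb{E}[A\mid L]$, $\eta^o(L)=\mathbb{E}[Y\mid L]$, $\kappa^o(L)=\mathrm{Cov}\{A,\pi_*^o(Z,L)\mid L\}$, $\xi^o(Z,L)=\mathbb{E}[Y\mid Z,L]$, and $\pi_*^o,\gamma^o$ as in the claim. The semiparametric analysis is carried out in the fully nonparametric model for the observed data (tangent space equal to all mean-zero square-integrable functions of $O$), so the efficient influence function is the unique influence function: the mean-zero square-integrable $\varphi$ with $\frac{d}{d\theta}\psi_*(P_\theta)|_{\theta=0}=\mathbb{E}[\varphi(O)s(O)]$ for every regular parametric submodel $P_\theta$ through the true law with score $s$ at $\theta=0$, where $\psi_*(P)$ is the functional given by the displayed formula under $P$ (including $\pi_*$ computed under $P$).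
   Formalization: Y is assumed square-integrable (otherwise φ need not be square-integrable), and a regular submodel means one differentiable in quadratic mean with second moments of Y bounded and strong IV relevance holding uniformly near θ=0; strong relevance is required only for almost every l. *)

(* Defs.v *)
From HB Require Import structures.
From mathcomp Require Export all_boot all_order all_algebra.
From mathcomp Require Export all_classical all_reals all_analysis.

Set Implicit Arguments.
Unset Strict Implicit.
Unset Printing Implicit Defensive.

Import Order.TTheory GRing.Theory Num.Theory.
Import numFieldNormedType.Exports.

Local Open Scope classical_set_scope.
Local Open Scope ring_scope.

(** * Conditional expectation, covariance and independence *)

Section conditional.
Context {R : realType} {d} {T : measurableType d} (P : probability T R).

(* [h] is a version of [x |-> E(f | X = x)]: conditional expectations are
   functions on the codomain of the conditioning variable, so that
   [E(f | X)] is [h \o X].  [f] is meant to be integrable. *)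
Definition is_condE {d'} {T' : measurableType d'} (X : T -> T') (f : T -> R)
    (h : T' -> R) : Prop :=
  [/\ measurable_fun setT h,
      P.-integrable setT (EFin \o (h \o X)) &
      forall B, measurable B ->
        (\int[P]_(x in X @^-1` B) (h (X x))%:E =
         \int[P]_(x in X @^-1` B) (f x)%:E)%E].

(* A chosen version; two versions agree almost surely along [X]. *)
Definition condE {d'} {T' : measurableType d'} (X : T -> T') (f : T -> R)
    : T' -> R :=
  xget (fun=> 0) [set h | is_condE X f h].

Definition condP {d'} {T' : measurableType d'} (X : T -> T') (E : set T)
    : T' -> R :=
  condE X \1_E.

Definition condCov {d'} {T' : measurableType d'} (X : T -> T') (f g : T -> R)
    : T' -> R :=
  condE X (fun x => (f x - condE X f (X x)) * (g x - condE X g (X x))).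

Definition condVar {d'} {T' : measurableType d'} (X : T -> T') (f : T -> R)
    : T' -> R :=
  condCov X f f.

Definition cond_indep {d1 d2 d3} {T1 : measurableType d1}
    {T2 : measurableType d2} {T3 : measurableType d3}
    (X1 : T -> T1) (X2 : T -> T2) (W : T -> T3) : Prop :=
  forall B1 B2, measurable B1 -> measurable B2 ->
    \forall w \ae P,
      condP W (X1 @^-1` B1 `&` X2 @^-1` B2) (W w) =
      condP W (X1 @^-1` B1) (W w) * condP W (X2 @^-1` B2) (W w).

End conditional.

(** * Observed data [O = (Z, A, Y, L)] *)

Notation Obs R TZ TL := (TZ * bool * R * TL)%type (only parsing).

Section observed_data.
Context {R : realType} {dZ dL} {TZ : measurableType dZ} {TL : measurableType dL}.

Definition oZ (o : Obs R TZ TL) : TZ := o.1.1.1.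
Definition oA (o : Obs R TZ TL) : bool := o.1.1.2.
Definition oY (o : Obs R TZ TL) : R := o.1.2.
Definition oL (o : Obs R TZ TL) : TL := o.2.
Definition oZL (o : Obs R TZ TL) : TZ * TL := (oZ o, oL o).
Definition oAr (o : Obs R TZ TL) : R := (oA o)%:R.

End observed_data.

Section observed_law.
Context {R : realType} {d dZ dL} {T : measurableType d}
  {TZ : measurableType dZ} {TL : measurableType dL}.

Definition obs_data (Z : {mfun T >-> TZ}) (A : {mfun T >-> bool})
    (Y : {mfun T >-> R}) (L : {mfun T >-> TL}) (w : T) : Obs R TZ TL :=
  (Z w, A w, Y w, L w).

Lemma measurable_obs_data Z A Y L : measurable_fun setT (obs_data Z A Y L).
Proof. by do 3?[apply: measurable_fun_pair]. Qed.

HB.instance Definition _ Z A Y L := isMeasurableFun.Build _ _ _ _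
  (obs_data Z A Y L) (measurable_obs_data Z A Y L).

Definition obs_law (P : probability T R) Z A Y L
    : probability (Obs R TZ TL) R :=
  distribution P (obs_data Z A Y L).

End observed_law.

(** * The functional and its nuisance functions *)

Section functional.
Context {R : realType} {dZ dL} {TZ : measurableType dZ} {TL : measurableType dL}.
Implicit Types Q : probability (Obs R TZ TL) R.

Definition propensity Q (a : bool) : TZ * TL -> R :=
  condP Q oZL (oA @^-1` [set a]).

Definition pi_star Q : TZ * TL -> R := propensity Q true.

Definition gamma_star Q (l : TL) : R :=
  condCov Q oL oY (pi_star Q \o oZL) l / condCov Q oL oAr (pi_star Q \o oZL) l.

Definition psi_star Q : R := \int[Q]_o gamma_star Q (oL o).

Record nuisance := Nuisance {
  nu_pi : TZ * TL -> R;
  nu_delta : TL -> R;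
  nu_kappa : TL -> R;
  nu_xi : TZ * TL -> R;
  nu_eta : TL -> R;
  nu_gamma : TL -> R }.

Definition true_nuisance Q : nuisance := {|
  nu_pi := pi_star Q;
  nu_delta := condE Q oL oAr;
  nu_kappa := condCov Q oL oAr (pi_star Q \o oZL);
  nu_xi := condE Q oZL oY;
  nu_eta := condE Q oL oY;
  nu_gamma := gamma_star Q |}.

Definition phi (psi : R) (b : nuisance) (o : Obs R TZ TL) : R :=
  let p := nu_pi b (oZL o) in
  let delta := nu_delta b (oL o) in
  let kappa := nu_kappa b (oL o) in
  let xi := nu_xi b (oZL o) in
  let eta := nu_eta b (oL o) in
  let gamma := nu_gamma b (oL o) in
  (p - delta) / kappa * oY o - psi
  + gamma / kappa * (kappa + (oAr o - p) ^+ 2 - (oAr o - delta) ^+ 2)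
  + kappa^-1 * (xi * (oAr o - p) - eta * (oAr o - delta)).

(* The value of a conditional variance at [l] is only defined up to null sets
   of the law of [L]. *)
Definition strong_iv_relevance Q (eps : R) : Prop :=
  forall a : bool, \forall o \ae Q,
    eps <= condVar Q oL (propensity Q a \o oZL) (oL o).

End functional.

(** * Regular submodels and the efficient influence function *)

Section efficiency.
Context {R : realType} {dZ dL} {TZ : measurableType dZ} {TL : measurableType dL}.
Implicit Types (Q : probability (Obs R TZ TL) R) (s f : Obs R TZ TL -> R).

(* Differentiability in quadratic mean at [0], with respect to some sigma-finite
   measure dominating the path near [0]. *)
Definition quadratic_mean_differentiable
    (Pt : R -> probability (Obs R TZ TL) R) s : Prop :=
  exists (mu : {sigma_finite_measure set (Obs R TZ TL) -> \bar R})
         (p : R -> Obs R TZ TL -> R),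
    (\forall t \near (0 : R),
       [/\ measurable_fun setT (p t),
           forall o, 0 <= p t o &
           forall B, measurable B ->
             Pt t B = (\int[mu]_(o in B) (p t o)%:E)%E]) /\
    (\int[mu]_o (((Num.sqrt (p t o) - Num.sqrt (p 0 o)) / t
                  - 2^-1 * s o * Num.sqrt (p 0 o)) ^+ 2)%:E)%E
      @[t --> (0 : R)^'] --> 0%E.

(* One-dimensional submodels through [Q] of the nonparametric model.  Besides
   differentiability in quadratic mean, regularity asks that the requirements
   making [psi_star] well defined, namely a finite second moment of [Y] and
   strong relevance of the instrument, hold uniformly near [0]; without such
   local bounds even the mean of [Y] is not differentiable along all
   differentiable paths.  The square-integrability and centering of the score
   follow from the differentiability. *)
Record regular_submodel Q (Pt : R -> probability (Obs R TZ TL) R) s : Prop := {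
  rs_through : forall B, measurable B -> Pt 0 B = Q B;
  rs_score_L2 : s \in Lfun Q 2%:E;
  rs_score_mean0 : ('E_Q[s] = 0)%E;
  rs_qmd : quadratic_mean_differentiable Pt s;
  rs_moment : exists M : R, \forall t \near (0 : R),
    (\int[Pt t]_o ((oY o) ^+ 2)%:E <= M%:E)%E;
  rs_relevance : exists2 eps : R, 0 < eps &
    \forall t \near (0 : R), strong_iv_relevance (Pt t) eps }.

Definition influence_function (psi : probability (Obs R TZ TL) R -> R) Q f
    : Prop :=
  [/\ f \in Lfun Q 2%:E,
      ('E_Q[f] = 0)%E &
      forall Pt s, regular_submodel Q Pt s ->
        is_derive (0 : R) (1 : R) (fun t : R => psi (Pt t))
          (\int[Q]_o (f o * s o))].

(* Every mean-zero square-integrable function is tangent to the model, so the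
   efficient influence function is the unique influence function. *)
Definition efficient_influence_function
    (psi : probability (Obs R TZ TL) R -> R) Q f : Prop :=
  influence_function psi Q f /\
  forall g, influence_function psi Q g -> g = f %[ae Q].

End efficiency.

(* Main.v *)
(** The functional is [psi_star Q = E_Q(Y u)] with [u = (pi - delta) / kappa].  For
    a bounded outcome and two laws [P1], [P0], the increment of [psi_star] equals
    [(E_1 - E_0) phi_0] up to products of two nuisance differences and to
    [E_1]-means of one nuisance difference times a factor that is centred under
    [P0].  A regression of a bounded variable moves in L2 by at most a multiple of
    the Hellinger distance [H] of the laws, so this remainder is O(H^2), hence
    O(t^2) along a path differentiable in quadratic mean.  An unbounded outcome is
    truncated at level [n]: the contribution of [Y 1_{|Y| > n}] to the difference
    quotient is governed by the Hellinger distance localized to [|Y| > n], which is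
    at most [|t| (o(1) + |s 1_{|Y| > n}|_2 / 2)], and it vanishes as [t -> 0] and
    then [n -> oo].

    For uniqueness, the tilts [(1 + t (1_B - Q B)) Q] form a regular submodel with
    score [1_B - Q B] for every event [B], so two influence functions have the same
    integral over [B]. *)

Require Import Defs.
From HB Require Import structures.
From mathcomp Require Import all_boot all_order all_algebra.
From mathcomp Require Import all_classical all_reals all_analysis.
From mathcomp Require Import measurable_realfun ring lra.

Set Implicit Arguments.
Unset Strict Implicit.
Unset Printing Implicit Defensive.

Import Order.TTheory GRing.Theory Num.Theory.
Import numFieldNormedType.Exports.

Local Open Scope classical_set_scope.
Local Open Scope ring_scope.

(** A uniform bound on the second moment of [Y] does not make [Y ^ 2] uniformly integrable along the
    path, so under the nearby law the tail of [Y] is only bounded in L2, not small. Smallness has to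
    come from the other factor, the difference of root densities restricted to the tail; the plain
    Hellinger distance would leave a term of the order of [t]. Neither law is assumed to have a
    bounded density with respect to the other. Nuisance differences are therefore measured under
    both laws at once, and integrals under different laws are compared in L2 of the dominating
    measure after multiplication by root densities. A remainder centred under [P0] is of second
    order because its [P1]-mean equals [(E_1 - E_0)] of it: the change of law costs one factor [H]
    and the nuisance difference in it a second one. Versions of conditional expectations are bounded
    only almost surely. Clipping them makes the weight [u] bounded by [eps^-1] everywhere, which
    keeps all integrability questions about [Y] alone. *)

Lemma ler_dist01 (R : realFieldType) (x y : R) :
  0 <= x <= 1 -> 0 <= y <= 1 -> `|x - y| <= 1.
Proof. by move=> /andP[? ?] /andP[? ?]; rewrite ler_norml; lra. Qed.

(** * Real-valued integration *)

Section bounded_measurable.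
Context d (T : measurableType d) (R : realType).
Implicit Types f g : T -> R.

Definition bm f := measurable_fun setT f /\ exists M, forall x, `|f x| <= M.

Lemma bm_cst (c : R) : bm (fun=> c).
Proof. by split => //; exists `|c|. Qed.

Lemma bmD f g : bm f -> bm g -> bm (fun x => f x + g x).
Proof.
move=> [mf [M fM]] [mg [N gN]]; split; first exact: measurable_funD.
by exists (M + N) => x; rewrite (le_trans (ler_normD _ _))// lerD.
Qed.

Lemma bmN f : bm f -> bm (fun x => - f x).
Proof.
move=> [mf [M fM]]; split; first exact: measurableT_comp.
by exists M => x; rewrite normrN.
Qed.

Lemma bmB f g : bm f -> bm g -> bm (fun x => f x - g x).
Proof. by move=> ? ?; apply: bmD => //; exact: bmN. Qed.

Lemma bmM f g : bm f -> bm g -> bm (fun x => f x * g x).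
Proof.
move=> [mf [M fM]] [mg [N gN]]; split; first exact: measurable_funM.
by exists (M * N) => x; rewrite normrM ler_pM.
Qed.

Lemma bmX f n : bm f -> bm (fun x => f x ^+ n).
Proof.
move=> [mf [M fM]]; split; first exact: measurable_funX.
by exists (M ^+ n) => x; rewrite normrX lerXn2r// nnegrE// (le_trans _ (fM x)).
Qed.

Lemma bm_norm f : bm f -> bm (fun x => `|f x|).
Proof.
move=> [mf [M fM]]; split; first exact: measurableT_comp.
by exists M => x; rewrite normr_id.
Qed.

Lemma measurable_inv_gt0 (e : R) f : 0 < e -> (forall x, e <= f x) ->
  measurable_fun setT f -> measurable_fun setT (fun x => (f x)^-1).
Proof.
move=> e0 fe mf.
have -> : (fun x => (f x)^-1) = (fun x => f x `^ (-1)).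
  by apply/funext => x; rewrite powRN powRr1// (le_trans (ltW e0)).
exact: (measurableT_comp (measurable_powR _)).
Qed.

Lemma bmV (e : R) f : 0 < e -> (forall x, e <= f x) -> bm f ->
  bm (fun x => (f x)^-1).
Proof.
move=> e0 fe [mf _]; split; first exact: measurable_inv_gt0 fe mf.
exists e^-1 => x; have f0 : 0 < f x by rewrite (lt_le_trans e0).
by rewrite normfV gtr0_norm// lef_pV2.
Qed.

Lemma bm_indic (A : set T) : measurable A -> bm \1_A.
Proof.
move=> mA; split; first exact: measurable_indic.
by exists 1 => x; rewrite indicE; case: (_ \in _); rewrite ?normr0 ?normr1.
Qed.

End bounded_measurable.

Lemma bm_comp d d' (T : measurableType d) (T' : measurableType d')
    (R : realType) (X : T -> T') (f : T' -> R) :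
  measurable_fun setT X -> bm f -> bm (fun x => f (X x)).
Proof.
move=> mX [mf [M fM]]; split; first exact: measurableT_comp.
by exists M => x.
Qed.

Ltac bmt := repeat first
  [ assumption | exact: bm_cst | apply: bmB | apply: bmD | apply: bmN
  | apply: bmM | apply: bmX | apply: bm_norm ].

Section real_integral.
Context d (T : measurableType d) (R : realType)
  (mu : {measure set T -> \bar R}).
Implicit Types f g : T -> R.

Definition L1 f := mu.-integrable setT (EFin \o f).

Lemma L1_meas f : L1 f -> measurable_fun setT f.
Proof. by move/measurable_int/measurable_EFinP. Qed.

Lemma L1D f g : L1 f -> L1 g -> L1 (fun x => f x + g x).
Proof. by move=> fi gi; exact: (integrableD measurableT fi gi). Qed.

Lemma L1N f : L1 f -> L1 (fun x => - f x).
Proof. by move=> fi; exact: (integrableN fi). Qed.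

Lemma L1B f g : L1 f -> L1 g -> L1 (fun x => f x - g x).
Proof. by move=> ? ?; apply: L1D => //; exact: L1N. Qed.

Lemma L1Z c f : L1 f -> L1 (fun x => c * f x).
Proof. by move=> fi; exact: (integrableZl measurableT c fi). Qed.

Lemma L1_norm f : L1 f -> L1 (fun x => `|f x|).
Proof. by move=> ?; exact: integrable_norm. Qed.

Lemma L1_le f g : measurable_fun setT f -> (forall x, `|f x| <= g x) ->
  L1 g -> L1 f.
Proof.
move=> mf fg; apply: (@le_integrable _ _ _ mu setT measurableT).
  exact/measurable_EFinP.
by move=> x _ /=; rewrite lee_fin (le_trans (fg x))// ler_norm.
Qed.

Lemma L1_bm f g : bm f -> L1 g -> L1 (fun x => f x * g x).
Proof.
move=> [mf [M fM]] ig.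
apply: (@L1_le _ (fun x => M * `|g x|)); last exact/L1Z/L1_norm.
  by apply: measurable_funM => //; exact: L1_meas.
by move=> x; rewrite normrM ler_wpM2r.
Qed.

Lemma L1_bmr f g : L1 f -> bm g -> L1 (fun x => f x * g x).
Proof. by move=> fi bg; under eq_fun do rewrite mulrC; exact: L1_bm. Qed.

Lemma intD f g : L1 f -> L1 g ->
  \int[mu]_x (f x + g x) = \int[mu]_x f x + \int[mu]_x g x.
Proof. by move=> ? ?; rewrite RintegralD. Qed.

Lemma intB f g : L1 f -> L1 g ->
  \int[mu]_x (f x - g x) = \int[mu]_x f x - \int[mu]_x g x.
Proof. by move=> ? ?; rewrite RintegralB. Qed.

Lemma intZ c f : L1 f -> \int[mu]_x (c * f x) = c * \int[mu]_x f x.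
Proof. by move=> ?; rewrite RintegralZl. Qed.

Lemma eq_int f g : f =1 g -> \int[mu]_x f x = \int[mu]_x g x.
Proof. by move=> /funext ->. Qed.

Lemma le_int f g : L1 f -> L1 g -> (forall x, f x <= g x) ->
  \int[mu]_x f x <= \int[mu]_x g x.
Proof. by move=> ? ? fg; apply: le_Rintegral. Qed.

Lemma int_ge0 f : (forall x, 0 <= f x) -> 0 <= \int[mu]_x f x.
Proof. by move=> f0; apply: Rintegral_ge0. Qed.

Lemma EFin_int f : L1 f -> (\int[mu]_x f x)%:E = (\int[mu]_x (f x)%:E)%E.
Proof. by move=> fi; rewrite /Rintegral fineK//; exact: integrable_fin_num. Qed.

Lemma ae_int f g : measurable_fun setT f -> measurable_fun setT g ->
  (\forall x \ae mu, f x = g x) -> \int[mu]_x f x = \int[mu]_x g x.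
Proof.
move=> mf mg fg; congr fine; apply: ae_eq_integral => //.
- exact/measurable_EFinP.
- exact/measurable_EFinP.
- by apply: filterS fg => x /= ->.
Qed.

Lemma ae_L1 f g : measurable_fun setT g ->
  (\forall x \ae mu, f x = g x) -> L1 f -> L1 g.
Proof.
move=> mg fg fi; have mf := L1_meas fi.
apply/integrableP; split; first exact/measurable_EFinP.
move/integrableP : fi => [_]; congr (_ < _)%E.
apply: ae_eq_integral => //.
- by apply/measurable_EFinP; exact: measurableT_comp.
- by apply/measurable_EFinP; exact: measurableT_comp.
- by apply: filterS fg => x /= ->.
Qed.

Lemma int0_ae f : L1 f -> (forall x, 0 <= f x) -> \int[mu]_x f x = 0 ->
  \forall x \ae mu, f x = 0.
Proof.
move=> fi f0 intf.
have mf := L1_meas fi.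
have := @ae_eq_integral_abs _ _ _ mu setT measurableT (EFin \o f) _.
case; first exact/measurable_EFinP.
move=> H _; have {H} : ae_eq mu setT (EFin \o f) (cst 0%E).
  apply: H; under eq_integral do rewrite /= ger0_norm//.
  by rewrite -EFin_int// intf.
by apply: filterS => x /= /(_ I) []; exact.
Qed.

Definition L2 f := measurable_fun setT f /\ L1 (fun x => f x ^+ 2).

Definition nrm f := Num.sqrt (\int[mu]_x f x ^+ 2).

Lemma L2M f g : L2 f -> L2 g -> L1 (fun x => f x * g x).
Proof.
move=> [mf fi] [mg gi].
apply: (@L1_le _ (fun x => f x ^+ 2 + g x ^+ 2)).
- exact: measurable_funM.
- move=> x; rewrite normrM -(real_normK (num_real (f x))).
  rewrite -(real_normK (num_real (g x))).
  have := sqr_ge0 (`|f x| - `|g x|); have := normr_ge0 (f x).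
  have := normr_ge0 (g x); set a := `|f x|; set b := `|g x|; nra.
- exact: L1D.
Qed.

Lemma L2Z c f : L2 f -> L2 (fun x => c * f x).
Proof.
move=> [mf fi]; split; first exact: measurable_funM.
by under eq_fun do rewrite exprMn; exact: L1Z.
Qed.

Lemma L2D f g : L2 f -> L2 g -> L2 (fun x => f x + g x).
Proof.
move=> f2 g2; have fg := L2M f2 g2; case: f2 => mf fi; case: g2 => mg gi.
split; first exact: measurable_funD.
have -> : (fun x => (f x + g x) ^+ 2) =
    (fun x => (f x ^+ 2 + g x ^+ 2) + 2 * (f x * g x)).
  by apply/funext => x; ring.
by apply: L1D; [exact: L1D|exact: L1Z].
Qed.

Lemma L2N f : L2 f -> L2 (fun x => - f x).
Proof.
move=> [mf fi]; split; first exact: measurableT_comp.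
by under eq_fun do rewrite sqrrN.
Qed.

Lemma L2B f g : L2 f -> L2 g -> L2 (fun x => f x - g x).
Proof. by move=> ? ?; apply: L2D => //; exact: L2N. Qed.

Lemma L2_le f g : measurable_fun setT f -> (forall x, `|f x| <= `|g x|) ->
  L2 g -> L2 f.
Proof.
move=> mf fg [mg gi]; split => //.
apply: L1_le gi; first exact: measurable_funX.
by move=> x; rewrite normrX -[leRHS]real_normK ?num_real// lerXn2r ?nnegrE.
Qed.

Lemma L2_bm f g : bm f -> L2 g -> L2 (fun x => f x * g x).
Proof.
move=> [mf [M fM]] g2; apply: (@L2_le _ (fun x => M * g x)).
- by apply: measurable_funM => //; case: g2.
- move=> x; rewrite !normrM ler_wpM2r// (le_trans (fM x))//.
  exact: ler_norm.
- exact: L2Z.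
Qed.

Lemma L2_bmr f g : L2 f -> bm g -> L2 (fun x => f x * g x).
Proof. by move=> fi bg; under eq_fun do rewrite mulrC; exact: L2_bm. Qed.

Lemma nrm_ge0 f : 0 <= nrm f. Proof. exact: sqrtr_ge0. Qed.

Lemma nrmE f : nrm f ^+ 2 = \int[mu]_x f x ^+ 2.
Proof. by rewrite sqr_sqrtr// int_ge0// => x; exact: sqr_ge0. Qed.

Lemma nrm_le f g : measurable_fun setT f -> (forall x, `|f x| <= `|g x|) ->
  L2 g -> nrm f <= nrm g.
Proof.
move=> mf fg g2; have f2 := L2_le mf fg g2.
rewrite ler_sqrt; last by apply: int_ge0 => x; exact: sqr_ge0.
apply: le_int; [by case: f2|by case: g2|] => x.
rewrite -[leRHS]real_normK ?num_real// -[leLHS]real_normK ?num_real//.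
by rewrite lerXn2r ?nnegrE.
Qed.

Lemma nrmZ c f : L2 f -> nrm (fun x => c * f x) = `|c| * nrm f.
Proof.
move=> [mf fi]; rewrite /nrm (@eq_int _ (fun x => c ^+ 2 * f x ^+ 2)); last first.
  by move=> x; rewrite exprMn.
by rewrite intZ// sqrtrM ?sqr_ge0// sqrtr_sqr.
Qed.

Lemma nrmN f : nrm (fun x => - f x) = nrm f.
Proof. by rewrite /nrm; congr Num.sqrt; apply: eq_int => x; rewrite sqrrN. Qed.

(** The degenerate case of Cauchy-Schwarz, in which the norms cannot be divided out. *)
Lemma L2M_ae0 f g : L2 f -> L2 g -> nrm f = 0 -> \int[mu]_x (f x * g x) = 0.
Proof.
move=> f2 g2 f0; have mfg := L1_meas (L2M f2 g2); case: f2 => mf fi.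
rewrite (@ae_int _ (fun=> 0))//.
  by rewrite (@eq_int _ (fun x => 0 * 0)) ?intZ ?mul0r//; exact: integrable0.
have := @int0_ae (fun x => f x ^+ 2) fi (fun x => sqr_ge0 _).
rewrite -nrmE f0 expr0n => /(_ erefl).
apply: filterS => x /eqP; rewrite sqrf_eq0 => /eqP ->; by rewrite mul0r.
Qed.

Lemma Cauchy_Schwarz f g : L2 f -> L2 g ->
  `|\int[mu]_x (f x * g x)| <= nrm f * nrm g.
Proof.
move=> f2 g2; have [f0|f0] := eqVneq (nrm f) 0.
  by rewrite L2M_ae0// f0 normr0 mul0r.
have [g0|g0] := eqVneq (nrm g) 0.
  rewrite (@eq_int _ (fun x => g x * f x)) => [|x]; last by rewrite mulrC.
  by rewrite L2M_ae0// g0 normr0 mulr0.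
have nf : 0 < nrm f by rewrite lt_def f0 nrm_ge0.
have ng : 0 < nrm g by rewrite lt_def g0 nrm_ge0.
have nfg : 0 < nrm f * nrm g by exact: mulr_gt0.
have fgi := L2M f2 g2.
rewrite (le_trans (le_normr_Rintegral measurableT fgi))//.
rewrite -(ler_pM2l nfg) -expr2.
rewrite -intZ; last exact: L1_norm.
(* Expanding [(nrm g * |f| - nrm f * |g|) ^ 2 >= 0]; with these weights the right-hand side
   integrates to exactly [(nrm f * nrm g) ^ 2]. *)
have H x : nrm f * nrm g * `|f x * g x| <=
    2^-1 * (nrm g ^+ 2 * f x ^+ 2 + nrm f ^+ 2 * g x ^+ 2).
  rewrite normrM -(real_normK (num_real (f x))) -(real_normK (num_real (g x))).
  have := sqr_ge0 (nrm g * `|f x| - nrm f * `|g x|).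
  set a := `|f x|; set b := `|g x|; set c := nrm f; set e := nrm g; lra.
case: f2 g2 => mf fi [mg gi].
rewrite (le_trans (le_int _ _ H))//.
- exact/L1Z/L1_norm.
- by apply: L1Z; apply: L1D; exact: L1Z.
- rewrite intZ; last by apply: L1D; exact: L1Z.
  by rewrite intD ?intZ -?nrmE; try exact: L1Z => //; try exact: fi; try exact: gi; lra.
Qed.

Lemma Cauchy_Schwarz_norm f g : L2 f -> L2 g ->
  \int[mu]_x `|f x * g x| <= nrm f * nrm g.
Proof.
move=> f2 g2; have := @Cauchy_Schwarz (fun x => `|f x|) (fun x => `|g x|).
have nm h : L2 h -> L2 (fun x => `|h x|).
  case=> mh hi; split; first exact: measurableT_comp.
  by under eq_fun do rewrite real_normK ?num_real//.
move=> /(_ (nm _ f2) (nm _ g2)).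
have -> h : nrm (fun x => `|h x|) = nrm h.
  rewrite /nrm; congr Num.sqrt; apply: eq_int => x.
  by rewrite real_normK ?num_real.
have -> h : nrm (fun x => `|h x|) = nrm h.
  rewrite /nrm; congr Num.sqrt; apply: eq_int => x.
  by rewrite real_normK ?num_real.
rewrite (@eq_int (fun x => `|f x| * `|g x|) (fun x => `|f x * g x|)).
  by apply: le_trans; rewrite ler_norm.
by move=> x; rewrite normrM.
Qed.

Lemma nrmD f g : L2 f -> L2 g -> nrm (fun x => f x + g x) <= nrm f + nrm g.
Proof.
move=> f2 g2; rewrite -(@ler_pXn2r _ 2)// ?nnegrE ?addr_ge0 ?nrm_ge0//.
have := Cauchy_Schwarz f2 g2; have fgi := L2M f2 g2.
case: f2 g2 => mf fi [mg gi].
rewrite sqrrD !nrmE.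
rewrite (@eq_int (fun x => (f x + g x) ^+ 2)
  (fun x => (f x ^+ 2 + g x ^+ 2) + 2 * (f x * g x))); last first.
  by move=> x; ring.
rewrite intD ?intD ?intZ//; [|exact: L1D|exact: L1Z].
by move=> /ler_normlP[_]; lra.
Qed.

Lemma nrmB f g : L2 f -> L2 g -> nrm (fun x => f x - g x) <= nrm f + nrm g.
Proof. by move=> f2 g2; rewrite -[nrm g]nrmN; apply: nrmD => //; exact: L2N. Qed.

End real_integral.

Section probability_integral.
Context d (T : measurableType d) (R : realType) (P : probability T R).
Implicit Types f g : T -> R.

Lemma bm_L1 f : bm f -> L1 P f.
Proof.
move=> [mf [M fM]]; apply: (@L1_le _ _ _ _ _ (fun=> M)) => //.
exact: finite_measure_integrable_cst.
Qed.

Lemma int_cst (c : R) : \int[P]_x c = c.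
Proof. by rewrite Rintegral_cst// [X in fine X]probability_setT mulr1. Qed.

Lemma bm_L2 f : bm f -> L2 P f.
Proof. by move=> bf; split; [case: bf|apply/bm_L1/bmX]. Qed.

Lemma L2_L1 f : L2 P f -> L1 P f.
Proof.
move=> f2; have := L2M f2 (bm_L2 (bm_cst _ 1)).
by under eq_fun do rewrite mulr1.
Qed.

Lemma nrm_cst (c : R) : nrm P (fun=> c) = `|c|.
Proof. by rewrite /nrm int_cst sqrtr_sqr. Qed.

End probability_integral.

(** * Laws with a density and their square roots *)

Section density.
Context d (T : measurableType d) (R : realType)
  (mu : {sigma_finite_measure set T -> \bar R}) (P : probability T R)
  (p : T -> R).
Hypothesis mp : measurable_fun setT p.
Hypothesis p0 : forall x, 0 <= p x.
Hypothesis Pp : forall B, measurable B -> P B = (\int[mu]_(x in B) (p x)%:E)%E.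

Lemma density_L1 : L1 mu p.
Proof.
apply/integrableP; split; first exact/measurable_EFinP.
under eq_integral do rewrite /= ger0_norm//.
by rewrite -Pp// probability_setT ltry.
Qed.

Lemma density_dominates : P `<< mu.
Proof.
apply/null_content_dominatesP => A mA A0; rewrite Pp//.
by apply: null_set_integral => //; apply/measurable_EFinP/measurable_funTS.
Qed.

(** [p] and the Radon-Nikodym derivative have the same integral over every measurable set, so they
    agree almost everywhere and the change of variables passes to [p]. *)
Lemma density_integral (f : T -> R) : L1 P f ->
  (\int[mu]_x (f x * p x)%:E = \int[P]_x (f x)%:E)%E.
Proof.
move=> fi; have mf := L1_meas fi.
rewrite -(Radon_Nikodym_change_of_variables density_dominates measurableT fi).
apply: ae_eq_integral => //.
- by apply/measurable_EFinP; exact: measurable_funM.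
- apply: emeasurable_funM; first exact/measurable_EFinP.
  by apply: (measurable_int mu); apply: Radon_Nikodym_integrable;
    exact: density_dominates.
- apply: (@ae_eqe_mul2l _ _ _ mu setT (EFin \o p) _ (EFin \o f)).
  apply: integral_ae_eq => //.
  + exact: density_L1.
  + by apply: (measurable_int mu); apply: Radon_Nikodym_integrable;
      exact: density_dominates.
  + move=> E _ mE; rewrite -Radon_Nikodym_integral//; last exact: density_dominates.
    by rewrite -Pp.
Qed.

(** For nonnegative integrands integrability need not be known beforehand; this is how the second
    moment of [Y] under a tilted law is first shown to be finite. *)
Lemma density_ge0_integral (f : T -> R) : measurable_fun setT f ->
  (forall x, 0 <= f x) ->
  (\int[mu]_x (f x * p x)%:E = \int[P]_x (f x)%:E)%E.
Proof.
move=> mf f0; have PL := density_dominates.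
rewrite -(Radon_Nikodym_SigmaFinite.change_of_variables PL)//; last exact/measurable_EFinP.
have mRN := measurable_int mu (Radon_Nikodym_SigmaFinite.f_integrable PL).
apply: ae_eq_integral => //.
- by apply/measurable_EFinP; exact: measurable_funM.
- by apply: emeasurable_funM => //; exact/measurable_EFinP.
- apply: (@ae_eqe_mul2l _ _ _ mu setT (EFin \o p) _ (EFin \o f)).
  apply: integral_ae_eq => //; first exact: density_L1.
  by move=> E _ mE; rewrite -Radon_Nikodym_SigmaFinite.f_integral// -Pp.
Qed.

Lemma density_mulL1 (f : T -> R) : L1 P f -> L1 mu (fun x => f x * p x).
Proof.
move=> fi; have mf := L1_meas fi.
apply/integrableP; split; first by apply/measurable_EFinP; exact: measurable_funM.
under eq_integral => x _ do rewrite /= normrM (ger0_norm (p0 x)).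
rewrite (density_integral (L1_norm fi)).
by have /integrableP[_] := L1_norm fi; under eq_integral do rewrite /= normr_id.
Qed.

Lemma density_int (f : T -> R) : L1 P f ->
  \int[mu]_x (f x * p x) = \int[P]_x f x.
Proof. by move=> fi; rewrite /Rintegral density_integral. Qed.

Let r x := Num.sqrt (p x).

Lemma density_sqrtE x : r x ^+ 2 = p x.
Proof. by rewrite /r sqr_sqrtr. Qed.

Lemma density_sqrt_meas : measurable_fun setT r.
Proof.
have -> : r = (fun x => p x `^ 2^-1) by apply/funext => x; rewrite /r powR12_sqrt.
exact: (measurableT_comp (measurable_powR _)).
Qed.

(** Multiplication by the root density embeds L2 of [P] isometrically into L2 of [mu] ([density_nrm]
    gives the norms), one space in which functions taken under different laws can be paired. *)
Lemma density_L2 (f : T -> R) : L2 P f -> L2 mu (fun x => f x * r x).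
Proof.
move=> [mf fi]; split; first exact: measurable_funM density_sqrt_meas.
under eq_fun do rewrite exprMn density_sqrtE.
exact: density_mulL1.
Qed.

Lemma density_nrm (f : T -> R) : L2 P f -> nrm mu (fun x => f x * r x) = nrm P f.
Proof.
move=> [mf fi]; rewrite /nrm -density_int//; congr Num.sqrt; apply: eq_int => x.
by rewrite exprMn density_sqrtE.
Qed.

Lemma sqrt_L2 : L2 mu r.
Proof.
have := density_L2 (bm_L2 P (bm_cst _ 1)).
by under eq_fun do rewrite mul1r.
Qed.

End density.

Lemma mem_bool_set {T : Type} (b : T -> bool) x : (x \in [set y | b y]) = b x.
Proof. by apply/idP/idP; rewrite inE. Qed.

(* [HB.pack] builds the probability out of proofs that are local to the lemma. *)
Lemma density_probability d (T : measurableType d) (R : realType)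
    (Q : probability T R) (w : T -> R) :
  measurable_fun setT w -> (forall x, 0 <= w x) ->
  (\int[Q]_x (w x)%:E = 1)%E ->
  {P : probability T R |
    forall A, measurable A -> P A = (\int[Q]_(x in A) (w x)%:E)%E}.
Proof.
move=> mw w0 w1.
pose m (A : set T) := (\int[Q]_(x in A) (w x)%:E)%E.
have m0 : m set0 = 0%E by rewrite /m integral_set0.
have mge0 A : (0 <= m A)%E by apply: integral_ge0 => x _; rewrite lee_fin.
have msa : semi_sigma_additive m.
  apply: semi_sigma_additive_nng_induced; first exact/measurable_EFinP.
  by move=> x; rewrite lee_fin.
pose mB := isMeasure.Build _ _ _ m m0 mge0 msa.
pose M : {measure set T -> \bar R} := HB.pack m mB.
pose P : probability T R := HB.pack m mB (Measure_isProbability.Build _ _ _ M w1).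
by exists P.
Qed.

(** * Tails of a measurable function *)

Section tails.
Context d (T : measurableType d) (R : realType).
Implicit Types Y g : T -> R.

Definition tail Y (n : nat) : T -> R := \1_[set x | n%:R < `|Y x|].

Lemma tailE Y n x : tail Y n x = (n%:R < `|Y x|)%R%:R.
Proof. by rewrite /tail indicE mem_bool_set. Qed.

Lemma bm_tail Y n : measurable_fun setT Y -> bm (tail Y n).
Proof.
move=> mY; apply: bm_indic; rewrite -[X in measurable X]setTI.
have mn : measurable_fun setT (fun x => `|Y x|) by exact: measurableT_comp.
have /(_ measurableT [set true] I) := measurable_fun_ltr (measurable_cst (n%:R : R)) mn.
exact.
Qed.

Lemma tail_cvg (P : probability T R) Y g : measurable_fun setT Y -> L1 P g ->
  forall e, 0 < e -> \forall n \near \oo, `|\int[P]_x (g x * tail Y n x)| < e.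
Proof.
move=> mY gi e e0; have mg := L1_meas gi.
have [] := @dominated_convergence _ _ _ P setT measurableT
  (fun n x => (g x * tail Y n x)%:E) (cst 0%E) (fun x => `|g x|%:E).
- move=> n; apply/measurable_EFinP/measurable_funM => //.
  by case: (bm_tail n mY).
- exact: measurable_cst.
- apply: aeW => x _; apply: cvg_near_cst.
  exists (Num.truncn `|Y x|).+1 => //= n /= xn.
  rewrite tailE ltNge (_ : `|Y x| <= n%:R) ?mulr0//.
  by rewrite (le_trans (ltW (truncnS_gt _)))// ler_nat.
- exact: L1_norm.
- apply: aeW => x n _ /=; rewrite lee_fin normrM ler_piMr// tailE.
  by case: (_ < _); rewrite ?normr0 ?normr1.
move=> _ _; rewrite integral0 => /fine_cvg /=.
move=> /cvgrPdist_lt /(_ _ e0); apply: filterS => n /=.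
by rewrite sub0r normrN.
Qed.

End tails.

(** * Conditional expectation *)

Section pull_out.
Context d d' (T : measurableType d) (T' : measurableType d') (R : realType)
  (P : probability T R) (X : T -> T').
Hypothesis mX : measurable_fun setT X.

Let I (j : nat) : R -> R := \1_[set z | j.+1%:R <= z].
(** For [y >= 0] this counts the integers [1, ..., J] not exceeding [y], that is, the minimum of [J]
    and the integer part of [y]. *)
Let S (J : nat) (y : R) : R := \sum_(j < J) I j y.

Let IE j y : I j y = (j.+1%:R <= y)%R%:R.
Proof. by rewrite /I indicE mem_bool_set. Qed.

Let S_recr J y : S J.+1 y = S J y + I J y.
Proof. by rewrite /S big_ord_recr. Qed.

Let S_spec J y : 0 <= y ->
  (J%:R <= y -> S J y = J%:R) /\ (y < J%:R -> S J y <= y <= S J y + 1).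
Proof.
move=> y0; elim: J => [|J [IH1 IH2]].
  by rewrite /S big_ord0; split => //; rewrite ltNge y0.
rewrite S_recr IE.
have JJ : J.+1%:R = J%:R + 1 :> R by rewrite -natr1.
split=> [Jy|yJ].
  by rewrite Jy IH1 ?JJ//; lra.
rewrite (lt_geF yJ) /= !addr0; have [yJ1|Jy] := ltP y J%:R; first exact: IH2.
by rewrite IH1//; lra.
Qed.

Let mI j (g : T' -> R) : measurable_fun setT g ->
  measurable [set y | j.+1%:R <= g y].
Proof.
by move=> mg; rewrite -[X in measurable X]setTI; exact: measurable_fun_le.
Qed.

Let I_comp j (g : T' -> R) y : I j (g y) = \1_[set y | j.+1%:R <= g y] y.
Proof. by rewrite IE indicE mem_bool_set. Qed.

Let bmI j (g : T' -> R) : measurable_fun setT g -> bm (fun y => I j (g y)).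
Proof.
by move=> mg; under eq_fun do rewrite I_comp; exact/bm_indic/mI.
Qed.

Let bmS J (g : T' -> R) : measurable_fun setT g -> bm (fun y => S J (g y)).
Proof.
move=> mg; elim: J => [|J IH].
  by under eq_fun do rewrite /S big_ord0; exact: bm_cst.
by under eq_fun do rewrite S_recr; apply: bmD => //; exact: bmI.
Qed.

(* A bounded [g >= 0] is within [1/n] of [S J (n g) / n], a finite combination
   of indicators of measurable sets. *)
Lemma pull_out0 (k : T -> R) : L1 P k ->
  (forall B, measurable B -> \int[P]_x (\1_B (X x) * k x) = 0) ->
  forall g, bm g -> \int[P]_x (g (X x) * k x) = 0.
Proof.
move=> ki kB.
have ki' g : bm g -> L1 P (fun x => g (X x) * k x).
  by move=> bg; apply: L1_bm => //; exact: bm_comp mX bg.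
(* Adding the bound [M] makes [g] nonnegative, and the shift costs nothing since [k] has integral 0
   (take [B = setT]). *)
suff nneg g : bm g -> (forall x, 0 <= g x) -> \int[P]_x (g (X x) * k x) = 0.
  move=> g bg; have [_ [M gM]] := bg.
  have := nneg (fun y => g y + M) (bmD bg (bm_cst _ M)).
  rewrite (@eq_int _ _ _ _ (fun x => (g (X x) + M) * k x)
    (fun x => g (X x) * k x + M * k x)); last by move=> x; rewrite mulrDl.
  rewrite intD ?intZ//; [|exact: ki'|exact: L1Z].
  have -> : \int[P]_x k x = 0.
    rewrite -(kB setT measurableT); apply: eq_int => x.
    by rewrite indicE in_setT mul1r.
  rewrite mulr0 addr0; apply=> x; have := gM x; rewrite ler_norml; lra.
move=> bg g0; have [mg [M gM]] := bg.
have mng n : measurable_fun setT (fun y => n%:R * g y).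
  exact: measurable_funM.
have Sn n J : \int[P]_x (S J (n%:R * g (X x)) * k x) = 0.
  elim: J => [|J IH].
    rewrite (@eq_int _ _ _ _ _ (fun x => 0 * k x)) ?intZ ?mul0r// => x.
    by rewrite /S big_ord0.
  rewrite (@eq_int _ _ _ _ _ (fun x => S J (n%:R * g (X x)) * k x +
     I J (n%:R * g (X x)) * k x)); last by move=> x; rewrite -mulrDl S_recr.
  rewrite intD; [|exact: (ki' _ (bmS _ (mng n)))|exact: (ki' _ (bmI _ (mng n)))].
  rewrite IH add0r -[RHS](kB _ (mI J (mng n))).
  by apply: eq_int => x; rewrite (I_comp _ (fun y => n%:R * g y)).
apply/eqP; rewrite -normr_le0; apply/ler_addgt0Pl => e e0; rewrite addr0.
have Kge0 : 0 <= \int[P]_x `|k x| by apply: int_ge0.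
pose n := (Num.truncn ((\int[P]_x `|k x|) / e)).+1.
have n0 : 0 < n%:R :> R by rewrite ltr0n.
have Kn : \int[P]_x `|k x| <= e * n%:R.
  by rewrite mulrC -ler_pdivrMr// ltW// truncnS_gt.
(* [J] exceeds [n * M], so the staircase does not saturate on the values of [n * g] and stays within
   1 of them. *)
pose J := (Num.truncn (n%:R * M)).+1.
rewrite -(ler_pM2r n0); apply: le_trans Kn.
rewrite mulrC -[X in X * _](gtr0_norm n0) -normrM -intZ; last exact: ki'.
have ni : L1 P (fun x => n%:R * (g (X x) * k x)) by exact/L1Z/ki'.
have Si : L1 P (fun x => S J (n%:R * g (X x)) * k x) by apply: (ki' (fun y => S J (n%:R * g y))); exact: bmS.
rewrite -[X in `|X|]subr0 -(Sn n J) -intB//.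
have di := L1B ni Si.
rewrite (le_trans (le_normr_Rintegral measurableT di))//.
apply: le_int; [exact: L1_norm|exact: L1_norm|] => x.
rewrite mulrA -mulrBl normrM ler_piMl//.
have ng0 : 0 <= n%:R * g (X x) by rewrite mulr_ge0// ltW.
have [_ ] := S_spec J ng0.
have H : n%:R * g (X x) < J%:R.
  rewrite (le_lt_trans _ (truncnS_gt (n%:R * M)))// ler_pM2l//.
  rewrite (le_trans _ (gM (X x)))//.
  exact: ler_norm.
by move=> /(_ H) /andP[? ?]; rewrite ler_norml; lra.
Qed.

(** Orthogonality to bounded functions of [X] extends to integrable ones: truncating [g] at level
    [n] leaves only a tail, which vanishes by dominated convergence because [k] is bounded. It is
    needed for the regression of [Y], which is unbounded. *)
Lemma pull_out_L1 (k : T -> R) (M : R) (g : T' -> R) :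
  measurable_fun setT k -> (forall x, `|k x| <= M) ->
  (forall g, bm g -> \int[P]_x (g (X x) * k x) = 0) ->
  measurable_fun setT g -> L1 P (g \o X) -> \int[P]_x (g (X x) * k x) = 0.
Proof.
move=> mk kM kg mg gi.
have M0 : 0 <= M by rewrite (le_trans _ (kM point)).
have bk : bm k by split => //; exists M.
have mgX : measurable_fun setT (fun x => g (X x)) := L1_meas gi.
have gki : L1 P (fun x => g (X x) * k x).
  by under eq_fun do rewrite mulrC; exact: L1_bm.
apply/eqP; rewrite -normr_le0; apply/ler_addgt0Pl => e e0; rewrite addr0.
have [n _ /(_ n (leqnn n)) /= nt] := @tail_cvg _ _ _ P _ _ mgX gki _ e0.
rewrite (le_trans _ (ltW nt))//.
have -> : \int[P]_x (g (X x) * k x) =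
    \int[P]_x (g (X x) * k x * tail (fun x => g (X x)) n x); last exact: lexx.
apply/eqP; rewrite -subr_eq0 -intB//; last first.
  by under eq_fun do rewrite mulrC; apply: L1_bm => //; exact: bm_tail.
have bt : bm (fun y => g y * (1 - tail g n y)).
  split.
    apply: measurable_funM => //; apply: measurable_funB => //.
    by case: (bm_tail n mg).
  exists n%:R => y; rewrite tailE; case: ltP => h; rewrite ?subrr ?mulr0 ?normr0//.
  by rewrite subr0 mulr1.
rewrite -(kg _ bt); apply/eqP; apply: eq_int => x.
by rewrite !tailE; ring.
Qed.

End pull_out.

Section conditional_expectation.
Context d (T : measurableType d) (R : realType) (P : probability T R).
Implicit Types f : T -> R.

Section version.
Context d' (T' : measurableType d') (X : T -> T').
Hypothesis mX : measurable_fun setT X.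
Implicit Types g h : T' -> R.

(** The defining identity is tested on bounded functions instead of events, the form in which later
    computations use it. *)
Definition cond_exp f h : Prop :=
  [/\ measurable_fun setT h, L1 P (h \o X) &
      forall g, bm g -> \int[P]_x (g (X x) * h (X x)) = \int[P]_x (g (X x) * f x)].

(** A version is the Radon-Nikodym derivative, with respect to the law of [X], of the image under
    [X] of the charge with density [f]. *)
Lemma is_condE_exists f : L1 P f -> exists h, is_condE P X f h.
Proof.
move=> fi.
pose X' : {mfun T >-> T'} := HB.pack X (isMeasurableFun.Build _ _ _ _ X mX).
pose nu' := [the {charge set T' -> \bar R} of
  pushforward (induced_charge fi) X'].
pose nu := nu' mX.
pose m := distribution P X'.
have num : nu `<< m.
  apply/null_content_dominatesP => A mA A0.
  rewrite /nu /nu' /= /pushforward /induced_charge; apply: null_set_integral => //.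
    by rewrite -[X in measurable X]setTI; exact: mX.
  exact/measurable_EFinP/measurable_funTS/(L1_meas fi).
have Rfin x : Radon_Nikodym nu m x \is a fin_num by exact: Radon_Nikodym_fin_num.
have Rint := Radon_Nikodym_integrable num.
have Rm := measurable_int m Rint.
exists (fun y => fine (Radon_Nikodym nu m y)).
have RE : EFin \o (fun y => fine (Radon_Nikodym nu m y)) = Radon_Nikodym nu m.
  by apply/funext => y /=; rewrite fineK.
have mh : measurable_fun setT (fun y => fine (Radon_Nikodym nu m y)).
  by apply/measurable_EFinP; rewrite RE.
have hi : P.-integrable setT (EFin \o ((fun y => fine (Radon_Nikodym nu m y)) \o X)).
  apply/integrableP; split.
    by apply/measurable_EFinP; exact: measurableT_comp.
  have /integrableP[_] := Rint.
  rewrite [X in (X < _)%E -> _]ge0_integral_distribution//; last first.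
    exact: measurableT_comp.
  by congr (_ < _)%E; apply: eq_integral => x _ /=; rewrite -abse_EFin fineK.
split => // B mB.
have -> : (\int[P]_(x in X @^-1` B) (f x)%:E = nu B)%E by [].
rewrite (Radon_Nikodym_integral num mB).
rewrite -[in RHS]RE [RHS](integral_pushforward (phi := X')) //.
  exact/measurable_EFinP.
apply: integrableS hi => //.
by rewrite -[X in measurable X]setTI; exact: mX.
Qed.

Lemma is_condE_cond_exp f h : L1 P f -> is_condE P X f h -> cond_exp f h.
Proof.
move=> fi [mh hi fh]; split => // g bg.
have bgX : bm (fun x => g (X x)) := bm_comp mX bg.
apply/eqP; rewrite -subr_eq0 -intB; [|exact: L1_bm|exact: L1_bm].
rewrite (@eq_int _ _ _ _ _ (fun x => g (X x) * (h (X x) - f x))); last first.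
  by move=> x; rewrite mulrBr.
rewrite (pull_out0 mX)//; first exact: L1B.
move=> B mB.
have mXB : measurable (X @^-1` B).
  by rewrite -[X in measurable X]setTI; exact: mX.
have bB := bm_comp mX (bm_indic R mB).
rewrite (@eq_int _ _ _ _ _ (fun x => \1_B (X x) * h (X x) - \1_B (X x) * f x)); last first.
  by move=> x; rewrite mulrBr.
rewrite intB; [|exact: L1_bm|exact: L1_bm].
apply/eqP; rewrite subr_eq0; apply/eqP.
have := congr1 fine (fh _ mB).
rewrite -!/(Rintegral _ _ _) !(Rintegral_mkcond _ (X @^-1` B)).
have E k x : (k \_ (X @^-1` B)) x = \1_B (X x) * k x :> R.
  rewrite /patch indicE.
  have -> : (x \in X @^-1` B) = (X x \in B) by apply/idP/idP; rewrite !inE.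
  by case: (_ \in _); rewrite ?mul1r ?mul0r.
by rewrite (eq_int P (E (h \o X))) (eq_int P (E f)).
Qed.

Lemma condE_spec f : L1 P f -> is_condE P X f (condE P X f).
Proof. by move=> fi; apply: xgetPex; exact: is_condE_exists. Qed.

Lemma cond_exp_condE f : L1 P f -> cond_exp f (condE P X f).
Proof. by move=> fi; apply: is_condE_cond_exp => //; exact: condE_spec. Qed.

Lemma cond_exp_int f h : cond_exp f h -> \int[P]_x h (X x) = \int[P]_x f x.
Proof.
move=> [_ _ /(_ _ (bm_cst _ 1))].
by under eq_int do rewrite mul1r; under [RHS]eq_int do rewrite mul1r.
Qed.

Lemma cond_expB f f' h h' : L1 P f -> L1 P f' ->
  cond_exp f h -> cond_exp f' h' ->
  cond_exp (fun x => f x - f' x) (fun y => h y - h' y).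
Proof.
move=> fi fi' [mh hi hf] [mh' hi' hf']; split.
- exact: measurable_funB.
- exact: L1B.
- move=> g bg; have bgX := bm_comp mX bg.
  under eq_int do rewrite mulrBr; under [RHS]eq_int do rewrite mulrBr.
  by rewrite !intB ?hf ?hf'//; exact: L1_bm.
Qed.

Lemma cond_exp_ae_eqr f h h' : measurable_fun setT h' ->
  (\forall x \ae P, h (X x) = h' (X x)) -> cond_exp f h -> cond_exp f h'.
Proof.
move=> mh' hh' [mh hi hf]; split => //.
  by apply: ae_L1 hi => //; exact: measurableT_comp.
move=> g bg; rewrite -hf//; have [mg _] := bm_comp mX bg.
apply: ae_int.
- by apply: measurable_funM => //; exact: measurableT_comp.
- by apply: measurable_funM => //; exact: measurableT_comp.
- by apply: filterS hh' => x ->.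
Qed.

Lemma cond_exp_ae_eql f f' h : measurable_fun setT f -> measurable_fun setT f' ->
  (\forall x \ae P, f x = f' x) -> cond_exp f h -> cond_exp f' h.
Proof.
move=> mf mf' ff' [mh hi hf]; split => // g bg.
rewrite hf//; have [mg _] := bm_comp mX bg.
apply: ae_int; [exact: measurable_funM|exact: measurable_funM|].
by apply: filterS ff' => x ->.
Qed.

(** Testing on the indicator of [h < c] makes the integral of a nonnegative function nonpositive. A
    lower bound can thus be proved by integrated estimates, which is what the relevance of tilted
    laws requires. *)
Lemma cond_exp_ge_test h c : measurable_fun setT h -> L1 P (h \o X) ->
  (forall g, bm g -> (forall y, 0 <= g y <= 1) ->
    c * \int[P]_x g (X x) <= \int[P]_x (g (X x) * h (X x))) ->
  \forall x \ae P, c <= h (X x).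
Proof.
move=> mh hi H.
pose B := [set y | h y < c].
have mB : measurable B.
  have /(_ measurableT [set true] I) := measurable_fun_ltr mh (measurable_cst c).
  by rewrite setTI.
have bB := bm_indic R mB; have bBX := bm_comp mX bB.
have i2 : L1 P (fun x => \1_B (X x) * (c - h (X x))).
  by apply: L1_bm => //; apply: L1B => //; exact/bm_L1/bm_cst.
have k0 x : 0 <= \1_B (X x) * (c - h (X x)).
  rewrite indicE mem_bool_set; case: ltP => hc; last by rewrite mul0r.
  by rewrite mul1r subr_ge0 ltW.
have : \int[P]_x (\1_B (X x) * (c - h (X x))) = 0.
  apply/eqP; rewrite eq_le int_ge0 ?andbT//.
  rewrite (@eq_int _ _ _ _ _ (fun x => c * \1_B (X x) - \1_B (X x) * h (X x))).
    rewrite intB ?intZ; try by [exact: bm_L1|exact: L1_bm|exact/L1Z/bm_L1].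
    rewrite subr_le0; apply: H => // y.
    by rewrite indicE; case: (_ \in _); rewrite ?lexx ler01.
  by move=> x; ring.
move=> /(int0_ae i2 k0); apply: filterS => x /eqP.
rewrite indicE mem_bool_set; case: ltP => // hc.
by rewrite mul1r subr_eq0 => /eqP hc'; rewrite hc' ltxx in hc.
Qed.

Lemma cond_exp_ge f h c : L1 P f -> cond_exp f h ->
  (\forall x \ae P, c <= f x) -> \forall x \ae P, c <= h (X x).
Proof.
move=> fi [mh hi hf] cf; apply: cond_exp_ge_test => // g bg g01.
have bgX := bm_comp mX bg; have gi := bm_L1 P bgX; have gfi := L1_bm bgX fi.
have di := L1B gfi (L1Z c gi).
rewrite hf// -subr_ge0 -intZ// -intB//; last exact: L1Z.
(* The integrand is nonnegative only almost everywhere; replacing it by its absolute value preserves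
   the integral and makes the sign evident. *)
rewrite (ae_int (L1_meas di) (L1_meas (L1_norm di))); first exact: int_ge0.
apply: filterS cf => x cfx; rewrite ger0_norm// subr_ge0 mulrC ler_wpM2l//.
by case/andP: (g01 (X x)).
Qed.

Lemma cond_exp_le f h c : L1 P f -> cond_exp f h ->
  (\forall x \ae P, f x <= c) -> \forall x \ae P, h (X x) <= c.
Proof.
move=> fi [mh hi hf] cf.
have ch : cond_exp (fun x => - f x) (fun y => - h y).
  split; [exact: measurableT_comp|exact: L1N|] => g bg.
  have bgX := bm_comp mX bg.
  rewrite (@eq_int _ _ _ _ _ (fun x => -1 * (g (X x) * h (X x)))); last first.
    by move=> x; ring.
  rewrite (@eq_int _ _ _ _ (fun x => g (X x) * - f x)
    (fun x => -1 * (g (X x) * f x))); last by move=> x; ring.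
  by rewrite !intZ ?hf//; exact: L1_bm.
have := @cond_exp_ge _ _ (- c) (L1N fi) ch.
have {}cf : \forall x \ae P, - c <= - f x by apply: filterS cf => x; rewrite lerN2.
by move=> /(_ cf); apply: filterS => x; rewrite lerN2.
Qed.

(** The difference of the two versions is a conditional expectation of [f - f = 0], hence almost
    surely both at least 0 and at most 0. *)
Lemma cond_exp_unique f h h' : L1 P f -> cond_exp f h -> cond_exp f h' ->
  \forall x \ae P, h (X x) = h' (X x).
Proof.
move=> fi H H'; have := cond_expB fi fi H H' => H0.
have z : L1 P (fun x => f x - f x) by exact: L1B.
have a0 := @cond_exp_ge _ _ 0 z H0 (aeW _ (fun x => _)).
have a1 := @cond_exp_le _ _ 0 z H0 (aeW _ (fun x => _)).
have := a0 _ => {}a0; have := a1 _ => {}a1.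
apply: filterS2 (a0 _) (a1 _) => [x h0 h1|x|x]; rewrite ?subrr//.
by apply/eqP; rewrite -subr_eq0 eq_le h0 h1.
Qed.

Definition clip (a b y : R) : R := Num.max a (Num.min b y).

Lemma clip_id a b y : a <= y -> y <= b -> clip a b y = y.
Proof. by move=> ay yb; rewrite /clip min_r// max_r. Qed.

Lemma clip_itv a b y : a <= b -> a <= clip a b y <= b.
Proof. by move=> ab; rewrite /clip le_max lexx/= ge_max ab ge_min lexx. Qed.

(** Turns bounds that hold almost surely into bounds that hold everywhere, as [bm] demands, without
    leaving the class of versions. *)
Lemma cond_exp_clip f h a b :
  cond_exp f h ->
  (\forall x \ae P, a <= h (X x)) -> (\forall x \ae P, h (X x) <= b) ->
  cond_exp f (fun y => clip a b (h y)) /\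
  (\forall x \ae P, h (X x) = clip a b (h (X x))).
Proof.
move=> fh ah hb.
have E : \forall x \ae P, h (X x) = clip a b (h (X x)).
  by apply: filterS2 ah hb => x ? ?; rewrite clip_id.
split => //; apply: (cond_exp_ae_eqr _ E fh); case: fh => mh _ _.
by apply: measurable_maxr => //; exact: measurable_minr.
Qed.

(* Testing against [h 1_{|h| <= n}] avoids assuming [h] square-integrable. *)
Lemma cond_exp_L2 f h : L2 P f -> cond_exp f h ->
  L2 P (h \o X) /\ nrm P (h \o X) <= nrm P f.
Proof.
move=> f2 [mh hi hf].
have mhX : measurable_fun setT (h \o X) by exact: measurableT_comp.
pose hn n y := h y * (1 - tail h n y).
have bhn n : bm (hn n).
  split.
    apply: measurable_funM => //; apply: measurable_funB => //.
    by case: (bm_tail n mh).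
  exists n%:R => y; rewrite /hn tailE; case: ltP => hy.
    by rewrite subrr mulr0 normr0.
  by rewrite subr0 mulr1.
have bhX n := bm_comp mX (bhn n).
have le n : \int[P]_x (hn n (X x) ^+ 2) <= nrm P f ^+ 2.
  (* The truncation factor is idempotent, so [hn ^ 2 = hn * h], and the bounded test function [hn]
     replaces [h] by [f]. *)
  have : \int[P]_x (hn n (X x) ^+ 2) = \int[P]_x (hn n (X x) * f x).
    rewrite -hf//; apply: eq_int => x; rewrite /hn tailE; case: ltP => _;
      by rewrite ?(subrr, subr0, mulr0, mul0r, mulr1, expr0n) ?expr2.
  rewrite -nrmE => H.
  have := Cauchy_Schwarz (bm_L2 P (bhX n)) f2; rewrite -H ger0_norm ?sqr_ge0// expr2.
  have [->|n0] := eqVneq (nrm P (fun x => hn n (X x))) 0.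
    by rewrite mul0r sqr_ge0.
  have np : 0 < nrm P (fun x => hn n (X x)) by rewrite lt_def n0 nrm_ge0.
  rewrite ler_pM2l// => nf; rewrite -expr2 lerXn2r// nnegrE nrm_ge0//.
have lim : (\int[P]_x (h (X x) ^+ 2)%:E <= (nrm P f ^+ 2)%:E)%E.
  have mono : (\int[P]_x (hn n (X x) ^+ 2)%:E)%E @[n --> \oo] -->
      (\int[P]_x (h (X x) ^+ 2)%:E)%E.
    rewrite (_ : (fun x => (h (X x) ^+ 2)%:E) = (fun x => limn (fun n => (hn n (X x) ^+ 2)%:E))).
      apply: cvg_monotone_convergence => //.
      - by move=> n; apply/measurable_EFinP; case: (bmX 2 (bhX n)).
      - by move=> n x _; rewrite lee_fin sqr_ge0.
      - move=> x _ n m nm; rewrite lee_fin /hn !tailE !exprMn ler_wpM2l ?sqr_ge0//.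
        have nm' : n%:R <= m%:R :> R by rewrite ler_nat.
        case: (ltP m%:R) => hm; case: (ltP n%:R) => hn'; rewrite ?subrr ?subr0 ?expr0n ?expr1n//=.
        by move: (lt_le_trans hm hn'); rewrite ltNge nm'.
    apply/funext => x; apply/esym/cvg_lim => //; apply: cvg_near_cst.
    exists (Num.truncn `|h (X x)|).+1 => //= n /= xn.
    rewrite /hn tailE ltNge (_ : `|h (X x)| <= n%:R) ?subr0 ?mulr1//.
    by rewrite (le_trans (ltW (truncnS_gt _)))// ler_nat.
  rewrite -(cvg_lim _ mono)//; apply: lime_le; first by apply/cvg_ex; eexists; exact: mono.
  by apply: nearW => n; rewrite -EFin_int ?lee_fin//; exact/bm_L1/bmX.
have hL2 : L2 P (h \o X).
  split => //; apply/integrableP; split.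
    by apply/measurable_EFinP; exact: measurable_funX.
  under eq_integral do rewrite /= ger0_norm ?sqr_ge0//.
  by rewrite (le_lt_trans lim)// ltry.
split => //; rewrite -(@ler_pXn2r _ 2)// ?nnegrE ?nrm_ge0// -lee_fin [X in X%:E]nrmE.
by rewrite EFin_int//; case: hL2.
Qed.

End version.

End conditional_expectation.

(** * Hellinger distance and the stability of regressions *)

Section hellinger.
Context d (T : measurableType d) (R : realType)
  (mu : {sigma_finite_measure set T -> \bar R}).
Implicit Types (P : probability T R) (p f : T -> R).

Definition is_density P p :=
  [/\ measurable_fun setT p, forall x, 0 <= p x &
      forall B, measurable B -> P B = (\int[mu]_(x in B) (p x)%:E)%E].

(** The Hellinger distance without the factor [1 / sqrt 2]. *)
Definition hell p1 p0 := nrm mu (fun x => Num.sqrt (p1 x) - Num.sqrt (p0 x)).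

Lemma hell_ge0 p1 p0 : 0 <= hell p1 p0.
Proof. exact: nrm_ge0. Qed.

Lemma hellC p1 p0 : hell p1 p0 = hell p0 p1.
Proof.
rewrite /hell -nrmN /nrm; congr Num.sqrt; apply: eq_int => x.
by rewrite opprB.
Qed.

Section two_laws.
Variables (P1 P0 : probability T R) (p1 p0 : T -> R).
Hypotheses (dp1 : is_density P1 p1) (dp0 : is_density P0 p0).
Local Notation H := (hell p1 p0).
Let r1 x := Num.sqrt (p1 x).
Let r0 x := Num.sqrt (p0 x).

Let dr_L2 : L2 mu (fun x => r1 x - r0 x).
Proof.
case: dp1 dp0 => m1 g1 E1 [m0 g0 E0].
by apply: L2B; [exact: sqrt_L2 E1|exact: sqrt_L2 E0].
Qed.

(** Factor [p1 - p0 = (r1 - r0) (r1 + r0)]: both factors lie in L2 of [mu], so Cauchy-Schwarz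
    applies to each summand. *)
Lemma int_diffE f : L2 P1 f -> L2 P0 f ->
  \int[P1]_x f x - \int[P0]_x f x =
  \int[mu]_x ((r1 x - r0 x) * (f x * r1 x)) +
  \int[mu]_x ((r1 x - r0 x) * (f x * r0 x)).
Proof.
move=> f1 f0; case: dp1 dp0 => m1 g1 E1 [m0 g0 E0].
have fr1 := density_L2 m1 g1 E1 f1; have fr0 := density_L2 m0 g0 E0 f0.
rewrite -intD; [|exact: L2M|exact: L2M].
rewrite -(density_int m1 g1 E1 (L2_L1 f1)) -(density_int m0 g0 E0 (L2_L1 f0)).
rewrite -intB; last 2 first.
- exact: density_mulL1 E1 _ (L2_L1 f1).
- exact: density_mulL1 E0 _ (L2_L1 f0).
apply: eq_int => x.
rewrite -[p1 x]sqr_sqrtr// -[p0 x]sqr_sqrtr// -/(r1 x) -/(r0 x).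
by ring.
Qed.

Lemma int_diff_le f : L2 P1 f -> L2 P0 f ->
  `|\int[P1]_x f x - \int[P0]_x f x| <= H * (nrm P1 f + nrm P0 f).
Proof.
move=> f1 f0; rewrite int_diffE//.
case: dp1 dp0 => m1 g1 E1 [m0 g0 E0].
rewrite (le_trans (ler_normD _ _))// mulrDr lerD//.
- by rewrite -(density_nrm m1 g1 E1 f1) Cauchy_Schwarz//; exact: density_L2 E1 _ f1.
- by rewrite -(density_nrm m0 g0 E0 f0) Cauchy_Schwarz//; exact: density_L2 E0 _ f0.
Qed.

End two_laws.

End hellinger.

Section joint_norm.
Context d (T : measurableType d) (R : realType) (P1 P0 : probability T R).
Implicit Types f g : T -> R.

(** The two norms are summed because the estimate of a regression difference under one law already
    involves its norm under the other; only the sum gives a closed inequality. *)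
Definition nrm2 f := nrm P1 f + nrm P0 f.

Lemma nrm2_ge0 f : 0 <= nrm2 f.
Proof. by rewrite addr_ge0// nrm_ge0. Qed.

Lemma nrm1_nrm2 f : nrm P1 f <= nrm2 f.
Proof. by rewrite lerDl nrm_ge0. Qed.

Lemma nrm2_le f g : bm f -> bm g -> (forall x, `|f x| <= `|g x|) -> nrm2 f <= nrm2 g.
Proof.
by move=> [mf _] bg fg; apply: lerD; apply: nrm_le => //; exact: bm_L2.
Qed.

Lemma nrm2Z c f : bm f -> nrm2 (fun x => c * f x) = `|c| * nrm2 f.
Proof. by move=> bf; rewrite /nrm2 !nrmZ ?mulrDr//; exact: bm_L2. Qed.

Lemma nrm2_leZ c f g : 0 <= c -> bm f -> bm g ->
  (forall x, `|f x| <= c * `|g x|) -> nrm2 f <= c * nrm2 g.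
Proof.
move=> c0 bf bg fg; rewrite -[c]ger0_norm// -nrm2Z//; apply: nrm2_le => //.
  by apply: bmM => //; exact: bm_cst.
by move=> x; rewrite normrM (ger0_norm c0).
Qed.

Lemma nrm2D f g : bm f -> bm g -> nrm2 (fun x => f x + g x) <= nrm2 f + nrm2 g.
Proof.
move=> bf bg; rewrite /nrm2 addrACA.
by apply: lerD; apply: nrmD; exact: bm_L2.
Qed.

Lemma nrm2_norm f : nrm2 (fun x => `|f x|) = nrm2 f.
Proof.
rewrite /nrm2 /nrm; congr (Num.sqrt _ + Num.sqrt _); apply: eq_int => x;
by rewrite real_normK ?num_real.
Qed.

End joint_norm.

Section rate.
Context d d' (T : measurableType d) (T' : measurableType d') (R : realType)
  (mu : {sigma_finite_measure set T -> \bar R}) (X : T -> T').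
Hypothesis mX : measurable_fun setT X.

Section one_sided.
Variables (P1 P0 : probability T R) (p1 p0 : T -> R).
Hypotheses (dp1 : is_density mu P1 p1) (dp0 : is_density mu P0 p0).
Variables (f1 f0 : T -> R) (h1 h0 : T' -> R).
Hypotheses (bf1 : bm f1) (bf0 : bm f0) (bh1 : bm h1) (bh0 : bm h0)
  (fh1 : cond_exp P1 X f1 h1) (fh0 : cond_exp P0 X f0 h0)
  (f0h0 : forall x, `|f0 x - h0 (X x)| <= 1).
Let D x := h1 (X x) - h0 (X x).

(* [E_1 D^2 = E_1[(f1 - f0) D] + (E_1 - E_0)[(f0 - h0) D]]. *)
Lemma cond_exp_diff_le :
  \int[P1]_x (D x ^+ 2) <=
  nrm2 P1 P0 D * (nrm2 P1 P0 (fun x => f1 x - f0 x) + hell mu p1 p0).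
Proof.
have bh1X := bm_comp mX bh1; have bh0X := bm_comp mX bh0.
have bD : bm D by exact: bmB.
have bg : bm (fun y => h1 y - h0 y) by exact: bmB.
have -> : \int[P1]_x (D x ^+ 2) = \int[P1]_x ((f1 x - f0 x) * D x) +
    (\int[P1]_x ((f0 x - h0 (X x)) * D x) - \int[P0]_x ((f0 x - h0 (X x)) * D x)).
  have -> : \int[P0]_x ((f0 x - h0 (X x)) * D x) = 0.
    rewrite (@eq_int _ _ _ _ _ (fun x => D x * f0 x - D x * h0 (X x))); last first.
      by move=> x; ring.
    rewrite intB; [|by apply: bm_L1; bmt|by apply: bm_L1; bmt].
    by case: fh0 => _ _ /(_ _ bg) ->; rewrite subrr.
  rewrite subr0 -intD; [|by apply: bm_L1; bmt|by apply: bm_L1; bmt].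
  rewrite (@eq_int _ _ _ _ _ (fun x => D x * h1 (X x) - D x * h0 (X x))); last first.
    by move=> x; rewrite /D; ring.
  rewrite (@eq_int _ _ _ _ (fun x => _ + _) (fun x => D x * f1 x - D x * h0 (X x))); last first.
    by move=> x; rewrite /D; ring.
  rewrite !intB; try by apply: bm_L1; bmt.
  by case: fh1 => _ _ /(_ _ bg) ->.
rewrite mulrDr lerD//.
  rewrite (le_trans (ler_norm _))// (le_trans (Cauchy_Schwarz _ _))//; [exact/bm_L2/bmB|exact: bm_L2|].
  by rewrite mulrC ler_pM ?nrm_ge0 ?nrm1_nrm2.
rewrite (le_trans (ler_norm _))//.
rewrite (le_trans (int_diff_le dp1 dp0 _ _))//; try by apply: bm_L2; bmt.
rewrite mulrC ler_wpM2r ?hell_ge0// -[leRHS]mul1r.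
apply: nrm2_leZ => //; first by bmt.
by move=> x; rewrite normrM ler_wpM2r.
Qed.

End one_sided.

Variables (P1 P0 : probability T R) (p1 p0 : T -> R).
Hypotheses (dp1 : is_density mu P1 p1) (dp0 : is_density mu P0 p0).

(** Let [a], [b] be the norms of the difference under the two laws, [N = a + b], and [S] the
    parenthesis on the right. The one-sided bounds give [a ^ 2 <= N * S] and [b ^ 2 <= N * S], so
    [N ^ 2 <= 2 (a ^ 2 + b ^ 2) <= 4 N * S]; divide by [N]. *)
Lemma cond_exp_rate (f1 f0 : T -> R) (h1 h0 : T' -> R) :
  bm f1 -> bm f0 -> bm h1 -> bm h0 ->
  cond_exp P1 X f1 h1 -> cond_exp P0 X f0 h0 ->
  (forall x, `|f1 x - h1 (X x)| <= 1) -> (forall x, `|f0 x - h0 (X x)| <= 1) ->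
  nrm2 P1 P0 (fun x => h1 (X x) - h0 (X x)) <=
  4 * (nrm2 P1 P0 (fun x => f1 x - f0 x) + hell mu p1 p0).
Proof.
move=> bf1 bf0 bh1 bh0 c1 c0 g1 g0.
have bD : bm (fun x => h1 (X x) - h0 (X x)).
  by apply: bmB; exact: bm_comp.
have L := cond_exp_diff_le dp1 dp0 bf1 bf0 bh1 bh0 c1 c0 g0.
have := cond_exp_diff_le dp0 dp1 bf0 bf1 bh0 bh1 c0 c1 g1.
have NC f g : nrm2 P0 P1 (fun x => f x - g x) = nrm2 P1 P0 (fun x => g x - f x).
  rewrite /nrm2 addrC; congr (_ + _); rewrite -nrmN /nrm; congr Num.sqrt;
  by apply: eq_int => x; rewrite opprB.
rewrite !NC hellC (@eq_int _ _ _ _ _ (fun x => (h1 (X x) - h0 (X x)) ^+ 2)); last first.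
  by move=> x; ring.
move: L; rewrite -!nrmE.
set ND := nrm2 _ _ _; set S := _ + hell _ _ _ => L1 L0.
have NDE : ND = nrm P1 (fun x => h1 (X x) - h0 (X x)) + nrm P0 (fun x => h1 (X x) - h0 (X x)) by [].
have ND0 : 0 <= ND by exact: nrm2_ge0.
have [->|NDn0] := eqVneq ND 0.
  by rewrite mulr_ge0// addr_ge0 ?nrm2_ge0 ?hell_ge0.
have NDp : 0 < ND by rewrite lt_def NDn0.
rewrite -(ler_pM2l NDp).
move: L1 L0; set a := nrm P1 _ in NDE *; set b := nrm P0 _ in NDE *.
move=> L1 L0; have := sqr_ge0 (a - b); rewrite {1}NDE NDE in L1 L0 *; lra.
Qed.

End rate.

(** * Expansion of the functional between two laws *)

Section observed.
Context {R : realType} {dZ dL} {TZ : measurableType dZ} {TL : measurableType dL}.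
Local Notation O := (TZ * bool * R * TL)%type.

Lemma measurable_oZ : measurable_fun setT (@oZ R _ _ TZ TL).
Proof.
by apply: measurableT_comp => //; apply: measurableT_comp.
Qed.

Lemma measurable_oA : measurable_fun setT (@oA R _ _ TZ TL).
Proof. by apply: measurableT_comp => //; apply: measurableT_comp. Qed.

Lemma measurable_oY : measurable_fun setT (@oY R _ _ TZ TL).
Proof. exact: measurableT_comp. Qed.

Lemma measurable_oL : measurable_fun setT (@oL R _ _ TZ TL).
Proof. exact: measurable_snd. Qed.

Lemma measurable_oZL : measurable_fun setT (@oZL R _ _ TZ TL).
Proof. by apply: measurable_fun_pair; [exact: measurable_oZ|exact: measurable_oL]. Qed.

Lemma oAr_indic : @oAr R _ _ TZ TL = \1_(@oA R _ _ TZ TL @^-1` [set true]).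
Proof.
apply/funext => o; rewrite /oAr indicE; congr (nat_of_bool _)%:R.
by apply/idP/idP; rewrite inE.
Qed.

Lemma measurable_oA_set a : measurable (@oA R _ _ TZ TL @^-1` [set a]).
Proof. by rewrite -[X in measurable X]setTI; exact: measurable_oA. Qed.

Lemma bm_oAr : bm (@oAr R _ _ TZ TL).
Proof. by rewrite oAr_indic; apply: bm_indic; exact: measurable_oA_set. Qed.

Lemma oAr_01 (o : O) : 0 <= oAr o <= 1.
Proof. by rewrite /oAr; case: (oA o); rewrite ?lexx ler01. Qed.

(* [psi_star Q] is the [Q]-mean of [Y] times this weight. *)
Definition iv_weight (pi : TZ * TL -> R) (delta kappa : TL -> R) (o : O) :=
  (pi (oZL o) - delta (oL o)) / kappa (oL o).

(** The covariance of [A] and [pi] given [L] equals the variance of [pi] given [L]; [kappa] is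
    specified as the latter, the quantity that relevance bounds from below. The range constraints
    hold everywhere, not just almost surely. *)
Record good_nuisance (Q : probability O R) (eps : R) (pi : TZ * TL -> R)
    (delta kappa : TL -> R) : Prop := {
  gn_bpi : bm pi;
  gn_bdelta : bm delta;
  gn_bkappa : bm kappa;
  gn_pi01 : forall z, 0 <= pi z <= 1;
  gn_delta01 : forall l, 0 <= delta l <= 1;
  gn_kappa : forall l, eps <= kappa l <= 1;
  gn_pi : cond_exp Q oZL oAr pi;
  gn_delta : cond_exp Q oL oAr delta;
  gn_kappaE :
    cond_exp Q oL (fun o => (pi (oZL o) - delta (oL o)) ^+ 2) kappa }.

Section bounded_facts.
Variables (Q : probability O R) (eps : R) (pi : TZ * TL -> R)
  (delta kappa : TL -> R).
Hypotheses (e0 : 0 < eps) (G : good_nuisance Q eps pi delta kappa).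

Lemma gn_piO : bm (fun o : O => pi (oZL o)).
Proof. exact: (bm_comp measurable_oZL (gn_bpi G)). Qed.

Lemma gn_deltaO : bm (fun o : O => delta (oL o)).
Proof. exact: (bm_comp measurable_oL (gn_bdelta G)). Qed.

Lemma gn_kappaO : bm (fun o : O => kappa (oL o)).
Proof. exact: (bm_comp measurable_oL (gn_bkappa G)). Qed.

Lemma gn_kappaV : bm (fun l => (kappa l)^-1).
Proof.
by apply: (bmV e0 _ (gn_bkappa G)) => l; case/andP: (gn_kappa G l).
Qed.

Lemma gn_kappaVO : bm (fun o : O => (kappa (oL o))^-1).
Proof. exact: (bm_comp measurable_oL gn_kappaV). Qed.

Lemma gn_kappa_gt0 l : 0 < kappa l.
Proof. by case/andP: (gn_kappa G l) => /(lt_le_trans e0). Qed.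

Lemma gn_kappaV_le l : `|(kappa l)^-1| <= eps^-1.
Proof.
rewrite normfV gtr0_norm ?gn_kappa_gt0// lef_pV2 ?posrE ?gn_kappa_gt0//.
by case/andP: (gn_kappa G l).
Qed.

Lemma gn_U : bm (iv_weight pi delta kappa).
Proof.
have := gn_kappaVO; have := gn_piO; have := gn_deltaO => ? ? ?.
by rewrite /iv_weight; bmt.
Qed.

Lemma gn_diff1 (o : O) : `|pi (oZL o) - delta (oL o)| <= 1.
Proof.
exact: ler_dist01 (gn_pi01 G _) (gn_delta01 G _).
Qed.

Lemma gn_U_le o : `|iv_weight pi delta kappa o| <= eps^-1.
Proof.
rewrite /iv_weight normrM -[leRHS]mul1r ler_pM//; first exact: gn_diff1.
exact: gn_kappaV_le.
Qed.

End bounded_facts.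

Section rates.
Variables (mu : {sigma_finite_measure set O -> \bar R}).
Variables (P1 P0 : probability O R) (p1 p0 : O -> R) (eps : R).
Hypotheses (e0 : 0 < eps) (dp1 : is_density mu P1 p1) (dp0 : is_density mu P0 p0).
Variables (pi1 pi0 : TZ * TL -> R) (delta1 kappa1 delta0 kappa0 : TL -> R).
Hypotheses (G1 : good_nuisance P1 eps pi1 delta1 kappa1)
  (G0 : good_nuisance P0 eps pi0 delta0 kappa0).
Local Notation H := (hell mu p1 p0).
Local Notation N := (nrm2 P1 P0).

Let Dpi (o : O) := pi1 (oZL o) - pi0 (oZL o).
Let Dde (o : O) := delta1 (oL o) - delta0 (oL o).
Let Dka (o : O) := kappa1 (oL o) - kappa0 (oL o).
Let DU (o : O) := iv_weight pi1 delta1 kappa1 o - iv_weight pi0 delta0 kappa0 o.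

Let bpi1 := gn_piO G1.
Let bpi0 := gn_piO G0.
Let bde1 := gn_deltaO G1.
Let bde0 := gn_deltaO G0.
Let bka1 := gn_kappaO G1.
Let bka0 := gn_kappaO G0.

Let N00 : N (fun x => oAr x - oAr x) = 0.
Proof.
rewrite /nrm2 /nrm.
have z : (fun x : O => (oAr x - oAr x) ^+ 2) = (fun=> 0 : R).
  by apply/funext => o; rewrite subrr expr0n.
by rewrite z !int_cst sqrtr0 addr0.
Qed.

Lemma pi_rate : N Dpi <= 4 * H.
Proof.
have := @cond_exp_rate _ _ _ _ _ mu _ measurable_oZL P1 P0 _ _ dp1 dp0
  oAr oAr pi1 pi0 bm_oAr bm_oAr (gn_bpi G1) (gn_bpi G0) (gn_pi G1) (gn_pi G0).
rewrite N00 add0r; apply=> o; apply: ler_dist01; rewrite ?oAr_01//.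
- exact: gn_pi01 G1 _.
- exact: gn_pi01 G0 _.
Qed.

Lemma delta_rate : N Dde <= 4 * H.
Proof.
have := @cond_exp_rate _ _ _ _ _ mu _ measurable_oL P1 P0 _ _ dp1 dp0
  oAr oAr _ _ bm_oAr bm_oAr (gn_bdelta G1) (gn_bdelta G0) (gn_delta G1) (gn_delta G0).
rewrite N00 add0r; apply=> o; apply: ler_dist01; rewrite ?oAr_01//.
- exact: gn_delta01 G1 _.
- exact: gn_delta01 G0 _.
Qed.

Let sq01 (Q : probability O R) pi delta kappa : good_nuisance Q eps pi delta kappa ->
  forall o : O, 0 <= (pi (oZL o) - delta (oL o)) ^+ 2 <= 1.
Proof.
move=> G o; rewrite sqr_ge0 -real_normK ?num_real//=.
by rewrite exprn_ile1// (gn_diff1 G).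
Qed.

Let kap01 (Q : probability O R) pi delta kappa : good_nuisance Q eps pi delta kappa ->
  forall l, 0 <= kappa l <= 1.
Proof.
by move=> G l; rewrite (ltW (gn_kappa_gt0 e0 G l)); case/andP: (gn_kappa G l).
Qed.

(** Here the regressed variable itself changes with the law. A difference of squares of numbers
    bounded by 1 is at most twice the difference, so this change is at most [2 (4 + 4) H = 16 H],
    and [4 (16 + 1) = 68]. *)
Lemma kappa_rate : N Dka <= 68 * H.
Proof.
have bD : bm Dpi by exact: bmB.
have bD' : bm Dde by exact: bmB.
have rt := @cond_exp_rate _ _ _ _ _ mu _ measurable_oL P1 P0 _ _ dp1 dp0
  (fun o => (pi1 (oZL o) - delta1 (oL o)) ^+ 2)
  (fun o => (pi0 (oZL o) - delta0 (oL o)) ^+ 2) _ _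
  (bmX 2 (bmB bpi1 bde1)) (bmX 2 (bmB bpi0 bde0)) (gn_bkappa G1) (gn_bkappa G0)
  (gn_kappaE G1) (gn_kappaE G0).
apply: le_trans (rt _ _) _.
- by move=> o; apply: ler_dist01; [exact: (sq01 G1)|exact: (kap01 G1)].
- by move=> o; apply: ler_dist01; [exact: (sq01 G0)|exact: (kap01 G0)].
have S : N (fun o => `|Dpi o| + `|Dde o|) <= 8 * H.
  rewrite (le_trans (nrm2D _ _ _ _))//; [exact: bm_norm|exact: bm_norm|].
  by rewrite !nrm2_norm; have := pi_rate; have := delta_rate; lra.
suff : N (fun x => (pi1 (oZL x) - delta1 (oL x)) ^+ 2 -
    (pi0 (oZL x) - delta0 (oL x)) ^+ 2) <= 2 * N (fun o => `|Dpi o| + `|Dde o|).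
  by lra.
apply: nrm2_leZ => //; [by bmt|by bmt|] => o.
rewrite subr_sqr normrM mulrC ler_pM//.
  rewrite (le_trans (ler_normD _ _))//.
  by have := gn_diff1 G1 o; have := gn_diff1 G0 o; lra.
rewrite [leRHS]ger0_norm ?addr_ge0// (le_trans _ (ler_normB _ _))//.
by rewrite le_eqVlt; apply/orP; left; apply/eqP; congr `|_|; rewrite /Dpi /Dde; ring.
Qed.

(** Here [8 = 4 + 4] comes from [pi_rate] and [delta_rate], and [68] from [kappa_rate]; the inner
    [eps^-1] bounds the weight and the outer one bounds [1 / kappa0]. *)
Definition CU := eps^-1 * (8 + eps^-1 * 68).

Lemma CU_ge0 : 0 <= CU.
Proof. by rewrite mulr_ge0 ?addr_ge0 ?mulr_ge0 ?invr_ge0 ?ltW. Qed.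

Lemma U_rate : N DU <= CU * H.
Proof.
have bD : bm Dpi by exact: bmB.
have bD' : bm Dde by exact: bmB.
have bD'' : bm Dka by exact: bmB.
have bU1 := gn_U e0 G1; have bU0 := gn_U e0 G0.
have ei : 0 <= eps^-1 by rewrite invr_ge0 ltW.
apply: (@le_trans _ _ (eps^-1 * N (fun o => (`|Dpi o| + `|Dde o|) + eps^-1 * `|Dka o|))).
  apply: nrm2_leZ => //; [by bmt|by bmt|] => o.
  (* Quotient rule for [(pi - delta) / kappa], arranged so that the coefficient of [Dka] is the
     bounded weight itself. *)
  have -> : DU o = (kappa0 (oL o))^-1 *
      (Dpi o - Dde o - iv_weight pi1 delta1 kappa1 o * Dka o).
    rewrite /DU /iv_weight /Dpi /Dde /Dka; field.
    by rewrite (gt_eqF (gn_kappa_gt0 e0 G1 _)) (gt_eqF (gn_kappa_gt0 e0 G0 _)).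
  rewrite normrM ler_pM//; first exact: gn_kappaV_le G0 _.
  rewrite [leRHS]ger0_norm ?addr_ge0 ?mulr_ge0//.
  rewrite (le_trans (ler_normB _ _))// lerD//; first exact: ler_normB.
  by rewrite normrM ler_wpM2r// (gn_U_le e0 G1).
rewrite /CU -mulrA ler_wpM2l//.
rewrite (le_trans (nrm2D _ _ _ _))//; [by bmt|by bmt|].
rewrite nrm2Z ?nrm2_norm; last exact: bm_norm.
rewrite (le_trans (lerD (nrm2D _ _ _ _) (lexx _)))//; [exact: bm_norm|exact: bm_norm|].
rewrite !nrm2_norm (ger0_norm ei).
have := pi_rate; have := delta_rate.
have := ler_wpM2l ei kappa_rate; lra.
Qed.

End rates.

(* [influence] is [phi] without its centering, with [Y] replaced by [f]; here
   [xi], [eta] and [gam] stand for [E[f|Z,L]], [E[f|L]] and [E[f u|L]]. *)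
Definition influence (pi : TZ * TL -> R) (delta kappa : TL -> R) (f : O -> R)
    (xi : TZ * TL -> R) (eta gam : TL -> R) (o : O) : R :=
  f o * iv_weight pi delta kappa o
  + (xi (oZL o) * (oAr o - pi (oZL o)) - eta (oL o) * (oAr o - delta (oL o)))
    / kappa (oL o)
  + gam (oL o) / kappa (oL o) * (kappa (oL o) + (oAr o - pi (oZL o)) ^+ 2
                                 - (oAr o - delta (oL o)) ^+ 2).

Section expansion.
Variables (P1 : probability O R) (eps : R).
Hypothesis e0 : 0 < eps.
Variables (pi1 pi0 : TZ * TL -> R) (delta1 kappa1 delta0 kappa0 : TL -> R).
Hypothesis G1 : good_nuisance P1 eps pi1 delta1 kappa1.
Hypotheses (bpi0 : bm pi0) (bdelta0 : bm delta0) (bkappa0 : bm kappa0)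
  (kappa0_ge : forall l, eps <= kappa0 l).
Variables (f : O -> R) (xi : TZ * TL -> R) (eta gam : TL -> R).
Hypotheses (bf : bm f) (bxi : bm xi) (beta : bm eta) (bgam : bm gam).

Let Dpi (o : O) := pi1 (oZL o) - pi0 (oZL o).
Let Dde (o : O) := delta1 (oL o) - delta0 (oL o).
Let Dka (o : O) := kappa1 (oL o) - kappa0 (oL o).
Let DU (o : O) := iv_weight pi1 delta1 kappa1 o - iv_weight pi0 delta0 kappa0 o.
Let k0V (l : TL) := (kappa0 l)^-1.

Let bpi1O := gn_piO G1.
Let bpi0O := bm_comp measurable_oZL bpi0.
Let bde1O := gn_deltaO G1.
Let bde0O := bm_comp measurable_oL bdelta0.
Let bka1O := gn_kappaO G1.
Let bka0O := bm_comp measurable_oL bkappa0.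
Let bxiO := bm_comp measurable_oZL bxi.
Let betaO := bm_comp measurable_oL beta.
Let bgamO := bm_comp measurable_oL bgam.
Let bk0V : bm k0V := bmV e0 kappa0_ge bkappa0.
Let bk0VO := bm_comp measurable_oL bk0V.
Let bU1 := gn_U e0 G1.
Let bU0 : bm (iv_weight pi0 delta0 kappa0).
Proof. by apply: bmM => //; exact: bmB. Qed.

(** In [rem_pi], [rem_delta] and [rem_kappa] one nuisance difference multiplies a residual that is
    centred under [P0] when [xi], [eta] and [gam] are the regressions under [P0]; [rem_U] and
    [rem_sq] are quadratic in the differences. *)
Definition rem_pi (o : O) := (f o - xi (oZL o)) * (Dpi o * k0V (oL o)).
Definition rem_delta (o : O) := (f o - eta (oL o)) * (Dde o * k0V (oL o)).
Definition rem_U (o : O) := f o * (DU o * Dka o) * k0V (oL o).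
Definition rem_kappa (o : O) :=
  (f o * iv_weight pi0 delta0 kappa0 o - gam (oL o)) * (Dka o * k0V (oL o)).
Definition rem_sq (o : O) := gam (oL o) * k0V (oL o) * (Dpi o ^+ 2 - Dde o ^+ 2).

Let bDpi : bm Dpi. Proof. exact: bmB. Qed.
Let bDde : bm Dde. Proof. exact: bmB. Qed.
Let bDka : bm Dka. Proof. exact: bmB. Qed.
Let bDU : bm DU. Proof. exact: bmB. Qed.

Lemma bm_rem_pi : bm rem_pi. Proof. by rewrite /rem_pi; bmt. Qed.
Lemma bm_rem_delta : bm rem_delta. Proof. by rewrite /rem_delta; bmt. Qed.
Lemma bm_rem_U : bm rem_U. Proof. by rewrite /rem_U; bmt. Qed.
Lemma bm_rem_kappa : bm rem_kappa. Proof. by rewrite /rem_kappa; bmt. Qed.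
Lemma bm_rem_sq : bm rem_sq. Proof. by rewrite /rem_sq; bmt. Qed.
Lemma bm_influence : bm (influence pi0 delta0 kappa0 f xi eta gam).
Proof. by have := bm_oAr => ?; rewrite /influence -/(k0V _); bmt. Qed.

(* The integrands agree up to multiples of [A - pi1], [A - delta1] and
   [(pi1 - delta1) ^ 2 - kappa1] that integrate to zero under [P1]. *)
Lemma expansion :
  \int[P1]_o (f o * iv_weight pi1 delta1 kappa1 o) =
  \int[P1]_o influence pi0 delta0 kappa0 f xi eta gam o
  + \int[P1]_o rem_pi o - \int[P1]_o rem_delta o - \int[P1]_o rem_U o
  - \int[P1]_o rem_kappa o - \int[P1]_o rem_sq o.
Proof.
have bA := bm_oAr.
pose w l := gam l * k0V l.
have bw : bm w by exact: bmM.
(* The square of [A] cancels between [(A - pi0) ^ 2] and [(A - delta0) ^ 2], so the integrand is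
   linear in [A]; [g1] and [g2] collect the coefficients with which [A] is traded for [pi1] and
   [delta1]. Their terms in [delta1] come from [pi1 ^ 2 - delta1 ^ 2 = (pi1 - delta1) ^ 2 + 2 delta1
   (pi1 - delta1)]. *)
pose g1 (z : TZ * TL) :=
  xi z * k0V z.2 - 2 * w z.2 * pi0 z + 2 * w z.2 * delta1 z.2.
pose g2 (l : TL) := - (eta l * k0V l) + 2 * w l * delta0 l - 2 * w l * delta1 l.
have snd_bm (g : TL -> R) : bm g -> bm (fun z : TZ * TL => g z.2) by exact: bm_comp.
have bg1 : bm g1.
  have ? := snd_bm _ bk0V; have ? := snd_bm _ bw; have ? := snd_bm _ (gn_bdelta G1).
  by rewrite /g1; bmt.
have bg2 : bm g2 by have ? := gn_bdelta G1; rewrite /g2; bmt.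
have bg1O := bm_comp measurable_oZL bg1.
have bg2O := bm_comp measurable_oL bg2.
have bwO := bm_comp measurable_oL bw.
have z1 : \int[P1]_o (g1 (oZL o) * pi1 (oZL o) - g1 (oZL o) * oAr o) = 0.
  rewrite intB; [|by apply: bm_L1; bmt|by apply: bm_L1; bmt].
  by case: (gn_pi G1) => _ _ /(_ _ bg1) ->; rewrite subrr.
have z2 : \int[P1]_o (g2 (oL o) * delta1 (oL o) - g2 (oL o) * oAr o) = 0.
  rewrite intB; [|by apply: bm_L1; bmt|by apply: bm_L1; bmt].
  by case: (gn_delta G1) => _ _ /(_ _ bg2) ->; rewrite subrr.
have z3 : \int[P1]_o (w (oL o) * kappa1 (oL o) -
    w (oL o) * (pi1 (oZL o) - delta1 (oL o)) ^+ 2) = 0.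
  rewrite intB; [|by apply: bm_L1; bmt|by apply: bm_L1; bmt].
  by case: (gn_kappaE G1) => _ _ /(_ _ bw) ->; rewrite subrr.
have bi := bm_influence; have b1 := bm_rem_pi; have b2 := bm_rem_delta.
have b3 := bm_rem_U; have b4 := bm_rem_kappa; have b5 := bm_rem_sq.
rewrite -[RHS]addr0 -[in RHS]z1 -[RHS]addr0 -[in RHS]z2 -[RHS]subr0 -[in RHS]z3.
rewrite -!(intD, intB); try by apply: bm_L1; bmt.
apply: eq_int => o.
rewrite /influence /rem_pi /rem_delta /rem_U /rem_kappa /rem_sq /DU /Dka /Dpi /Dde.
rewrite /g1 /g2 /w /iv_weight /k0V /=.
field.
by rewrite (gt_eqF (gn_kappa_gt0 e0 G1 _)) (gt_eqF (lt_le_trans e0 (kappa0_ge _))).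
Qed.

End expansion.

End observed.

Lemma ler_norm_rem (R : realFieldType) (I0 I1 r1 r2 r3 r4 r5 c1 c2 c3 c4 c5 : R) :
  `|r1| <= c1 -> `|r2| <= c2 -> `|r3| <= c3 -> `|r4| <= c4 -> `|r5| <= c5 ->
  `|I1 + r1 - r2 - r3 - r4 - r5 - I0 - (I1 - I0)| <= c1 + c2 + c3 + c4 + c5.
Proof. by rewrite !ler_norml; lra. Qed.

(** * Bounds on the increment of the functional between two laws *)

Section differences.
Context {R : realType} {dZ dL} {TZ : measurableType dZ} {TL : measurableType dL}.
Local Notation O := (TZ * bool * R * TL)%type.
Variables (mu : {sigma_finite_measure set O -> \bar R}).
Variables (P0 : probability O R) (p0 : O -> R) (eps : R).
Hypotheses (e0 : 0 < eps) (dp0 : is_density mu P0 p0).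
Variables (pi0 : TZ * TL -> R) (delta0 kappa0 : TL -> R).
Hypothesis (G0 : good_nuisance P0 eps pi0 delta0 kappa0).
Local Notation u0 := (iv_weight pi0 delta0 kappa0).

Let ei : 0 <= eps^-1. Proof. by rewrite invr_ge0 ltW. Qed.

Section bounded.
Variables (f : O -> R) (xi : TZ * TL -> R) (eta gam : TL -> R) (K : R).
Hypotheses (bf : bm f) (bxi : bm xi) (beta : bm eta) (bgam : bm gam).
Hypotheses (fK : forall o, `|f o| <= K) (xiK : forall z, `|xi z| <= K)
  (etaK : forall l, `|eta l| <= K) (gamK : forall l, `|gam l| <= K).
Hypotheses (fxi : cond_exp P0 oZL f xi) (feta : cond_exp P0 oL f eta)
  (fgam : cond_exp P0 oL (fun o => f o * u0 o) gam).
Local Notation inf0 := (influence pi0 delta0 kappa0 f xi eta gam).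

Let kap_ge l : eps <= kappa0 l. Proof. by case/andP: (gn_kappa G0 l). Qed.

Let K0 : 0 <= K. Proof. exact: le_trans (normr_ge0 _) (fK point). Qed.

(** The expansion of [P0] against itself: every remainder contains a vanishing nuisance
    difference. *)
Lemma influence_mean : \int[P0]_o inf0 o = \int[P0]_o (f o * u0 o).
Proof.
rewrite (expansion e0 G0 (gn_bpi G0) (gn_bdelta G0) (gn_bkappa G0) kap_ge
  bf bxi beta bgam).
have z (g : O -> R) : (forall o, g o = 0) -> \int[P0]_o g o = 0.
  by move=> g0; rewrite (eq_int _ g0) int_cst.
rewrite !(z (rem_pi _ _ _ _ _)) ?(z (rem_delta _ _ _ _ _)) ?(z (rem_U _ _ _ _ _ _ _))
  ?(z (rem_kappa _ _ _ _ _ _ _)) ?(z (rem_sq _ _ _ _ _ _)) ?subr0 ?addr0// => o;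
  by rewrite /rem_pi /rem_delta /rem_U /rem_kappa /rem_sq !subrr; ring.
Qed.

(** One summand per remainder, in the order of [expansion]: [8 = 2 * 4] twice for the regressions of
    [f], [68 * CU] for the product of [DU] and [Dka], [68 (eps^-1 + 1)] for the residual
    [f u0 - gam], and [32 = 4 ^ 2 + 4 ^ 2] for the squares. *)
Definition Cbounded : R := K * eps^-1 * (8 + 8 + 68 * CU eps + 68 * (eps^-1 + 1) + 32).

Lemma bounded_expansion (P1 : probability O R) (p1 : O -> R) pi1 delta1 kappa1 :
  is_density mu P1 p1 -> good_nuisance P1 eps pi1 delta1 kappa1 ->
  `|\int[P1]_o (f o * iv_weight pi1 delta1 kappa1 o) - \int[P0]_o (f o * u0 o) -
    (\int[P1]_o inf0 o - \int[P0]_o inf0 o)| <= Cbounded * hell mu p1 p0 ^+ 2.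
Proof.
move=> dp1 G1; rewrite influence_mean.
rewrite (expansion e0 G1 (gn_bpi G0) (gn_bdelta G0) (gn_bkappa G0) kap_ge
  bf bxi beta bgam).
have b1 := bm_rem_pi e0 G1 (gn_bpi G0) (gn_bkappa G0) kap_ge bf bxi.
have b2 := bm_rem_delta e0 G1 (gn_bdelta G0) (gn_bkappa G0) kap_ge bf beta.
have b4 := bm_rem_kappa e0 G1 (gn_bpi G0) (gn_bdelta G0) (gn_bkappa G0) kap_ge bf bgam.
have bk0V := gn_kappaV e0 G0; have bk0VO := gn_kappaVO e0 G0.
have k0V_le := gn_kappaV_le e0 G0.
have bpi1 := gn_bpi G1; have bpi0 := gn_bpi G0.
have bde1 := gn_bdelta G1; have bde0 := gn_bdelta G0.
have bka1 := gn_bkappa G1; have bka0 := gn_bkappa G0.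
have bpi1O := gn_piO G1; have bpi0O := gn_piO G0.
have bde1O := gn_deltaO G1; have bde0O := gn_deltaO G0.
have bka1O := gn_kappaO G1; have bka0O := gn_kappaO G0.
have bxiO := bm_comp (@measurable_oZL R _ _ TZ TL) bxi.
have betaO := bm_comp (@measurable_oL R _ _ TZ TL) beta.
have bgamO := bm_comp (@measurable_oL R _ _ TZ TL) bgam.
have bU1 := gn_U e0 G1; have bU0 := gn_U e0 G0.
have rpi := pi_rate dp1 dp0 G1 G0; have rde := delta_rate dp1 dp0 G1 G0.
have rka := kappa_rate e0 dp1 dp0 G1 G0; have rU := U_rate e0 dp1 dp0 G1 G0.
set H := hell mu p1 p0 in rpi rde rka rU *.
have H0 : 0 <= H by exact: hell_ge0.
have snd_bm (g : TL -> R) : bm g -> bm (fun z : TZ * TL => g z.2) by exact: bm_comp.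
have z1 : \int[P0]_o rem_pi pi1 pi0 kappa0 f xi o = 0.
  pose g z := (pi1 z - pi0 z) * (kappa0 z.2)^-1.
  have bg : bm g by have ? := snd_bm _ bk0V; rewrite /g; bmt.
  have bgO := bm_comp (@measurable_oZL R _ _ TZ TL) bg.
  rewrite (@eq_int _ _ _ _ _ (fun o => g (oZL o) * f o - g (oZL o) * xi (oZL o))).
    rewrite intB; [|by apply: bm_L1; bmt|by apply: bm_L1; bmt].
    by case: fxi => _ _ /(_ _ bg) ->; rewrite subrr.
  by move=> o; rewrite /rem_pi /g /=; ring.
have z2 : \int[P0]_o rem_delta delta1 delta0 kappa0 f eta o = 0.
  pose g l := (delta1 l - delta0 l) * (kappa0 l)^-1.
  have bg : bm g by rewrite /g; bmt.
  have bgO := bm_comp (@measurable_oL R _ _ TZ TL) bg.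
  rewrite (@eq_int _ _ _ _ _ (fun o => g (oL o) * f o - g (oL o) * eta (oL o))).
    rewrite intB; [|by apply: bm_L1; bmt|by apply: bm_L1; bmt].
    by case: feta => _ _ /(_ _ bg) ->; rewrite subrr.
  by move=> o; rewrite /rem_delta /g /=; ring.
have z4 : \int[P0]_o rem_kappa pi0 kappa1 delta0 kappa0 f gam o = 0.
  pose g l := (kappa1 l - kappa0 l) * (kappa0 l)^-1.
  have bg : bm g by rewrite /g; bmt.
  have bgO := bm_comp (@measurable_oL R _ _ TZ TL) bg.
  rewrite (@eq_int _ _ _ _ _ (fun o => g (oL o) * (f o * u0 o) - g (oL o) * gam (oL o))).
    rewrite intB; [|by apply: bm_L1; bmt|by apply: bm_L1; bmt].
    by case: fgam => _ _ /(_ _ bg) ->; rewrite subrr.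
  by move=> o; rewrite /rem_kappa /g /=; ring.
pose Dpi (o : O) := pi1 (oZL o) - pi0 (oZL o).
pose Dde (o : O) := delta1 (oL o) - delta0 (oL o).
pose Dka (o : O) := kappa1 (oL o) - kappa0 (oL o).
pose DU (o : O) := iv_weight pi1 delta1 kappa1 o - u0 o.
have bDpi : bm Dpi by exact: bmB.
have bDde : bm Dde by exact: bmB.
have bDka : bm Dka by exact: bmB.
have bDU : bm DU by exact: bmB.
(* Applied to the centred remainders: one factor [H] comes from [int_diff_le], the other from the
   rate of the nuisance difference [D] that dominates [g]. *)
have cross (g D : O -> R) c b : 0 <= c -> bm g -> bm D ->
    (forall o, `|g o| <= c * `|D o|) -> nrm2 P1 P0 D <= b * H ->
    \int[P0]_o g o = 0 -> `|\int[P1]_o g o| <= c * b * H ^+ 2.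
  move=> c0 bg bD gD NDb g0.
  have := int_diff_le dp1 dp0 (bm_L2 _ bg) (bm_L2 _ bg).
  rewrite g0 subr0 => /le_trans; apply.
  rewrite expr2 mulrA mulrC ler_wpM2r//.
  rewrite (le_trans (nrm2_leZ _ _ c0 bg bD gD))//.
  by rewrite -mulrA ler_wpM2l.
have Ke : 0 <= K * eps^-1 by exact: mulr_ge0.
have h1 : `|\int[P1]_o rem_pi pi1 pi0 kappa0 f xi o| <= 2 * (K * eps^-1) * 4 * H ^+ 2.
  apply: (cross _ Dpi) => //; first exact: mulr_ge0.
  move=> o; rewrite /rem_pi !normrM -/(Dpi o) mulrCA mulrC ler_wpM2r//.
  rewrite mulrA mulrC [leRHS]mulrC ler_pM// (le_trans (ler_normB _ _))//.
  by have := fK o; have := xiK (oZL o); lra.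
have h2 : `|\int[P1]_o rem_delta delta1 delta0 kappa0 f eta o| <= 2 * (K * eps^-1) * 4 * H ^+ 2.
  apply: (cross _ Dde) => //; first exact: mulr_ge0.
  move=> o; rewrite /rem_delta !normrM -/(Dde o) mulrCA mulrC ler_wpM2r//.
  rewrite mulrA mulrC [leRHS]mulrC ler_pM// (le_trans (ler_normB _ _))//.
  by have := fK o; have := etaK (oL o); lra.
have h4 : `|\int[P1]_o rem_kappa pi0 kappa1 delta0 kappa0 f gam o| <=
    ((K * eps^-1 + K) * eps^-1) * 68 * H ^+ 2.
  apply: (cross _ Dka) => //; first by rewrite mulr_ge0// addr_ge0.
  move=> o; rewrite /rem_kappa !normrM -/(Dka o) mulrCA mulrC ler_wpM2r//.
  rewrite ler_pM// (le_trans (ler_normB _ _))// lerD//.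
  by rewrite normrM ler_pM// (gn_U_le e0 G0).
have nle := nrm1_nrm2 P1 P0.
have h3 : `|\int[P1]_o rem_U pi1 pi0 delta1 kappa1 delta0 kappa0 f o| <=
    K * eps^-1 * (CU eps * 68) * H ^+ 2.
  have bW : bm (fun o => DU o * Dka o) by exact: bmM.
  rewrite (le_trans (le_normr_Rintegral measurableT _))//.
    exact/bm_L1/(bm_rem_U e0 G1 bpi0 bde0 bka0 kap_ge bf).
  apply: (@le_trans _ _ (\int[P1]_o (K * eps^-1 * `|DU o * Dka o|))).
    apply: le_int.
    - exact/L1_norm/bm_L1/(bm_rem_U e0 G1 bpi0 bde0 bka0 kap_ge bf).
    - exact/L1Z/L1_norm/bm_L1.
    - move=> o; rewrite /rem_U -/(DU o) -/(Dka o) mulrAC normrM ler_wpM2r//.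
      by rewrite normrM ler_pM.
  rewrite intZ; last exact/L1_norm/bm_L1.
  rewrite -[leRHS]mulrA ler_wpM2l//.
  rewrite (le_trans (Cauchy_Schwarz_norm (bm_L2 _ bDU) (bm_L2 _ bDka)))//.
  rewrite (_ : CU eps * 68 * H ^+ 2 = (CU eps * H) * (68 * H)); last by ring.
  by rewrite ler_pM ?nrm_ge0// (le_trans (nle _)).
have h5 : `|\int[P1]_o rem_sq pi1 pi0 delta1 delta0 kappa0 gam o| <=
    K * eps^-1 * 32 * H ^+ 2.
  have bW : bm (fun o => Dpi o ^+ 2 + Dde o ^+ 2) by bmt.
  have bS := bm_rem_sq e0 G1 bpi0 bde0 bka0 kap_ge bgam.
  rewrite (le_trans (le_normr_Rintegral measurableT _))//.
    exact/bm_L1.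
  apply: (@le_trans _ _ (\int[P1]_o (K * eps^-1 * (Dpi o ^+ 2 + Dde o ^+ 2)))).
    apply: le_int.
    - exact/L1_norm/bm_L1.
    - exact/L1Z/bm_L1.
    - move=> o; rewrite /rem_sq -/(Dpi o) -/(Dde o) normrM ler_pM//.
        by rewrite normrM ler_pM.
      rewrite (le_trans (ler_normB _ _))// !ger0_norm ?sqr_ge0//.
  rewrite intZ; last exact/bm_L1.
  rewrite -[leRHS]mulrA ler_wpM2l// intD; [|exact/bm_L1/bmX|exact/bm_L1/bmX].
  rewrite -!nrmE.
  have s1 : nrm P1 Dpi ^+ 2 <= (4 * H) ^+ 2.
    by rewrite lerXn2r ?nnegrE ?nrm_ge0 ?mulr_ge0// (le_trans (nle _)).
  have s2 : nrm P1 Dde ^+ 2 <= (4 * H) ^+ 2.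
    by rewrite lerXn2r ?nnegrE ?nrm_ge0 ?mulr_ge0// (le_trans (nle _)).
  by rewrite (_ : 32 * H ^+ 2 = (4 * H) ^+ 2 + (4 * H) ^+ 2); [exact: lerD|ring].
apply: (le_trans (ler_norm_rem _ _ h1 h2 h3 h4 h5)).
by rewrite /Cbounded le_eqVlt; apply/orP; left; apply/eqP; ring.
Qed.

End bounded.

(* When [f] lives where [chi = 1], only the part of the Hellinger distance carried
   by [chi] multiplies [f] under both laws. *)
Lemma localized_diff (f chi : O -> R) (P1 : probability O R) (p1 : O -> R)
    pi1 delta1 kappa1 :
  is_density mu P1 p1 -> good_nuisance P1 eps pi1 delta1 kappa1 ->
  L2 P1 f -> L2 P0 f -> bm chi -> (forall o, f o = chi o * f o) ->
  `|\int[P1]_o (f o * iv_weight pi1 delta1 kappa1 o) - \int[P0]_o (f o * u0 o)| <=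
  eps^-1 * (nrm P1 f + nrm P0 f) *
    nrm mu (fun o => chi o * (Num.sqrt (p1 o) - Num.sqrt (p0 o)))
  + nrm P0 f * (CU eps * hell mu p1 p0).
Proof.
move=> dp1 G1 f1 f0 bchi fchi.
have bU1 := gn_U e0 G1; have bU0 := gn_U e0 G0.
have bDU := bmB bU1 bU0.
case: (dp1) (dp0) => m1 g1 E1 [m0 g0 E0].
have fu1 : L2 P1 (fun o => f o * iv_weight pi1 delta1 kappa1 o).
  by under eq_fun do rewrite mulrC; exact: L2_bm.
have fu0 : L2 P0 (fun o => f o * u0 o).
  by under eq_fun do rewrite mulrC; exact: L2_bm.
rewrite -(density_int m1 g1 E1 (L2_L1 fu1)) -(density_int m0 g0 E0 (L2_L1 fu0)).
rewrite -intB; last 2 first.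
- exact: (density_mulL1 m1 g1 E1 (L2_L1 fu1)).
- exact: (density_mulL1 m0 g0 E0 (L2_L1 fu0)).
pose r1 o := Num.sqrt (p1 o); pose r0 o := Num.sqrt (p0 o).
have r1L : L2 mu r1 := sqrt_L2 m1 g1 E1.
have r0L : L2 mu r0 := sqrt_L2 m0 g0 E0.
have chir : L2 mu (fun o => chi o * (r1 o - r0 o)) by apply: L2_bm => //; exact: L2B.
have fu1r := density_L2 m1 g1 E1 fu1; have fu0r := density_L2 m0 g0 E0 fu0.
have fr0 := density_L2 m0 g0 E0 f0.
have DU2 := bm_L2 P1 bDU; have DUr := density_L2 m1 g1 E1 DU2.
(* With [u1], [u0] the two weights, [u1 p1 - u0 p0 = (r1 - r0) (u1 r1 + u0 r0) + r0 r1 (u1 - u0)].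
   In the mixed term [f] is paired with [r0] and the weight difference with [r1], so that it is the
   norm of [f] under the fixed law [P0] that multiplies [U_rate]. *)
rewrite (@eq_int _ _ _ _ _ (fun o =>
  (chi o * (r1 o - r0 o)) * (f o * iv_weight pi1 delta1 kappa1 o * r1 o) +
  (chi o * (r1 o - r0 o)) * (f o * u0 o * r0 o) +
  (f o * r0 o) * ((iv_weight pi1 delta1 kappa1 o - u0 o) * r1 o))); last first.
  move=> o; rewrite -[p1 o]sqr_sqrtr// -[p0 o]sqr_sqrtr// -/(r1 o) -/(r0 o).
  transitivity ((chi o * f o) * ((r1 o - r0 o) *
      (iv_weight pi1 delta1 kappa1 o * r1 o + u0 o * r0 o)) +
      f o * r0 o * ((iv_weight pi1 delta1 kappa1 o - u0 o) * r1 o)); last by ring.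
  by rewrite -fchi; ring.
rewrite intD ?intD; try by [exact: L2M|apply: L1D; exact: L2M].
rewrite (le_trans (ler_normD _ _))// lerD//.
  rewrite (le_trans (ler_normD _ _))// mulrDr mulrDl lerD//.
    rewrite (le_trans (Cauchy_Schwarz chir fu1r))// mulrC ler_wpM2r ?nrm_ge0//.
    rewrite (density_nrm m1 g1 E1 fu1).
    rewrite -[X in X * _]ger0_norm// -nrmZ//.
    apply: nrm_le; [by case: fu1| |exact: L2Z] => o.
    by rewrite (normrM (f o)) (normrM eps^-1) mulrC ler_wpM2r// (le_trans (gn_U_le e0 G1 o))// ler_norm.
  rewrite (le_trans (Cauchy_Schwarz chir fu0r))// mulrC ler_wpM2r ?nrm_ge0//.
  rewrite (density_nrm m0 g0 E0 fu0).
  rewrite -[X in X * _]ger0_norm// -nrmZ//.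
  apply: nrm_le; [by case: fu0| |exact: L2Z] => o.
  by rewrite (normrM (f o)) (normrM eps^-1) mulrC ler_wpM2r// (le_trans (gn_U_le e0 G0 o))// ler_norm.
rewrite (le_trans (Cauchy_Schwarz fr0 DUr))// (density_nrm m0 g0 E0 f0) (density_nrm m1 g1 E1 DU2) ler_wpM2l ?nrm_ge0//.
by rewrite (le_trans (nrm1_nrm2 P1 P0 _))// (U_rate e0 dp1 dp0 G1 G0).
Qed.

End differences.

(** Since the inverse of 0 is 0, [1 / f = f * (f ^ 2) ^ (-1)] holds at zeros of [f] too. The
    denominator of [gamma_star] is an arbitrary version and may vanish on a null set. *)
Lemma measurable_funV d (T : measurableType d) (R : realType) (f : T -> R) :
  measurable_fun setT f -> measurable_fun setT (fun x => (f x)^-1).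
Proof.
move=> mf.
have -> : (fun x => (f x)^-1) = (fun x => f x * (f x ^+ 2) `^ (-1)).
  apply/funext => x; rewrite powRN powRr1 ?sqr_ge0//.
  have [->|f0] := eqVneq (f x) 0; first by rewrite mul0r invr0.
  by field.
apply: measurable_funM => //.
apply: (measurableT_comp (measurable_powR _)); exact: measurable_funX.
Qed.

(** * Bounded versions of the nuisance functions *)

Section nuisances.
Context {R : realType} {dZ dL} {TZ : measurableType dZ} {TL : measurableType dL}.
Local Notation O := (TZ * bool * R * TL)%type.
Variables (Q : probability O R) (eps : R).
Hypotheses (Y2 : L2 Q oY) (e0 : 0 < eps).

Let mL := @measurable_oL R _ _ TZ TL.
Let mZL := @measurable_oZL R _ _ TZ TL.
Let mY := @measurable_oY R _ _ TZ TL.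
Let Y1 : L1 Q oY := L2_L1 Y2.
Let A1 : L1 Q oAr := bm_L1 Q (@bm_oAr R _ _ TZ TL).

Lemma strong_iv_relevance_le e : e <= eps -> strong_iv_relevance Q eps ->
  strong_iv_relevance Q e.
Proof. by move=> le r a; apply: filterS (r a) => o; exact: le_trans. Qed.

Let snd_bm (g : TL -> R) : bm g -> bm (fun z : TZ * TL => g z.2).
Proof. exact: bm_comp. Qed.

Let bd01 d' (T : measurableType d') (h : T -> R) :
  measurable_fun setT h -> (forall x, 0 <= h x <= 1) -> bm h.
Proof.
move=> mh h01; split => //; exists 1 => x.
by have /andP[? ?] := h01 x; rewrite ger0_norm.
Qed.

Definition arm (a : bool) : O -> R := \1_(oA @^-1` [set a]).

Lemma bm_arm a : bm (arm a).
Proof. by apply: bm_indic; exact: measurable_oA_set. Qed.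

Lemma arm01 a o : 0 <= arm a o <= 1.
Proof. by rewrite /arm indicE; case: (_ \in _); rewrite ?lexx ler01. Qed.

(** Stated for both treatment values, because relevance of a tilted law has to be proved for both.
    The bounded [pi] and [delta] represent the conditional variance of the chosen, possibly
    unbounded, version of the propensity. *)
Lemma propensity_spec a : exists pi delta,
  [/\ [/\ bm pi, forall z, 0 <= pi z <= 1 & cond_exp Q oZL (arm a) pi],
      [/\ bm delta, forall l, 0 <= delta l <= 1 & cond_exp Q oL (arm a) delta],
      cond_exp Q oL (fun o => (pi (oZL o) - delta (oL o)) ^+ 2)
        (condVar Q oL (propensity Q a \o oZL)),
      cond_exp Q oZL (arm a) (propensity Q a) &
      \forall o \ae Q, [/\ propensity Q a (oZL o) = pi (oZL o),
        condE Q oL (arm a) (oL o) = delta (oL o) &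
        condE Q oL (propensity Q a \o oZL) (oL o) = delta (oL o)]].
Proof.
have bA := bm_arm a; have A1' := bm_L1 Q bA.
set ps := propensity Q a.
have cps : cond_exp Q oZL (arm a) ps by exact: cond_exp_condE.
have A0 : \forall o \ae Q, 0 <= arm a o by apply: aeW => o; case/andP: (arm01 a o).
have A2 : \forall o \ae Q, arm a o <= 1 by apply: aeW => o; case/andP: (arm01 a o).
have [cpi aepi] := cond_exp_clip mZL cps (cond_exp_ge mZL A1' cps A0) (cond_exp_le mZL A1' cps A2).
set ds := condE Q oL (arm a).
have cds : cond_exp Q oL (arm a) ds by exact: cond_exp_condE.
have [cde aede] := cond_exp_clip mL cds (cond_exp_ge mL A1' cds A0) (cond_exp_le mL A1' cds A2).
set pi := (fun y => clip 0 1 (ps y)) in cpi aepi.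
set delta := (fun y => clip 0 1 (ds y)) in cde aede.
have pi01 z : 0 <= pi z <= 1 by exact: clip_itv.
have de01 l : 0 <= delta l <= 1 by exact: clip_itv.
have bpi : bm pi by apply: bd01 => //; case: cpi.
have bde : bm delta by apply: bd01 => //; case: cde.
have bpiO := bm_comp mZL bpi; have bdeO := bm_comp mL bde.
set qs := condE Q oL (ps \o oZL).
have ps1 : L1 Q (ps \o oZL) by case: cps.
have cqs : cond_exp Q oL (ps \o oZL) qs by exact: cond_exp_condE.
(* Tower property: a test function of [L] is also a test function of [(Z, L)]. *)
have cqsA : cond_exp Q oL (arm a) qs.
  case: cqs => mq qi qE; split => // g bg; rewrite qE//.
  by case: cps => _ _ /(_ _ (snd_bm bg)).
have aeq : \forall o \ae Q, qs (oL o) = delta (oL o).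
  have := cond_exp_unique mL A1' cqsA cds.
  by apply: filterS2 aede => o h1 h2; rewrite h2 h1.
exists pi, delta.
split; [by split|by split| |exact: cps|by apply: filterS3 aepi aede aeq].
have mps : measurable_fun setT (fun o : O => ps (oZL o)) := L1_meas ps1.
have mqs : measurable_fun setT (fun o : O => qs (oL o)).
  by case: cqs => _ /L1_meas.
have bsq : bm (fun o : O => (pi (oZL o) - delta (oL o)) ^+ 2) by bmt.
pose f (o : O) := (ps (oZL o) - qs (oL o)) * (ps (oZL o) - qs (oL o)).
have mf : measurable_fun setT f by apply: measurable_funM; exact: measurable_funB.
have ae : \forall o \ae Q, f o = (pi (oZL o) - delta (oL o)) ^+ 2.
  by apply: filterS2 aepi aeq => o h1 h2; rewrite /f h1 h2 expr2.
have mb : measurable_fun setT (fun o : O => (pi (oZL o) - delta (oL o)) ^+ 2).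
  by case: bsq.
apply: (cond_exp_ae_eql mL mf mb ae); apply: cond_exp_condE => //.
by apply: (ae_L1 mf _ (bm_L1 Q bsq)); apply: filterS ae => o ->.
Qed.

(** Replaces the chosen versions by bounded ones and identifies [gamma_star] with the regression of
    [Y u] on [L]. Measurability of the unclipped functions is recorded separately, as almost sure
    equality does not imply it. *)
Lemma true_nuisance_spec : eps <= 1 -> strong_iv_relevance Q eps ->
  exists pi delta kappa gam,
  [/\ good_nuisance Q eps pi delta kappa,
      cond_exp Q oL (fun o => oY o * iv_weight pi delta kappa o) gam,
      measurable_fun setT (gamma_star Q) /\
      measurable_fun setT (condCov Q oL oAr (pi_star Q \o oZL)),
      psi_star Q = \int[Q]_o (oY o * iv_weight pi delta kappa o) &
      \forall o \ae Q, [/\ pi_star Q (oZL o) = pi (oZL o),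
        condE Q oL oAr (oL o) = delta (oL o),
        condCov Q oL oAr (pi_star Q \o oZL) (oL o) = kappa (oL o) &
        gamma_star Q (oL o) = gam (oL o)]].
Proof.
move=> e1 /(_ true) rel.
have bA := @bm_oAr R _ _ TZ TL.
have armA : arm true = oAr by rewrite oAr_indic.
have [pi [delta [[bpi pi01 cpi] [bde de01 cde] cV cps ae3]]] := propensity_spec true.
rewrite armA -/(pi_star Q) in cpi cde cV cps ae3 *.
set ps := pi_star Q in cV cps ae3 *.
set ds := condE Q oL oAr in ae3 *.
set qs := condE Q oL (ps \o oZL) in ae3 *.
have aepi : \forall o \ae Q, ps (oZL o) = pi (oZL o) by apply: filterS ae3 => o [].
have aede : \forall o \ae Q, ds (oL o) = delta (oL o) by apply: filterS ae3 => o [].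
have aeq : \forall o \ae Q, qs (oL o) = delta (oL o) by apply: filterS ae3 => o [].
have bpiO := bm_comp mZL bpi; have bdeO := bm_comp mL bde.
have ps1 : L1 Q (ps \o oZL) by case: cps.
have mps : measurable_fun setT (fun o : O => ps (oZL o)) := L1_meas ps1.
have mqs : measurable_fun setT (fun o : O => qs (oL o)).
  by case: (cond_exp_condE mL ps1) => _ /L1_meas.
have mds : measurable_fun setT (fun o : O => ds (oL o)).
  by case: (cond_exp_condE mL A1) => _ /L1_meas.
have bsq : bm (fun o : O => (pi (oZL o) - delta (oL o)) ^+ 2) by bmt.
set V := condVar Q oL (ps \o oZL) in cV *.
have V_ge : \forall o \ae Q, eps <= V (oL o) by [].
have V_le : \forall o \ae Q, V (oL o) <= 1.
  apply: (cond_exp_le mL (bm_L1 Q bsq) cV); apply: aeW => o.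
  have /andP[? ?] := pi01 (oZL o); have /andP[? ?] := de01 (oL o).
  by rewrite -real_normK ?num_real// exprn_ile1// ler_norml; lra.
have [cka aeka] := cond_exp_clip mL cV V_ge V_le.
set kappa := (fun y => clip eps 1 (V y)) in cka aeka.
have ka01 l : eps <= kappa l <= 1 by exact: clip_itv.
have bka : bm kappa.
  apply: bd01; first by case: cka.
  by move=> l; case/andP: (ka01 l) => h ->; rewrite (le_trans (ltW e0) h).
have G : good_nuisance Q eps pi delta kappa by [].
have bkaV := gn_kappaV e0 G.
(* The denominator of [gamma_star] is the same conditional variance. *)
set ks := condCov Q oL oAr (ps \o oZL).
pose f (o : O) := (oAr o - ds (oL o)) * (ps (oZL o) - qs (oL o)).
pose g (o : O) := (oAr o - delta (oL o)) * (pi (oZL o) - delta (oL o)).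
have bg : bm g by apply: bmM; exact: bmB.
have mA : measurable_fun setT (@oAr R _ _ TZ TL) by case: bA.
have mf : measurable_fun setT f by apply: measurable_funM; exact: measurable_funB.
have ae : \forall o \ae Q, f o = g o.
  by apply: filterS3 aede aeq aepi => o h1 h2 h3; rewrite /f /g h1 h2 h3.
have f1 : L1 Q f.
  by apply: (ae_L1 mf _ (bm_L1 Q bg)); apply: filterS ae => o ->.
have bd0 : \forall o \ae Q, ks (oL o) = kappa (oL o).
  have ck : cond_exp Q oL g ks.
    by apply: (cond_exp_ae_eql mL mf _ ae); [case: bg|exact: cond_exp_condE].
  (* The other factor [pi - delta] depends on [(Z, L)] only, so [A] may be replaced by its
     regression [pi]. *)
  have ck' : cond_exp Q oL (fun o => (pi (oZL o) - delta (oL o)) ^+ 2) ks.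
    case: ck => mk ki kE; split => // h bh; rewrite kE//.
    have bhO := bm_comp mL bh.
    pose w z := h z.2 * (pi z - delta z.2).
    have bw : bm w by have ? := snd_bm bh; have ? := snd_bm bde; rewrite /w; bmt.
    have bwO := bm_comp mZL bw.
    apply/eqP; rewrite -subr_eq0 -intB; [|by apply: bm_L1; bmt|by apply: bm_L1; bmt].
    rewrite (@eq_int _ _ _ _ _ (fun o => w (oZL o) * oAr o - w (oZL o) * pi (oZL o))).
      rewrite intB; [|by apply: bm_L1; bmt|by apply: bm_L1; bmt].
      by case: cpi => _ _ /(_ _ bw) ->; rewrite subrr.
    by move=> o; rewrite /g /w /=; ring.
  have := cond_exp_unique mL (bm_L1 Q bsq) ck' cV.
  by apply: filterS2 aeka => o h1 h2; rewrite h2 h1.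
set es := condE Q oL oY.
have ces : cond_exp Q oL oY es by exact: cond_exp_condE.
have es1 : L1 Q (es \o oL) by case: ces.
set Ns := condCov Q oL oY (ps \o oZL).
have bdi : bm (fun o : O => pi (oZL o) - delta (oL o)) by exact: bmB.
have g1 : L1 Q (fun o => (oY o - es (oL o)) * (pi (oZL o) - delta (oL o))).
  exact: (L1_bmr (L1B Y1 es1) bdi).
have cN : cond_exp Q oL (fun o => (oY o - es (oL o)) * (pi (oZL o) - delta (oL o))) Ns.
  pose h (o : O) := (oY o - es (oL o)) * (ps (oZL o) - qs (oL o)).
  have mes : measurable_fun setT (fun o : O => es (oL o)) := L1_meas es1.
  have mh : measurable_fun setT h by apply: measurable_funM; exact: measurable_funB.
  have aeh : \forall o \ae Q, h o = (oY o - es (oL o)) * (pi (oZL o) - delta (oL o)).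
    by apply: filterS2 aepi aeq => o h1 h2; rewrite /h h1 h2.
  apply: (cond_exp_ae_eql mL mh (L1_meas g1) aeh); apply: cond_exp_condE => //.
  by apply: (ae_L1 mh _ g1); apply: filterS aeh => o ->.
pose gam l := Ns l / kappa l.
have mgam : measurable_fun setT gam.
  by apply: measurable_funM; [case: cN|case: bkaV].
have bkaVO := gn_kappaVO e0 G.
have bU := gn_U e0 G.
have YU1 : L1 Q (fun o => oY o * iv_weight pi delta kappa o).
  exact: (L1_bmr Y1 bU).
have cg : cond_exp Q oL (fun o => oY o * iv_weight pi delta kappa o) gam.
  split => //.
    by case: cN => _ Ni _; exact: (L1_bmr Ni bkaVO).
  move=> h bh.
  have bw : bm (fun l => h l * (kappa l)^-1) by exact: bmM.
  have bwO := bm_comp mL bw; have bhO := bm_comp mL bh.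
  (* Centring [Y] in the covariance has no effect, since [pi - delta] is centred given [L]. The
     regression [es] of [Y] is only integrable, hence [pull_out_L1]. *)
  have z : \int[Q]_o (h (oL o) / kappa (oL o) * es (oL o) *
      (pi (oZL o) - delta (oL o))) = 0.
    apply: (@pull_out_L1 _ _ _ _ _ Q _ (fun o => pi (oZL o) - delta (oL o)) 1
      (fun l => h l / kappa l * es l)).
    - by case: bdi.
    - exact: gn_diff1 G.
    - move=> k bk; have bkO := bm_comp mL bk.
      rewrite (@eq_int _ _ _ _ _ (fun o => k (oL o) * pi (oZL o) - k (oL o) * delta (oL o))).
        rewrite intB; [|by apply: bm_L1; bmt|by apply: bm_L1; bmt].
        case: cpi => _ _ /(_ _ (snd_bm bk)) /= ->.
        by case: cde => _ _ /(_ _ bk) ->; rewrite subrr.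
      by move=> o; rewrite mulrBr.
    - by apply: measurable_funM; [case: bw|case: ces].
    - exact: L1_bm bwO es1.
  rewrite -[RHS]subr0 -z.
  rewrite (@eq_int _ _ _ _ (fun o => h (oL o) * gam (oL o))
    (fun o => h (oL o) / kappa (oL o) * Ns (oL o))); last by move=> o; rewrite /gam; ring.
  case: cN => _ _ /(_ _ bw) ->; rewrite -intB.
  - by apply: eq_int => o; rewrite /iv_weight; ring.
  - exact: L1_bm.
  - apply: (@L1_le _ _ _ _ _ (fun o => `|h (oL o) / kappa (oL o) * es (oL o)|)).
    + apply: measurable_funM; [|by case: bdi].
      by apply: measurable_funM; [case: bwO|exact: L1_meas es1].
    + by move=> o; rewrite normrM ler_piMr// (gn_diff1 G).
    + exact/L1_norm/(L1_bm bwO es1).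
have mks : measurable_fun setT ks by case: (cond_exp_condE mL f1).
have mgs : measurable_fun setT (gamma_star Q).
  by apply: measurable_funM; [case: cN|exact: measurable_funV].
have aeg : \forall o \ae Q, gamma_star Q (oL o) = gam (oL o).
  by apply: filterS bd0 => o h; rewrite /gamma_star /gam -h.
exists pi, delta, kappa, gam; split => //.
- rewrite /psi_star -(cond_exp_int cg); apply: ae_int => //.
  + exact: measurableT_comp mgs mL.
  + exact: measurableT_comp mgam mL.
- have {}ae3 : \forall o \ae Q, [/\ ds (oL o) = delta (oL o),
      ks (oL o) = kappa (oL o) & gamma_star Q (oL o) = gam (oL o)].
    by apply: filterS3 aede bd0 aeg.
  by apply: filterS2 aepi ae3 => o h1 [h2 h3 h4]; split.
Qed.

End nuisances.

Lemma nrm_bmr d (T : measurableType d) (R : realType)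
    (mu : {measure set T -> \bar R}) (f g : T -> R) c :
  L2 mu f -> bm g -> (forall x, `|g x| <= c) ->
  nrm mu (fun x => f x * g x) <= c * nrm mu f.
Proof.
move=> f2 bg gc; have c0 : 0 <= c by exact: le_trans (normr_ge0 _) (gc point).
rewrite -[c]ger0_norm// -nrmZ//; apply: nrm_le; last exact: L2Z.
  by case: f2 bg => mf _ [mg _]; exact: measurable_funM.
by move=> x; rewrite !normrM mulrC ler_wpM2r// (le_trans (gc x))// ler_norm.
Qed.

Lemma cond_exp_bounded d d' (T : measurableType d) (T' : measurableType d')
    (R : realType) (P : probability T R) (X : T -> T') (f : T -> R) (K : R) :
  measurable_fun setT X -> bm f -> (forall x, `|f x| <= K) ->
  exists h, [/\ bm h, forall y, `|h y| <= K & cond_exp P X f h].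
Proof.
move=> mX bf fK; have f1 := bm_L1 P bf; have c := cond_exp_condE mX f1.
have K0 : 0 <= K by exact: le_trans (normr_ge0 _) (fK point).
have fK1 : \forall x \ae P, - K <= f x.
  by apply: aeW => x; have := fK x; rewrite ler_norml => /andP[].
have fK2 : \forall x \ae P, f x <= K.
  by apply: aeW => x; have := fK x; rewrite ler_norml => /andP[].
have [c' _] := cond_exp_clip mX c (cond_exp_ge mX f1 c fK1) (cond_exp_le mX f1 c fK2).
have hK y : `|clip (- K) K (condE P X f y)| <= K.
  by rewrite ler_norml; apply: clip_itv; lra.
eexists; split; [|exact: hK|exact: c'].
by split; [case: c'|exists K].
Qed.

(** * Mean-square continuity of the influence function in the outcome *)

Section influence_L2.
Context {R : realType} {dZ dL} {TZ : measurableType dZ} {TL : measurableType dL}.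
Local Notation O := (TZ * bool * R * TL)%type.
Variables (Q : probability O R) (eps : R).
Variables (pi : TZ * TL -> R) (delta kappa : TL -> R).
Hypotheses (e0 : 0 < eps) (G : good_nuisance Q eps pi delta kappa).

Let mL := @measurable_oL R _ _ TZ TL.
Let mZL := @measurable_oZL R _ _ TZ TL.
Let ei : 0 <= eps^-1. Proof. by rewrite invr_ge0 ltW. Qed.

(** The terms in [f], [xi] and [eta] each have a multiplier bounded by [eps^-1]; the one in [gam]
    has a multiplier bounded by [2 eps^-1], and the norm of [gam] itself is at most [eps^-1] times
    that of [f]. *)
Definition Cinf := eps^-1 * (3 + 2 * eps^-1).

(** The influence function is linear in [f] together with its regressions, and regression contracts
    L2. This bound therefore transfers truncation errors of [Y] to the influence function. *)
Lemma influence_L2 (f : O -> R) xi eta gam : L2 Q f ->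
  cond_exp Q oZL f xi -> cond_exp Q oL f eta ->
  cond_exp Q oL (fun o => f o * iv_weight pi delta kappa o) gam ->
  L2 Q (influence pi delta kappa f xi eta gam) /\
  nrm Q (influence pi delta kappa f xi eta gam) <= Cinf * nrm Q f.
Proof.
move=> f2 cxi ceta cgam.
have bU := gn_U e0 G; have Ue := gn_U_le e0 G.
have fU2 := L2_bmr f2 bU; have fUn := nrm_bmr f2 bU Ue.
have [xi2 xin] := cond_exp_L2 mZL f2 cxi.
have [eta2 etan] := cond_exp_L2 mL f2 ceta.
have [gam2 gamn] := cond_exp_L2 mL fU2 cgam.
have bA := @bm_oAr R _ _ TZ TL.
have bV := gn_kappaVO e0 G; have bka := gn_kappaO G.
have bpi := gn_piO G; have bde := gn_deltaO G.
pose b1 (o : O) := (oAr o - pi (oZL o)) / kappa (oL o).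
pose b2 (o : O) := (oAr o - delta (oL o)) / kappa (oL o).
pose b3 (o : O) := (kappa (oL o) + (oAr o - pi (oZL o)) ^+ 2
  - (oAr o - delta (oL o)) ^+ 2) / kappa (oL o).
have bb1 : bm b1 by apply: bmM => //; exact: bmB.
have bb2 : bm b2 by apply: bmM => //; exact: bmB.
have bb3 : bm b3.
  by apply: bmM => //; apply: bmB; [apply: bmD => //|]; apply: bmX; exact: bmB.
have V_le := gn_kappaV_le e0 G.
have b1e o : `|b1 o| <= eps^-1.
  rewrite normrM -[leRHS]mul1r ler_pM// ler_dist01 ?oAr_01//; exact: gn_pi01 G _.
have b2e o : `|b2 o| <= eps^-1.
  rewrite normrM -[leRHS]mul1r ler_pM// ler_dist01 ?oAr_01//; exact: gn_delta01 G _.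
have b3e o : `|b3 o| <= 2 * eps^-1.
  rewrite normrM ler_pM//.
  have sq01 (x : R) : `|x| <= 1 -> 0 <= x ^+ 2 <= 1.
    by move=> x1; rewrite sqr_ge0 -real_normK ?num_real//= exprn_ile1.
  have /andP[? ?] := sq01 _ (ler_dist01 (oAr_01 o) (gn_pi01 G (oZL o))).
  have /andP[? ?] := sq01 _ (ler_dist01 (oAr_01 o) (gn_delta01 G (oL o))).
  have /andP[_ ?] := gn_kappa G (oL o); have ? := gn_kappa_gt0 e0 G (oL o).
  by rewrite ler_norml; apply/andP; split; lra.
have i1 := L2_bmr xi2 bb1; have n1 := nrm_bmr xi2 bb1 b1e.
have i2 := L2_bmr eta2 bb2; have n2 := nrm_bmr eta2 bb2 b2e.
have i3 := L2_bmr gam2 bb3; have n3 := nrm_bmr gam2 bb3 b3e.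
have -> : influence pi delta kappa f xi eta gam = (fun o =>
    ((f o * iv_weight pi delta kappa o + (xi \o oZL) o * b1 o) -
     (eta \o oL) o * b2 o) + (gam \o oL) o * b3 o).
  by apply/funext => o; rewrite /influence /b1 /b2 /b3 /=; ring.
have j1 := L2D fU2 i1; have j2 := L2B j1 i2; have j3 := L2D j2 i3.
split => //.
rewrite (le_trans (nrmD j2 i3))//.
rewrite (le_trans (lerD (nrmB j1 i2) (lexx _)))//.
rewrite (le_trans (lerD (lerD (nrmD fU2 i1) (lexx _)) (lexx _)))//.
have := ler_wpM2l ei xin; have := ler_wpM2l ei etan.
have e2 : 0 <= 2 * eps^-1 by rewrite mulr_ge0.
have := ler_wpM2l e2 (le_trans gamn fUn).
move: fUn n1 n2 n3; rewrite /Cinf.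
set x1 := nrm Q _; set x2 := nrm Q _; set x3 := nrm Q _; set x4 := nrm Q _.
set x5 := nrm Q _; set x6 := nrm Q _; set x7 := nrm Q _; set x8 := nrm Q _.
clear; nra.
Qed.

End influence_L2.

(** * Derivative along a submodel *)

Section quotient.
Context d (T : measurableType d) (R : realType)
  (mu : {sigma_finite_measure set T -> \bar R}).
Variables (P1 P0 : probability T R) (p1 p0 s : T -> R) (t : R).
Hypotheses (dp1 : is_density mu P1 p1) (dp0 : is_density mu P0 p0)
  (s2 : L2 P0 s) (t0 : t != 0).
Let r1 x := Num.sqrt (p1 x).
Let r0 x := Num.sqrt (p0 x).

(** The derivative at 0 of the root density, since the score is the derivative of the log
    density. *)
Definition half_score x := 2^-1 * s x * Num.sqrt (p0 x).
Definition qmd_error :=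
  nrm mu (fun x => (Num.sqrt (p1 x) - Num.sqrt (p0 x)) / t - half_score x).

Let r1L : L2 mu r1. Proof. by case: dp1 => m g E; exact: sqrt_L2 E. Qed.
Let r0L : L2 mu r0. Proof. by case: dp0 => m g E; exact: sqrt_L2 E. Qed.

Lemma half_score_L2 : L2 mu half_score.
Proof. by case: dp0 => m g E; apply: density_L2 (L2Z 2^-1 s2). Qed.

Let dr := L2B r1L r0L.

Let q2 : L2 mu (fun x => (r1 x - r0 x) / t).
Proof. by under eq_fun do rewrite mulrC; exact: L2Z. Qed.

Let diff2 : L2 mu (fun x => (r1 x - r0 x) / t - half_score x).
Proof. exact: L2B q2 half_score_L2. Qed.

(** The gain over [hell_le] is that the score appears only where [chi] lives, so its norm is small
    when [chi] marks a far tail. *)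
Lemma localized_hell_le (chi : T -> R) : bm chi -> (forall x, `|chi x| <= 1) ->
  nrm mu (fun x => chi x * (Num.sqrt (p1 x) - Num.sqrt (p0 x))) <=
  `|t| * (qmd_error + 2^-1 * nrm P0 (fun x => s x * chi x)).
Proof.
move=> bchi chi1.
have -> : (fun x => chi x * (Num.sqrt (p1 x) - Num.sqrt (p0 x))) =
    (fun x => t * (((r1 x - r0 x) / t - half_score x) * chi x + half_score x * chi x)).
  by apply/funext => x; rewrite /r1 /r0; field.
have i1 := L2_bmr diff2 bchi; have i2 := L2_bmr half_score_L2 bchi.
rewrite nrmZ; last exact: L2D.
rewrite ler_wpM2l// (le_trans (nrmD i1 i2))// lerD//.
  by rewrite (le_trans (nrm_bmr diff2 bchi chi1))// mul1r.
have sc := L2_bmr s2 bchi.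
have -> : (fun x => half_score x * chi x) = (fun x => 2^-1 * (s x * chi x) * r0 x).
  by apply/funext => x; rewrite /half_score /r0; ring.
case: dp0 => m g E.
by rewrite (density_nrm m g E (L2Z 2^-1 sc)) nrmZ// ger0_norm.
Qed.

Lemma hell_le : hell mu p1 p0 <= `|t| * (nrm mu half_score + qmd_error).
Proof.
rewrite /hell.
have -> : (fun x => Num.sqrt (p1 x) - Num.sqrt (p0 x)) =
    (fun x => t * (half_score x + ((r1 x - r0 x) / t - half_score x))).
  by apply/funext => x; rewrite /r1 /r0; field.
rewrite nrmZ; last exact: L2D half_score_L2 diff2.
by rewrite ler_wpM2l// (nrmD half_score_L2 diff2).
Qed.

Lemma int_quotient_le (f : T -> R) (B : R) : bm f -> (forall x, `|f x| <= B) ->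
  `|(\int[P1]_x f x - \int[P0]_x f x) / t - \int[P0]_x (f x * s x)| <=
  2 * B * qmd_error + nrm mu half_score * (B * hell mu p1 p0).
Proof.
move=> bf fB; have B0 : 0 <= B by exact: le_trans (normr_ge0 _) (fB point).
have f1 := bm_L2 P1 bf; have f0 := bm_L2 P0 bf.
rewrite (int_diffE dp1 dp0 f1 f0).
case: (dp1) (dp0) => m1 g1 E1 [m0 g0 E0].
have fr1 := density_L2 m1 g1 E1 f1; have fr0 := density_L2 m0 g0 E0 f0.
have fs2 := L2_bm bf s2.
rewrite -(density_int m0 g0 E0 (L2_L1 fs2)).
have fsi := density_mulL1 m0 g0 E0 (L2_L1 fs2).
have drf : L2 mu (fun x => f x * (r1 x - r0 x)) by exact: L2_bm.
have hs2 := half_score_L2.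
(* Uses [half_score * (r1 + r0) = s * p0 + half_score * (r1 - r0)]: the first two integrals carry
   the differentiability error, the third is of the order of the Hellinger distance. *)
have -> : (\int[mu]_x ((r1 x - r0 x) * (f x * r1 x)) +
    \int[mu]_x ((r1 x - r0 x) * (f x * r0 x))) / t - \int[mu]_x (f x * s x * p0 x) =
    \int[mu]_x (((r1 x - r0 x) / t - half_score x) * (f x * r1 x)) +
    \int[mu]_x (((r1 x - r0 x) / t - half_score x) * (f x * r0 x)) +
    \int[mu]_x (half_score x * (f x * (r1 x - r0 x))).
  have a1 := L2M dr fr1; have a2 := L2M dr fr0.
  have b1 := L2M diff2 fr1; have b2 := L2M diff2 fr0; have b3 := L2M hs2 drf.
  rewrite -(intD a1 a2) mulrC -(intZ _ (L1D a1 a2)) -(intB (L1Z t^-1 (L1D a1 a2)) fsi).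
  rewrite -(intD b1 b2) -(intD (L1D b1 b2) b3).
  apply: eq_int => x; rewrite /half_score /r1 /r0.
  by move: (sqr_sqrtr (g0 x)); set q := Num.sqrt (p0 x) => <-; field.
have n1 : nrm mu (fun x => f x * r1 x) <= B.
  rewrite (density_nrm m1 g1 E1 f1) -[leRHS]ger0_norm// -(nrm_cst P1 B).
  by apply: nrm_le; [by case: bf| |exact/bm_L2/bm_cst] => x; rewrite (ger0_norm B0).
have n0 : nrm mu (fun x => f x * r0 x) <= B.
  rewrite (density_nrm m0 g0 E0 f0) -[leRHS]ger0_norm// -(nrm_cst P0 B).
  by apply: nrm_le; [by case: bf| |exact/bm_L2/bm_cst] => x; rewrite (ger0_norm B0).
rewrite (le_trans (ler_normD _ _))// lerD//.
  rewrite (le_trans (ler_normD _ _))// [2 * B]mulr_natl mulr2n mulrDl lerD//.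
    by rewrite (le_trans (Cauchy_Schwarz diff2 fr1))// mulrC ler_wpM2r// nrm_ge0.
  by rewrite (le_trans (Cauchy_Schwarz diff2 fr0))// mulrC ler_wpM2r// nrm_ge0.
rewrite (le_trans (Cauchy_Schwarz hs2 drf))// ler_wpM2l ?nrm_ge0//.
have -> : (fun x => f x * (r1 x - r0 x)) = (fun x => (r1 x - r0 x) * f x).
  by apply/funext => x; rewrite mulrC.
exact: (nrm_bmr dr bf fB).
Qed.

End quotient.

(* [A] and [S] are the contributions of the truncated outcome and of its tail,
   [H] the Hellinger distance, [ch] its localization to the tail, and [a] the
   error in the differentiability in quadratic mean. *)
Lemma quotient_combine (R : realFieldType)
    (A S Bq Dn D t a H ch g B Cb e n1 nf cu sg ci ns m y : R) :
  t != 0 -> 0 <= a -> a <= 1 -> 0 <= g -> 0 <= B -> 0 <= Cb -> 0 <= e ->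
  0 <= n1 -> 0 <= nf -> 0 <= cu -> 0 <= sg -> 0 <= H -> 0 <= ch ->
  n1 <= m -> nf <= y ->
  H <= `|t| * (g + a) -> ch <= `|t| * (a + sg) ->
  `|A - Bq| <= Cb * H ^+ 2 ->
  `|S| <= e * (n1 + nf) * ch + nf * (cu * H) ->
  `|Bq / t - Dn| <= 2 * B * a + g * (B * H) ->
  `|Dn - D| <= ci * nf * ns ->
  `|(A + S) / t - D| <= (e * (m + y) + y * cu + 2 * B) * a +
    (Cb * (g + 1) ^+ 2 + g * B * (g + 1)) * `|t| +
    (e * (m + y) * sg + nf * (cu * g + ci * ns)).
Proof.
move=> t0 a0 a1 g0 B0 Cb0 e0 n10 nf0 cu0 sg0 H0 ch0 n1m nfy Hle chle hA hS hq hD.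
have tp : 0 < `|t| by rewrite normr_gt0.
have H1 : H <= `|t| * (g + 1) by rewrite (le_trans Hle)// ler_wpM2l// lerD2l.
have kA : `|(A - Bq) / t| <= Cb * (g + 1) ^+ 2 * `|t|.
  rewrite normrM normfV ler_pdivrMr// (le_trans hA)// -!mulrA ler_wpM2l//.
  have : H ^+ 2 <= (`|t| * (g + 1)) ^+ 2.
    by rewrite lerXn2r// nnegrE// mulr_ge0// addr_ge0.
  by rewrite exprMn => /le_trans; apply; rewrite le_eqVlt expr2 mulrC !mulrA eqxx.
have kS : `|S / t| <= e * (m + y) * (a + sg) + nf * (cu * (g + a)).
  rewrite normrM normfV ler_pdivrMr// (le_trans hS)// mulrDl lerD//.
    rewrite -[leRHS]mulrA [(a + sg) * _]mulrC ler_pM// ?mulr_ge0 ?addr_ge0//.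
    by rewrite ler_wpM2l// lerD.
  by rewrite -!mulrA !ler_wpM2l// [leRHS]mulrC.
have kq : g * (B * H) <= g * B * (g + 1) * `|t|.
  by rewrite -!mulrA !ler_wpM2l// [leRHS]mulrC.
have nfa : nf * (cu * a) <= y * cu * a by rewrite mulrA ler_wpM2r// ler_wpM2r.
have -> : (A + S) / t - D = (A - Bq) / t + S / t + (Bq / t - Dn) + (Dn - D) by field.
rewrite (le_trans (ler_normD _ _))//.
rewrite (le_trans (lerD (ler_normD _ _) (lexx _)))//.
rewrite (le_trans (lerD (lerD (ler_normD _ _) (lexx _)) (lexx _)))//.
rewrite (le_trans (lerD (lerD (lerD kA kS) hq) hD))//.
rewrite (_ : nf * (cu * (g + a)) = nf * (cu * g) + nf * (cu * a)); last by ring.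
move: kq nfa; set w1 := g * (B * H); set w2 := nf * (cu * a); clear.
by nra.
Qed.

Section derivative.
Context {R : realType} {dZ dL} {TZ : measurableType dZ} {TL : measurableType dL}.
Local Notation O := (TZ * bool * R * TL)%type.
Variables (mu : {sigma_finite_measure set O -> \bar R}).
Variables (Q : probability O R) (p0 s : O -> R) (eps : R).
Hypotheses (e0 : 0 < eps) (e1 : eps <= 1) (dp0 : is_density mu Q p0)
  (s2 : L2 Q s) (Y2 : L2 Q oY).
Variables (pi0 : TZ * TL -> R) (delta0 kappa0 : TL -> R).
Hypothesis G0 : good_nuisance Q eps pi0 delta0 kappa0.
Local Notation u0 := (iv_weight pi0 delta0 kappa0).
Variables (xi : TZ * TL -> R) (eta gam : TL -> R).
Hypotheses (cxi : cond_exp Q oZL oY xi) (ceta : cond_exp Q oL oY eta)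
  (cgam : cond_exp Q oL (fun o => oY o * u0 o) gam).
Local Notation inf0 := (influence pi0 delta0 kappa0 oY xi eta gam).

Let mL := @measurable_oL R _ _ TZ TL.
Let mZL := @measurable_oZL R _ _ TZ TL.
Let mY := @measurable_oY R _ _ TZ TL.
Let ei : 0 <= eps^-1. Proof. by rewrite invr_ge0 ltW. Qed.

Definition Ytail n (o : O) := oY o * tail oY n o.
Definition Ytrunc n (o : O) := oY o * (1 - tail oY n o).

Lemma tail01 n (o : O) : 0 <= tail oY n o <= 1.
Proof. by rewrite tailE; case: (_ < _); rewrite /= ?lexx ?ler01. Qed.

Lemma tail_le1 n (o : O) : `|tail oY n o| <= 1.
Proof. by rewrite ger0_norm; case/andP: (tail01 n o). Qed.

Lemma tail_idem n (o : O) : tail oY n o * tail oY n o = tail oY n o.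
Proof. by rewrite tailE; case: (_ < _); rewrite /= ?mulr1 ?mulr0. Qed.

Lemma Ytrunc_le n o : `|Ytrunc n o| <= n%:R.
Proof.
rewrite /Ytrunc tailE; case: ltP => h /=; first by rewrite subrr mulr0 normr0.
by rewrite subr0 mulr1.
Qed.

Lemma bm_Ytrunc n : bm (Ytrunc n).
Proof.
split; last by exists n%:R; exact: Ytrunc_le.
apply: measurable_funM => //; apply: measurable_funB => //.
by case: (bm_tail n mY).
Qed.

Lemma Ytail_L2 (P : probability O R) n : L2 P oY -> L2 P (Ytail n).
Proof. by move=> P2; apply: L2_bmr => //; exact: bm_tail. Qed.

Lemma Ytail_nrm (P : probability O R) n : L2 P oY -> nrm P (Ytail n) <= nrm P oY.
Proof.
by move=> P2; rewrite -[leRHS]mul1r (nrm_bmr P2 (bm_tail n mY))// => o; exact: tail_le1.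
Qed.

(** One bound serves all three: the regressions of [Ytrunc n] are bounded by [n], which is at most
    [n / eps] as [eps <= 1], and the weight contributes a factor [eps^-1] to the third. *)
Lemma truncated_nuisance n : exists xin etan gamn,
  [/\ bm xin, bm etan, bm gamn,
      [/\ forall z, `|xin z| <= n%:R * eps^-1,
          forall l, `|etan l| <= n%:R * eps^-1 &
          forall l, `|gamn l| <= n%:R * eps^-1] &
      [/\ cond_exp Q oZL (Ytrunc n) xin, cond_exp Q oL (Ytrunc n) etan &
          cond_exp Q oL (fun o => Ytrunc n o * u0 o) gamn]].
Proof.
have en : n%:R <= n%:R * eps^-1 by rewrite ler_peMr// invf_ge1.
have bf := bm_Ytrunc n; have fn := @Ytrunc_le n.
have [xin [b1 n1 c1]] := cond_exp_bounded Q mZL bf fn.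
have [etan [b2 n2 c2]] := cond_exp_bounded Q mL bf fn.
have fun_le o : `|Ytrunc n o * u0 o| <= n%:R * eps^-1.
  by rewrite normrM ler_pM// (gn_U_le e0 G0).
have [gamn [b3 n3 c3]] := cond_exp_bounded Q mL (bmM bf (gn_U e0 G0)) fun_le.
exists xin, etan, gamn; split => //; split => // y.
- exact: le_trans (n1 y) en.
- exact: le_trans (n2 y) en.
Qed.

(** By linearity the difference is the influence function built from [Ytail n], to which
    [influence_L2] applies. *)
Lemma influence_truncated n xin etan gamn :
  cond_exp Q oZL (Ytrunc n) xin -> cond_exp Q oL (Ytrunc n) etan ->
  cond_exp Q oL (fun o => Ytrunc n o * u0 o) gamn ->
  L2 Q (fun o => inf0 o - influence pi0 delta0 kappa0 (Ytrunc n) xin etan gamn o) /\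
  nrm Q (fun o => inf0 o - influence pi0 delta0 kappa0 (Ytrunc n) xin etan gamn o)
    <= Cinf eps * nrm Q (Ytail n).
Proof.
move=> c1 c2 c3; have Y1 := L2_L1 Y2; have f1 := bm_L1 Q (bm_Ytrunc n).
have bU := gn_U e0 G0.
have -> : (fun o => inf0 o - influence pi0 delta0 kappa0 (Ytrunc n) xin etan gamn o) =
    influence pi0 delta0 kappa0 (Ytail n) (fun z => xi z - xin z)
      (fun l => eta l - etan l) (fun l => gam l - gamn l).
  by apply/funext => o; rewrite /influence /Ytail /Ytrunc; ring.
have E : (fun o => oY o - Ytrunc n o) = Ytail n.
  by apply/funext => o; rewrite /Ytail /Ytrunc; ring.
apply: (influence_L2 e0 G0 (Ytail_L2 n Y2)).
- by rewrite -E; exact: cond_expB.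
- by rewrite -E; exact: cond_expB.
- rewrite -E (_ : (fun o => _) = (fun o => oY o * u0 o - Ytrunc n o * u0 o)).
    by apply: cond_expB => //; apply: L1_bmr.
  by apply/funext => o; rewrite mulrBl.
Qed.

Lemma nrm_tail_cvg (g : O -> R) : L2 Q g -> forall e, 0 < e ->
  \forall n \near \oo, nrm Q (fun o => g o * tail oY n o) < e.
Proof.
move=> [mg gi] e ep; have ee : 0 < e ^+ 2 by rewrite exprn_gt0.
have := tail_cvg mY gi ee; apply: filterS => n H.
rewrite -(@ltr_pXn2r _ 2)// ?nnegrE ?nrm_ge0 ?ltW// nrmE.
rewrite (@eq_int _ _ _ _ (fun o => (g o * tail oY n o) ^+ 2) (fun o => g o ^+ 2 * tail oY n o)).
  by apply: le_lt_trans H; rewrite ler_norm.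
by move=> o; rewrite exprMn [X in _ * X]expr2 tail_idem.
Qed.

(** [influence_mean] needs a bounded outcome; it is applied to [Ytrunc n], and both sides change by
    at most a multiple of the norm of [Ytail n]. *)
Lemma influence_expectation : \int[Q]_o inf0 o = \int[Q]_o (oY o * u0 o).
Proof.
have bU := gn_U e0 G0.
have [i2 _] := influence_L2 e0 G0 Y2 cxi ceta cgam.
have C0 : 0 < Cinf eps + eps^-1 + 1.
  by rewrite ltr_pwDr// addr_ge0// mulr_ge0// addr_ge0// mulr_ge0.
apply/eqP; rewrite -subr_eq0 -normr_le0; apply/ler_addgt0Pl => e ep; rewrite addr0.
have [n _ /(_ n (leqnn n)) /= tn] := nrm_tail_cvg Y2 (divr_gt0 ep C0).
have [xin [etan [gamn [b1 b2 b3 [n1 n2 n3] [c1 c2 c3]]]]] := truncated_nuisance n.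
have [d2 dn] := influence_truncated c1 c2 c3.
have en : n%:R <= n%:R * eps^-1 by rewrite ler_peMr// invf_ge1.
have fn o : `|Ytrunc n o| <= n%:R * eps^-1 := le_trans (Ytrunc_le n o) en.
have M := influence_mean e0 G0 (bm_Ytrunc n) b1 b2 b3.
have t2 := Ytail_L2 n Y2.
have tU2 := L2_bmr t2 bU.
have YU := L2_L1 (L2_bmr Y2 bU); have fU := bm_L1 Q (bmM (bm_Ytrunc n) bU).
have bi : L1 Q (influence pi0 delta0 kappa0 (Ytrunc n) xin etan gamn).
  apply/bm_L1/(bm_influence e0 (gn_bpi G0) (gn_bdelta G0) (gn_bkappa G0)) => //.
    by move=> l; case/andP: (gn_kappa G0 l).
  exact: bm_Ytrunc.
have -> : \int[Q]_o inf0 o - \int[Q]_o (oY o * u0 o) =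
    \int[Q]_o (inf0 o - influence pi0 delta0 kappa0 (Ytrunc n) xin etan gamn o) -
    \int[Q]_o (Ytail n o * u0 o).
  rewrite (intB (L2_L1 i2) bi) M.
  rewrite (@eq_int _ _ _ _ (fun o => Ytail n o * u0 o)
    (fun o => oY o * u0 o - Ytrunc n o * u0 o)); first by rewrite (intB YU fU); ring.
  by move=> o; rewrite /Ytail /Ytrunc; ring.
have one g : L2 Q g -> `|\int[Q]_o g o| <= nrm Q g.
  move=> g2; have := Cauchy_Schwarz g2 (bm_L2 Q (bm_cst _ 1)).
  by rewrite nrm_cst normr1 mulr1; under eq_int do rewrite mulr1.
rewrite (le_trans (ler_normB _ _))//.
rewrite (le_trans (lerD (one _ d2) (one _ tU2)))//.
rewrite (le_trans (lerD dn (nrm_bmr t2 bU (gn_U_le e0 G0))))// -mulrDl.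
move: tn; rewrite -/(Ytail n) ltr_pdivlMr// => /ltW; apply: le_trans.
by rewrite mulrC ler_wpM2l ?nrm_ge0// lerDl.
Qed.

Variables (m : R).
Hypothesis m0 : 0 <= m.

(** What survives of the error when [t -> 0] with [n] fixed. In the first summand the tail of [Y]
    under the nearby law is merely bounded by [m] and the score is small; the second collects the
    change of the weight on the tail and the truncation of the influence function. *)
Definition tail_error n :=
  eps^-1 * (m + nrm Q oY) * (2^-1 * nrm Q (fun o => s o * tail oY n o)) +
  nrm Q (Ytail n) * (CU eps * nrm mu (half_score p0 s) + Cinf eps * nrm Q s).

Lemma tail_error_small e : 0 < e -> exists n, tail_error n < e.
Proof.
move=> ep.
pose c1 := eps^-1 * (m + nrm Q oY) * 2^-1 + 1.
pose c2 := CU eps * nrm mu (half_score p0 s) + Cinf eps * nrm Q s + 1.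
have c10 : 0 < c1 by rewrite ltr_pwDr// !(mulr_ge0, addr_ge0) ?nrm_ge0.
have c20 : 0 < c2.
  by rewrite ltr_pwDr// addr_ge0// mulr_ge0 ?nrm_ge0 ?CU_ge0// !(mulr_ge0, addr_ge0).
have e2 : 0 < e / 2 by rewrite divr_gt0.
have [n _ /(_ n (leqnn n)) /= [t1 t2]] := filterI
  (nrm_tail_cvg s2 (divr_gt0 e2 c10)) (nrm_tail_cvg Y2 (divr_gt0 e2 c20)).
exists n; rewrite /tail_error mulrA -/(Ytail n).
move: t1 t2; rewrite -/(Ytail n) !ltr_pdivlMr//.
have := nrm_ge0 Q (fun o => s o * tail oY n o); have := nrm_ge0 Q (Ytail n).
rewrite /c1 /c2.
set x := nrm Q (fun o => _); set y := nrm Q (Ytail n).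
set k1 := _ * 2^-1; set k2 := _ + _ * nrm Q s.
by move=> *; rewrite [e]splitr ltrD//; lra.
Qed.

(** [C1] and [C2] may grow with [n] but do not depend on the nearby law or on [t], so [n] can be
    fixed before [t] tends to 0. Requiring an error of at most 1 makes the Hellinger distance
    O(t). *)
Lemma quotient_bound n : exists C1 C2, [/\ 0 <= C1, 0 <= C2 &
  forall (P1 : probability O R) (p1 : O -> R) pi1 delta1 kappa1 (t : R),
    t != 0 -> is_density mu P1 p1 -> good_nuisance P1 eps pi1 delta1 kappa1 ->
    L2 P1 oY -> nrm P1 oY <= m -> qmd_error mu p1 p0 s t <= 1 ->
    `|(\int[P1]_o (oY o * iv_weight pi1 delta1 kappa1 o) - \int[Q]_o (oY o * u0 o)) / t
      - \int[Q]_o (inf0 o * s o)| <=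
    C1 * qmd_error mu p1 p0 s t + C2 * `|t| + tail_error n].
Proof.
have bU0 := gn_U e0 G0.
have [i2 _] := influence_L2 e0 G0 Y2 cxi ceta cgam.
have [xin [etan [gamn [b1 b2 b3 [n1 n2 n3] [c1 c2 c3]]]]] := truncated_nuisance n.
have [d2 dn] := influence_truncated c1 c2 c3.
have en : n%:R <= n%:R * eps^-1 by rewrite ler_peMr// invf_ge1.
have fn o : `|Ytrunc n o| <= n%:R * eps^-1 := le_trans (Ytrunc_le n o) en.
set K := n%:R * eps^-1 in n1 n2 n3 fn en.
have K0 : 0 <= K by rewrite mulr_ge0.
have := bounded_expansion e0 dp0 G0 (bm_Ytrunc n) b1 b2 b3 fn n1 n2 n3 c1 c2 c3.
set Cb := Cbounded eps K.
set infn := influence _ _ _ _ xin etan gamn in d2 dn * => bdd.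
have bin : bm infn.
  apply: (bm_influence e0 (gn_bpi G0) (gn_bdelta G0) (gn_bkappa G0)) => //.
    by move=> l; case/andP: (gn_kappa G0 l).
  exact: bm_Ytrunc.
have [_ [B' inB']] := bin.
pose B := `|B'|; have B0 : 0 <= B := normr_ge0 B'.
have inB o : `|infn o| <= B by rewrite (le_trans (inB' o))// ler_norm.
have Cb0 : 0 <= Cb.
  by rewrite /Cb /Cbounded !(mulr_ge0, addr_ge0)//.
have CU0 := CU_ge0 e0.
pose g := nrm mu (half_score p0 s); pose y := nrm Q oY.
have g0 : 0 <= g by exact: nrm_ge0.
have y0 : 0 <= y by exact: nrm_ge0.
exists (eps^-1 * (m + y) + y * CU eps + 2 * B).
exists (Cb * (g + 1) ^+ 2 + g * B * (g + 1)).
split; [by rewrite !(mulr_ge0, addr_ge0)|by rewrite !(mulr_ge0, addr_ge0, exprn_ge0)|].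
move=> P1 p1 pi1 delta1 kappa1 t t0 dp1 G1 P1Y P1m.
set a := qmd_error mu p1 p0 s t => a1.
have a0 : 0 <= a by exact: nrm_ge0.
have bU1 := gn_U e0 G1.
have {}bdd := bdd _ _ _ _ _ dp1 G1.
have bchi : bm (tail oY n : O -> R) := bm_tail n mY.
have fchi o : Ytail n o = tail oY n o * Ytail n o.
  by rewrite /Ytail mulrCA tail_idem.
have loc := localized_diff e0 dp0 G0 dp1 G1 (Ytail_L2 n P1Y) (Ytail_L2 n Y2) bchi fchi.
have Hle := hell_le dp1 dp0 s2 t0.
have chile := localized_hell_le dp1 dp0 s2 t0 bchi (tail_le1 n).
have quo := int_quotient_le dp1 dp0 s2 t0 bin inB.
have YU (P2 : probability O R) (u : O -> R) : L2 P2 oY -> bm u ->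
    \int[P2]_o (oY o * u o) = \int[P2]_o (Ytrunc n o * u o) + \int[P2]_o (Ytail n o * u o).
  move=> P2Y bu; rewrite -intD.
  - by apply: eq_int => o; rewrite /Ytrunc /Ytail; ring.
  - exact: bm_L1 (bmM (bm_Ytrunc n) bu).
  - exact: L2_L1 (L2_bmr (Ytail_L2 n P2Y) bu).
rewrite (YU P1 _ P1Y bU1) (YU Q _ Y2 bU0) opprD addrACA.
rewrite /tail_error -/g -/y.
have DD : `|\int[Q]_o (infn o * s o) - \int[Q]_o (inf0 o * s o)| <=
    Cinf eps * nrm Q (Ytail n) * nrm Q s.
  rewrite distrC -intB; [|exact: L2M|exact: L2M (bm_L2 Q bin) s2].
  rewrite (@eq_int _ _ _ _ _ (fun o => (inf0 o - infn o) * s o)); last first.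
    by move=> o; rewrite mulrBl.
  by rewrite (le_trans (Cauchy_Schwarz d2 s2))// ler_wpM2r// nrm_ge0.
apply: (quotient_combine t0 a0 a1 g0 B0 Cb0 ei (nrm_ge0 P1 (Ytail n))
  (nrm_ge0 Q (Ytail n)) CU0 _ (hell_ge0 mu p1 p0) (nrm_ge0 _ _) _ _ Hle chile
  bdd loc quo DD).
- by rewrite mulr_ge0// nrm_ge0.
- exact: le_trans (Ytail_nrm n P1Y) P1m.
- exact: Ytail_nrm.
Qed.

End derivative.

(** * Transfer to the given definitions and pathwise derivative of the functional *)

Section Lfun2.
Context d (T : measurableType d) (R : realType) (mu : {measure set T -> \bar R}).

Lemma Lfun2P (f : T -> R) : f \in Lfun mu 2%:E <-> L2 mu f.
Proof.
split=> [f2|[mf fi]].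
  split; last exact: Lfun2_integrable_sqr.
  by move: f2; rewrite inE => /andP[]; rewrite inE.
rewrite inE; apply/andP; split; rewrite inE//= /finite_norm unlock /Lnorm.
apply: poweR_lty; have /integrableP[_] := fi.
under eq_integral do rewrite /= ger0_norm ?sqr_ge0//.
congr (_ < _)%E; apply: eq_integral => x _.
transitivity ((`|f x| `^ 2)%:E); last by [].
by rewrite powR_mulrn// real_normK ?num_real.
Qed.

End Lfun2.

Section same_law.
Context d d' (T : measurableType d) (T' : measurableType d') (R : realType)
  (P Q : probability T R) (X : T -> T').
Hypothesis PQ : forall B, measurable B -> P B = Q B.

Lemma eq_law_integral (D : set T) (f : T -> \bar R) :
  (\int[P]_(x in D) f x = \int[Q]_(x in D) f x)%E.
Proof. by apply: eq_measure_integral => A mA _; exact: PQ. Qed.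

(** The chosen version depends on the law only through the predicate [is_condE], so laws that agree
    on measurable sets select literally the same function. This identifies the functional at [Pt 0]
    with that at [Q]. *)
Lemma eq_law_condE (f : T -> R) : condE P X f = condE Q X f.
Proof.
rewrite /condE; congr xget; apply/seteqP; split=> h [mh /integrableP[m hi] E];
  split => //; try (by apply/integrableP; split => //; move: hi; rewrite eq_law_integral);
  by move=> B mB; move: (E B mB); rewrite !eq_law_integral.
Qed.

End same_law.

Lemma measurable_phi_form d (T : measurableType d) (R : realType) (c : R)
    (p de ka x e g a y : T -> R) :
  measurable_fun setT p -> measurable_fun setT de -> measurable_fun setT ka ->
  measurable_fun setT x -> measurable_fun setT e -> measurable_fun setT g ->
  measurable_fun setT a -> measurable_fun setT y ->
  measurable_fun setT (fun o => (p o - de o) / ka o * y o - c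
    + g o / ka o * (ka o + (a o - p o) ^+ 2 - (a o - de o) ^+ 2)
    + (ka o)^-1 * (x o * (a o - p o) - e o * (a o - de o))).
Proof.
move=> mp md mk mx me mg ma my; have mV := measurable_funV mk.
have mpd := measurable_funB mp md; have map := measurable_funB ma mp.
have mad := measurable_funB ma md.
have h1 := measurable_funM (measurable_funM mpd mV) my.
have h2 := measurable_funB (measurable_funD mk (measurable_funX 2 map)) (measurable_funX 2 mad).
have h3 := measurable_funB (measurable_funM mx map) (measurable_funM me mad).
exact: measurable_funD (measurable_funD (measurable_funB h1 (measurable_cst c))
  (measurable_funM (measurable_funM mg mV) h2)) (measurable_funM mV h3).
Qed.

Section main_derivative.
Context {R : realType} {dZ dL} {TZ : measurableType dZ} {TL : measurableType dL}.
Local Notation O := (TZ * bool * R * TL)%type.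

Let mL := @measurable_oL R _ _ TZ TL.
Let mZL := @measurable_oZL R _ _ TZ TL.
Let mY := @measurable_oY R _ _ TZ TL.

Lemma eq_law_psi_star (P Q : probability O R) :
  (forall B, measurable B -> P B = Q B) -> psi_star P = psi_star Q.
Proof.
move=> PQ.
have E d' (T' : measurableType d') (X : O -> T') f : condE P X f = condE Q X f.
  exact: eq_law_condE.
have piE : pi_star P = pi_star Q by rewrite /pi_star /propensity /condP E.
have covE f g : condCov P (@oL R _ _ TZ TL) f g = condCov Q oL f g.
  by rewrite /condCov !E.
have gE : gamma_star P = gamma_star Q by rewrite /gamma_star piE !covE.
by rewrite /psi_star gE /Rintegral; congr fine; exact: eq_law_integral.
Qed.

Section law.
Variables (Q : probability O R) (eps : R).
Hypotheses (Y2 : L2 Q oY) (e0 : 0 < eps) (e1 : eps <= 1)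
  (rel : strong_iv_relevance Q eps).

Lemma phi_spec : exists pi delta kappa gam,
  [/\ good_nuisance Q eps pi delta kappa,
      cond_exp Q oL (fun o => oY o * iv_weight pi delta kappa o) gam,
      psi_star Q = \int[Q]_o (oY o * iv_weight pi delta kappa o),
      measurable_fun setT (phi (psi_star Q) (true_nuisance Q)) &
      \forall o \ae Q, phi (psi_star Q) (true_nuisance Q) o =
        influence pi delta kappa oY (condE Q oZL oY) (condE Q oL oY) gam o - psi_star Q].
Proof.
have [pi [delta [kappa [gam [G cg [mg mk] psiE ae]]]]] := true_nuisance_spec Y2 e0 e1 rel.
exists pi, delta, kappa, gam; split => //; last first.
  apply: filterS ae => o [h1 h2 h3 h4].
  by rewrite /phi /= h1 h2 h3 h4 /influence /iv_weight; ring.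
have Y1 := L2_L1 Y2; have bA := @bm_oAr R _ _ TZ TL.
have A1 := bm_L1 Q bA.
have mA : measurable_fun setT (@oAr R _ _ TZ TL) by case: bA.
have mpi : measurable_fun setT (fun o : O => pi_star Q (oZL o)).
  apply: (measurableT_comp _ mZL); rewrite /pi_star /propensity /condP -oAr_indic.
  by case: (cond_exp_condE mZL A1).
have mde : measurable_fun setT (fun o : O => condE Q oL oAr (oL o)).
  by apply: (measurableT_comp _ mL); case: (cond_exp_condE mL A1).
have mxi : measurable_fun setT (fun o : O => condE Q oZL oY (oZL o)).
  by apply: (measurableT_comp _ mZL); case: (cond_exp_condE mZL Y1).
have meta : measurable_fun setT (fun o : O => condE Q oL oY (oL o)).
  by apply: (measurableT_comp _ mL); case: (cond_exp_condE mL Y1).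
have mgO := measurableT_comp mg mL; have mkO := measurableT_comp mk mL.
exact: (measurable_phi_form (psi_star Q) mpi mde mkO mxi meta mgO mA mY).
Qed.

Lemma phi_L2 : L2 Q (phi (psi_star Q) (true_nuisance Q)).
Proof.
have [pi [delta [kappa [gam [G cg psiE mphi ae]]]]] := phi_spec.
have Y1 := L2_L1 Y2.
have [i2 _] := influence_L2 e0 G Y2 (cond_exp_condE mZL Y1) (cond_exp_condE mL Y1) cg.
have d2 := L2B i2 (bm_L2 Q (bm_cst _ (psi_star Q))).
split => //; apply: ae_L1 (proj2 d2); first exact: measurable_funX.
by apply: filterS ae => o ->.
Qed.

Lemma phi_mean0 : \int[Q]_o phi (psi_star Q) (true_nuisance Q) o = 0.
Proof.
have [pi [delta [kappa [gam [G cg psiE mphi ae]]]]] := phi_spec.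
have Y1 := L2_L1 Y2.
have cx := cond_exp_condE mZL Y1; have ce := cond_exp_condE mL Y1.
have [i2 _] := influence_L2 e0 G Y2 cx ce cg.
have i1 := L2_L1 i2; have p1 := bm_L1 Q (bm_cst _ (psi_star Q)).
rewrite (ae_int mphi (L1_meas (L1B i1 p1)) ae) intB// int_cst.
by rewrite (influence_expectation e0 e1 Y2 G cx ce cg) -psiE subrr.
Qed.

End law.

Lemma expectation_Rintegral (Q : probability O R) (f : O -> R) : L1 Q f ->
  ('E_Q[f] = 0)%E <-> \int[Q]_o f o = 0.
Proof.
by move=> f1; rewrite unlock -EFin_int//; split => [[]|->].
Qed.

Lemma psi_star_derive (Q : probability O R) (eps : R) Pt s :
  L2 Q oY -> 0 < eps -> strong_iv_relevance Q eps -> regular_submodel Q Pt s ->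
  is_derive (0 : R) (1 : R) (fun t : R => psi_star (Pt t))
    (\int[Q]_o (phi (psi_star Q) (true_nuisance Q) o * s o)).
Proof.
move=> Y2 ep relQ [PQ /Lfun2P s2 s0 [mu [p [dens qmd]]] [M mom] [eps1 ep1 rel1]].
(* A single relevance constant for [Q] and the nearby laws; it is kept at most 1 so that clipping
   [kappa] between [e] and 1 makes sense. *)
pose e := Num.min (Num.min eps eps1) 1.
have e0 : 0 < e by rewrite !lt_min ep ep1 ltr01.
have e1 : e <= 1 by rewrite ge_min lexx orbT.
have ee : e <= eps by rewrite !ge_min lexx.
have ee1 : e <= eps1 by rewrite !ge_min lexx orbT.
have relQe := strong_iv_relevance_le ee relQ.
have Y1 := L2_L1 Y2.
have cx := cond_exp_condE mZL Y1; have ce := cond_exp_condE mL Y1.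
have [pi [delta [kappa [gam [G cg psiE mphi ae]]]]] := phi_spec Y2 e0 e1 relQe.
have [i2 _] := influence_L2 e0 G Y2 cx ce cg.
have s1 : L1 Q s := L2_L1 s2.
(* [phi] differs from [influence] by the constant [psi_star Q], which is orthogonal to the centred
   score. *)
have -> : \int[Q]_o (phi (psi_star Q) (true_nuisance Q) o * s o) =
    \int[Q]_o (influence pi delta kappa oY (condE Q oZL oY) (condE Q oL oY) gam o * s o).
  have is1 := L2M i2 s2; have ps1 := L1Z (psi_star Q) s1.
  transitivity (\int[Q]_o (influence pi delta kappa oY (condE Q oZL oY)
      (condE Q oL oY) gam o * s o - psi_star Q * s o)).
    apply: ae_int.
    - by apply: measurable_funM => //; case: s2.
    - exact: L1_meas (L1B is1 ps1).
    - by apply: filterS ae => o ->; rewrite mulrBl.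
  rewrite intB// intZ//; move/(expectation_Rintegral s1): s0 => ->.
  by rewrite mulr0 subr0.
set D := \int[Q]_o _.
have dp0 : is_density mu Q (p 0).
  have [m0 g0 E0] := nbhs_singleton dens.
  by split => // B mB; rewrite -PQ// E0.
pose m := Num.sqrt M.
have m0 : 0 <= m by exact: sqrtr_ge0.
pose F (t : R) := psi_star (Pt t).
have F0 : F 0 = \int[Q]_o (oY o * iv_weight pi delta kappa o).
  by rewrite /F (eq_law_psi_star PQ).
suff H : h^-1 *: ((F \o shift 0) (h *: 1) - F 0) @[h --> (0 : R)^'] --> D.
  by apply: DeriveDef; [apply/cvg_ex; exists D|exact: cvg_lim].
apply/cvgrPdist_le => r r0.
have r2 : 0 < r / 2 by rewrite divr_gt0.
(* Half of the tolerance [r] goes to the tail, which fixes [n]; the terms in [C1] and [C2] share the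
   other half. *)
have [n tn] := tail_error_small mu (p 0) e0 s2 Y2 m0 r2.
have [C1 [C2 [C10 C20 bound]]] := quotient_bound e0 e1 dp0 s2 Y2 G cx ce cg m0 n.
have err_le c : 0 < c -> \forall t \near (0 : R)^', qmd_error mu (p t) (p 0) s t <= c.
  move=> c0; have cc : 0 < c ^+ 2 by rewrite exprn_gt0.
  move: qmd => /fine_cvg /cvgrPdist_le /(_ _ cc); apply: filterS => t.
  rewrite /= sub0r normrN => H; rewrite /qmd_error /nrm -[leRHS](ger0_norm (ltW c0)).
  by rewrite -sqrtr_sqr ler_wsqrtr// (le_trans _ H)// ler_norm.
(* [C1] and [C2] may be 0, hence the added 1 in the denominators. *)
have k1 : 0 < (r / 2) / 2 / (C1 + 1) by rewrite !divr_gt0// ltr_wpDl.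
have k2 : 0 < (r / 2) / 2 / (C2 + 1) by rewrite !divr_gt0// ltr_wpDl.
near=> t.
have t0 : t != 0 by near: t; exact: nbhs_dnbhs_neq.
have [mt gt Et] : [/\ measurable_fun setT (p t), forall o, 0 <= p t o &
    forall B, measurable B -> Pt t B = (\int[mu]_(o in B) (p t o)%:E)%E].
  by near: t; exact: nbhs_dnbhs dens.
have relt : strong_iv_relevance (Pt t) e.
  apply: (strong_iv_relevance_le ee1); near: t; exact: nbhs_dnbhs rel1.
have momt : (\int[Pt t]_o ((oY o) ^+ 2)%:E <= M%:E)%E.
  by near: t; exact: nbhs_dnbhs mom.
have Yt : L2 (Pt t) oY.
  split => //; apply/integrableP; split.
    by apply/measurable_EFinP; exact: measurable_funX.
  under eq_integral do rewrite /= ger0_norm ?sqr_ge0//.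
  by rewrite (le_lt_trans momt)// ltry.
have Ytm : nrm (Pt t) oY <= m.
  rewrite /nrm /m ler_wsqrtr// -lee_fin EFin_int//; by case: Yt.
have [pi1 [delta1 [kappa1 [gam1 [G1 _ _ psi1 _]]]]] := true_nuisance_spec Yt e0 e1 relt.
have a1 : qmd_error mu (p t) (p 0) s t <= 1 by near: t; exact: err_le.
have ak : qmd_error mu (p t) (p 0) s t <= (r / 2) / 2 / (C1 + 1).
  by near: t; exact: err_le.
have tk : `|t| <= (r / 2) / 2 / (C2 + 1) by near: t; exact: dnbhs0_le.
have := bound _ _ _ _ _ _ t0 (And3 mt gt Et) G1 Yt Ytm a1.
rewrite -psi1 -F0 -/D -/(F t) => b.
rewrite /= addr0 /GRing.scale /= mulr1 mulrC distrC (le_trans b)//.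
have b1 : C1 * qmd_error mu (p t) (p 0) s t <= (r / 2) / 2.
  rewrite (le_trans (ler_wpM2l C10 ak))// mulrCA ger_pMr ?divr_gt0//.
  by rewrite ler_pdivrMr ?ltr_wpDl// mul1r lerDl.
have b2 : C2 * `|t| <= (r / 2) / 2.
  rewrite (le_trans (ler_wpM2l C20 tk))// mulrCA ger_pMr ?divr_gt0//.
  by rewrite ler_pdivrMr ?ltr_wpDl// mul1r lerDl.
rewrite (le_trans (lerD (lerD b1 b2) (ltW tn)))// -[X in X + _]splitr.
by rewrite -splitr.
Unshelve. all: by end_near. Qed.

End main_derivative.

(** * Bounded tilts and uniqueness *)

Section submodel.
Context {R : realType} {dZ dL} {TZ : measurableType dZ} {TL : measurableType dL}.
Local Notation O := (TZ * bool * R * TL)%type.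
Variables (Q : probability O R) (eps0 : R) (s : O -> R).
Hypotheses (Y2 : L2 Q oY) (e0 : 0 < eps0) (rel : strong_iv_relevance Q eps0).
Hypotheses (bs : bm s) (s1 : forall o, `|s o| <= 1) (sm : \int[Q]_o s o = 0).

Let mL := @measurable_oL R _ _ TZ TL.
Let mZL := @measurable_oZL R _ _ TZ TL.
Let mY := @measurable_oY R _ _ TZ TL.

(* [1 + t s] is a density only for small [t], but a submodel is indexed by all of
   [R]. *)
Definition cutoff (t : R) : R := if `|t| <= 2^-1 then t else 0.

Definition tilt (t : R) (o : O) : R := 1 + cutoff t * s o.

Lemma cutoff_le t : `|cutoff t| <= 2^-1.
Proof. by rewrite /cutoff; case: ifPn => // _; rewrite normr0 invr_ge0. Qed.

Lemma cutoff_id t : `|t| <= 2^-1 -> cutoff t = t.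
Proof. by rewrite /cutoff => ->. Qed.

Lemma cutoff0 : cutoff 0 = 0.
Proof. by rewrite cutoff_id// normr0 invr_ge0. Qed.

Lemma tilt_bounds t o : 2^-1 <= tilt t o <= 2.
Proof.
have : `|cutoff t * s o| <= 2^-1.
  by rewrite normrM -[leRHS]mulr1 ler_pM// cutoff_le.
by rewrite /tilt ler_norml => /andP[? ?]; apply/andP; split; lra.
Qed.

Lemma tilt_ge0 t o : 0 <= tilt t o.
Proof. by have /andP[? _] := tilt_bounds t o; lra. Qed.

Lemma bm_tilt t : bm (tilt t).
Proof. by rewrite /tilt; bmt. Qed.

Lemma int_tilt t : (\int[Q]_o (tilt t o)%:E = 1)%E.
Proof.
rewrite -EFin_int; last exact/bm_L1/bm_tilt.
rewrite /tilt intD; [|exact/bm_L1/bm_cst|exact/L1Z/bm_L1].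
by rewrite int_cst intZ; [rewrite sm mulr0 addr0|exact: bm_L1].
Qed.

Definition tilted t : probability O R :=
  sval (density_probability (proj1 (bm_tilt t)) (tilt_ge0 t) (int_tilt t)).

Lemma tiltedE t B : measurable B ->
  tilted t B = (\int[Q]_(o in B) (tilt t o)%:E)%E.
Proof. by move=> mB; rewrite /tilted; case: density_probability => ? /= ->. Qed.

Lemma tilted_int t (f : O -> R) : bm f ->
  \int[tilted t]_o f o = \int[Q]_o (f o * tilt t o).
Proof.
move=> bf; rewrite -(density_int (proj1 (bm_tilt t)) (tilt_ge0 t) (tiltedE t))//.
exact: bm_L1.
Qed.

Lemma tilted_ge0_integral t (f : O -> R) : measurable_fun setT f ->
  (forall o, 0 <= f o) ->
  (\int[tilted t]_o (f o)%:E = \int[Q]_o (f o * tilt t o)%:E)%E.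
Proof.
move=> mf f0.
by rewrite -(density_ge0_integral (proj1 (bm_tilt t)) (tilt_ge0 t) (tiltedE t)).
Qed.

Lemma tilted_moment t :
  (\int[tilted t]_o ((oY o) ^+ 2)%:E <= (2 * \int[Q]_o oY o ^+ 2)%:E)%E.
Proof.
rewrite (tilted_ge0_integral t (measurable_funX 2 mY) (fun o => sqr_ge0 _)).
case: Y2 => _ Yi; rewrite -intZ// EFin_int; last exact: L1Z.
apply: ge0_le_integral => //.
- by move=> o _; rewrite lee_fin mulr_ge0 ?sqr_ge0 ?tilt_ge0.
- apply/measurable_EFinP/measurable_funM; first exact: measurable_funX.
  by case: (bm_tilt t).
- by apply/measurable_EFinP/measurable_funM => //; exact: measurable_funX.
- move=> o _; rewrite lee_fin mulrC ler_wpM2r ?sqr_ge0//.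
  by case/andP: (tilt_bounds t o).
Qed.

(* [sqrt (1 + x) - 1 - x / 2 = - (sqrt (1 + x) - 1) ^ 2 / 2]. *)
Lemma sqrt_expansion (x : R) : `|x| <= 2^-1 ->
  `|Num.sqrt (1 + x) - 1 - 2^-1 * x| <= x ^+ 2.
Proof.
rewrite ler_norml => /andP[x1 x2].
have p : 0 <= 1 + x by lra.
have r0 := sqrtr_ge0 (1 + x); have := sqr_sqrtr p.
move: r0; set r := Num.sqrt _ => r0 E.
have -> : r - 1 - 2^-1 * x = - (2^-1 * (r - 1) ^+ 2).
  have -> : x = r ^+ 2 - 1 by rewrite E; ring.
  by field.
have h : 0 <= 2^-1 * (r - 1) ^+ 2 by apply: mulr_ge0; rewrite ?invr_ge0 ?sqr_ge0.
rewrite normrN (ger0_norm h).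
have -> : x ^+ 2 = (r - 1) ^+ 2 * (r + 1) ^+ 2.
  have -> : x = r ^+ 2 - 1 by rewrite E; ring.
  by ring.
rewrite mulrC ler_wpM2l ?sqr_ge0//.
have : 1 <= (r + 1) ^+ 2 by nra.
by lra.
Qed.

Lemma tilted_qmd : quadratic_mean_differentiable tilted s.
Proof.
exists Q, tilt; split.
  near=> t; split; [by case: (bm_tilt t)|exact: tilt_ge0|exact: tiltedE].
have half0 : 0 < 2^-1 :> R by rewrite invr_gt0.
apply: (@squeeze_cvge _ _ _ _ (cst 0%E) _ (fun t : R => (t ^+ 2)%:E)).
- near=> t; apply/andP; split.
    by apply: integral_ge0 => o _; rewrite lee_fin sqr_ge0.
  have t0 : t != 0 by near: t; exact: nbhs_dnbhs_neq.
  have t1 : `|t| <= 2^-1 by near: t; exact: dnbhs0_le.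
  have tt : 0 < `|t| by rewrite normr_gt0.
  (* The remainder of [sqrt_expansion] at [t * s] is at most [t ^ 2], so dividing by [t] leaves at
     most [|t|]. *)
  have bound o : ((Num.sqrt (tilt t o) - Num.sqrt (tilt 0 o)) / t
      - 2^-1 * s o * Num.sqrt (tilt 0 o)) ^+ 2 <= t ^+ 2.
    rewrite /tilt cutoff0 mul0r addr0 sqrtr1 mulr1 cutoff_id//.
    have ts : `|t * s o| <= `|t| by rewrite normrM ler_piMr.
    have := sqrt_expansion (le_trans ts t1) => E.
    have -> : (Num.sqrt (1 + t * s o) - 1) / t - 2^-1 * s o =
        (Num.sqrt (1 + t * s o) - 1 - 2^-1 * (t * s o)) / t by field.
    rewrite -real_normK ?num_real// -[leRHS]real_normK ?num_real//.
    rewrite lerXn2r ?nnegrE// normrM normfV ler_pdivrMr// (le_trans E)//.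
    by rewrite -expr2 -real_normK ?num_real// lerXn2r ?nnegrE.
  have -> : ((t ^+ 2)%:E = \int[Q]_(_ in setT) (t ^+ 2)%:E)%E.
    by rewrite integral_cst// [X in (_ * X)%E]probability_setT mule1.
  apply: ge0_le_integral => //.
  + by move=> o _; rewrite lee_fin sqr_ge0.
  + have msq u : measurable_fun setT (fun o => Num.sqrt (tilt u o)).
      have -> : (fun o => Num.sqrt (tilt u o)) = (fun o => tilt u o `^ 2^-1).
        by apply/funext => o; rewrite powR12_sqrt// tilt_ge0.
      by apply: (measurableT_comp (measurable_powR _)); case: (bm_tilt u).
    apply/measurable_EFinP/measurable_funX/measurable_funB.
      by apply: measurable_funM => //; exact: measurable_funB.
    by apply: measurable_funM => //; apply: measurable_funM => //; case: bs.
  + by move=> o _; rewrite lee_fin.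
- exact: cvg_cst.
- have : (fun t : R => t ^+ 2) @ (0 : R)^' --> (0 : R).
    apply: cvg_within_filter.
    by have := @exprn_continuous R 2 0; rewrite /continuous_at expr0n.
  by move=> h; apply: cvg_EFin; [exact: nearW|exact: h].
Unshelve. all: by end_near. Qed.

(** Test on [g(L)] with [0 <= g <= 1] and let [G] be the mean of [g] under [Q]. Passing to the
    [Q]-propensity halves the quadratic form, changing the law halves it again, and the propensity
    error costs [|t| G]: at least [(eps0 / 4 - eps0 / 8) G] remains. As the tilted mean of [g] is at
    most [2 G], this gives [eps0 / 16]. *)
Lemma tilted_relevance t : `|t| <= 2^-1 -> `|t| <= eps0 / 8 ->
  strong_iv_relevance (tilted t) (eps0 / 16).
Proof.
move=> t1 t2 a; set Pt := tilted t.
have [pi0 [de0 [[bpi0 pi001 cpi0] [bde0 de001 cde0] cV0 _ _]]] := propensity_spec Q a.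
have [pi1 [de1 [[bpi1 pi011 cpi1] [bde1 de011 cde1] cV1 _ _]]] := propensity_spec Pt a.
set V0 := condVar Q _ _ in cV0; set V1 := condVar Pt _ _ in cV1 *.
have bA := @bm_arm R _ _ TZ TL a.
have bw := bm_tilt t.
pose x (o : O) := pi1 (oZL o); pose y (o : O) := de1 (oL o).
pose u (o : O) := pi0 (oZL o); pose v (o : O) := de0 (oL o).
have bx : bm x := bm_comp mZL bpi1. have by' : bm y := bm_comp mL bde1.
have bu : bm u := bm_comp mZL bpi0. have bv : bm v := bm_comp mL bde0.
apply: (cond_exp_ge_test mL);
  [by case: cV1|by case: cV1|] => gl bgl gl01.
pose g (o : O) := gl (oL o); have bg : bm g := bm_comp mL bgl.
have g0 o : 0 <= g o by case/andP: (gl01 (oL o)).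
have snd_bm (h : TL -> R) : bm h -> bm (fun z : TZ * TL => h z.2) by exact: bm_comp.
have -> : \int[Pt]_o (gl (oL o) * V1 (oL o)) = \int[Pt]_o (g o * (x o - y o) ^+ 2).
  by case: cV1 => _ _ ->.
have Eg : \int[Pt]_o gl (oL o) <= 2 * \int[Q]_o g o.
  rewrite tilted_int// -intZ; last exact: bm_L1.
  apply: le_int; [exact/bm_L1/bmM|exact/L1Z/bm_L1|] => o.
  rewrite mulrC ler_wpM2r ?g0//; first by case/andP: (tilt_bounds t o).
(* From [(u - y) ^ 2 <= 2 (u - x) ^ 2 + 2 (x - y) ^ 2]. *)
have B1 : 2^-1 * \int[Pt]_o (g o * (u o - y o) ^+ 2) -
    \int[Pt]_o (g o * (x o - u o) ^+ 2) <= \int[Pt]_o (g o * (x o - y o) ^+ 2).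
  have b1 : bm (fun o => g o * (u o - y o) ^+ 2) by bmt.
  have b2 : bm (fun o => g o * (x o - u o) ^+ 2) by bmt.
  have b3 : bm (fun o => g o * (x o - y o) ^+ 2) by bmt.
  rewrite -intZ; last exact: bm_L1.
  rewrite -intB; [|exact/L1Z/bm_L1|exact: bm_L1].
  apply: le_int; [apply: L1B; [exact/L1Z/bm_L1|exact: bm_L1]|exact: bm_L1|] => o.
  rewrite mulrCA -mulrBr ler_wpM2l//.
  have := sqr_ge0 ((u o - y o) - 2 * (u o - x o)); lra.
have B2 : 2^-1 * \int[Q]_o (g o * (u o - y o) ^+ 2) <=
    \int[Pt]_o (g o * (u o - y o) ^+ 2).
  have b1 : bm (fun o => g o * (u o - y o) ^+ 2) by bmt.
  rewrite tilted_int// -intZ; last exact: bm_L1.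
  apply: le_int; [exact/L1Z/bm_L1|exact/bm_L1/bmM|] => o.
  have h0 : 0 <= g o * (u o - y o) ^+ 2 by rewrite mulr_ge0 ?sqr_ge0.
  by rewrite mulrC ler_wpM2l//; case/andP: (tilt_bounds t o).
have B3 : eps0 * \int[Q]_o g o <= \int[Q]_o (g o * (u o - y o) ^+ 2).
  have b1 : bm (fun o => g o * (u o - v o) ^+ 2) by bmt.
  have b2 : bm (fun o => g o * (v o - y o) ^+ 2) by bmt.
  pose k l := 2 * gl l * (de0 l - de1 l).
  have bk : bm k by rewrite /k; bmt.
  have bkO := bm_comp mL bk.
  have z : \int[Q]_o (k (oL o) * u o - k (oL o) * v o) = 0.
    rewrite intB; [|by apply: bm_L1; bmt|by apply: bm_L1; bmt].
    case: cpi0 => _ _ /(_ _ (snd_bm _ bk)) /= ->.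
    by case: cde0 => _ _ /(_ _ bk) ->; rewrite subrr.
  have -> : \int[Q]_o (g o * (u o - y o) ^+ 2) =
      \int[Q]_o (g o * (u o - v o) ^+ 2) + \int[Q]_o (g o * (v o - y o) ^+ 2).
    rewrite -[RHS]addr0 -[in RHS]z -!intD; try by apply: bm_L1; bmt.
    by apply: eq_int => o; rewrite /k /g /u /v /y; ring.
  rewrite ler_wpDr//; first by apply: int_ge0 => o; rewrite mulr_ge0 ?sqr_ge0.
  have -> : \int[Q]_o (g o * (u o - v o) ^+ 2) = \int[Q]_o (g o * V0 (oL o)).
    by case: cV0 => _ _ ->.
  have V01 : L1 Q (fun o => V0 (oL o)) by case: cV0.
  have gV := L1_bm bg V01; have ge := bm_L1 Q bg.
  rewrite -subr_ge0 -intZ// -intB//; last exact: L1Z.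
  rewrite (@ae_int _ _ _ _ _ (fun o => `|g o * V0 (oL o) - eps0 * g o|)).
  - exact: int_ge0.
  - exact: L1_meas (L1B gV (L1Z _ ge)).
  - exact: L1_meas (L1_norm (L1B gV (L1Z _ ge))).
  - apply: filterS (rel a) => o Vo.
    by rewrite ger0_norm// subr_ge0 mulrC ler_wpM2l.
(* Under the tilted law [x] may be replaced by the treatment indicator, which turns one factor
   [x - u] into a residual centred under [Q]. Only the part [t * s] of the density then
   contributes. *)
have B4 : \int[Pt]_o (g o * (x o - u o) ^+ 2) <= `|t| * \int[Q]_o g o.
  pose k z := gl z.2 * (pi1 z - pi0 z).
  have bk : bm k by have ? := snd_bm _ bgl; rewrite /k; bmt.
  have bkO := bm_comp mZL bk.
  have z1 : \int[Pt]_o (k (oZL o) * x o - k (oZL o) * arm a o) = 0.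
    rewrite intB; [|by apply: bm_L1; bmt|by apply: bm_L1; bmt].
    by case: cpi1 => _ _ /(_ _ bk) ->; rewrite subrr.
  have z0 : \int[Q]_o (k (oZL o) * arm a o - k (oZL o) * u o) = 0.
    rewrite intB; [|by apply: bm_L1; bmt|by apply: bm_L1; bmt].
    by case: cpi0 => _ _ /(_ _ bk) ->; rewrite subrr.
  have -> : \int[Pt]_o (g o * (x o - u o) ^+ 2) =
      \int[Pt]_o (k (oZL o) * arm a o - k (oZL o) * u o).
    rewrite -[RHS]addr0 -[in RHS]z1 -intD; try by apply: bm_L1; bmt.
    by apply: eq_int => o; rewrite /k /g /x /u; ring.
  have bkk : bm (fun o => k (oZL o) * arm a o - k (oZL o) * u o) by bmt.
  rewrite tilted_int//.
  rewrite (@eq_int _ _ _ _ _ (fun o => (k (oZL o) * arm a o - k (oZL o) * u o) +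
    t * ((k (oZL o) * arm a o - k (oZL o) * u o) * s o))); last first.
    by move=> o; rewrite /tilt cutoff_id//; ring.
  rewrite intD; [|exact: bm_L1|exact/L1Z/bm_L1/bmM].
  rewrite z0 add0r intZ; last exact/bm_L1/bmM.
  rewrite (le_trans (ler_norm _))// normrM ler_wpM2l//.
  rewrite (le_trans (le_normr_Rintegral measurableT _))//; first exact/bm_L1/bmM.
  apply: le_int; [exact/L1_norm/bm_L1/bmM|exact: bm_L1|] => o.
  have -> : (k (oZL o) * arm a o - k (oZL o) * u o) * s o =
    g o * ((x o - u o) * (arm a o - u o) * s o) by rewrite /k /g /x /u /=; ring.
  rewrite normrM (ger0_norm (g0 o)) ler_piMr// !normrM !mulr_ile1//.
  - exact: ler_dist01 (pi011 _) (pi001 _).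
  - exact: ler_dist01 (arm01 _ _) (pi001 _).
have Eg0 : 0 <= \int[Q]_o g o by exact: int_ge0.
have tE := ler_wpM2r Eg0 t2.
have eE : eps0 / 16 * \int[Pt]_o gl (oL o) <= eps0 / 16 * (2 * \int[Q]_o g o).
  by rewrite ler_wpM2l// divr_ge0// ltW.
move: eE tE B1 B2 B3 B4; clear.
set i1 := \int[Pt]_o gl _; set i2 := \int[Q]_o g _; set i3 := \int[Pt]_o _.
set i4 := \int[Pt]_o _; set i5 := \int[Pt]_o _; set i6 := \int[Q]_o _.
lra.
Qed.

Lemma tilted_regular : regular_submodel Q tilted s.
Proof.
have s2 := bm_L2 Q bs.
split.
- move=> B mB; rewrite tiltedE// -[RHS]mul1e -integral_cst//.
  by apply: eq_integral => o _; rewrite /tilt cutoff0 mul0r addr0.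
- exact/Lfun2P.
- by apply/expectation_Rintegral => //; exact: bm_L1.
- exact: tilted_qmd.
- by exists (2 * \int[Q]_o oY o ^+ 2); near=> t; exact: tilted_moment.
- exists (eps0 / 16); first by rewrite divr_gt0.
  near=> t; apply: tilted_relevance; near: t.
    by apply: (@nbhs0_le _ R); rewrite invr_gt0.
  by apply: (@nbhs0_le _ R); rewrite divr_gt0.
Unshelve. all: by end_near. Qed.

End submodel.

Section uniqueness.
Context {R : realType} {dZ dL} {TZ : measurableType dZ} {TL : measurableType dL}.
Local Notation O := (TZ * bool * R * TL)%type.
Variables (Q : probability O R) (eps0 : R).
Hypotheses (Y2 : L2 Q oY) (e0 : 0 < eps0) (rel : strong_iv_relevance Q eps0).

Lemma influence_function_unique (f g : O -> R) :
  influence_function psi_star Q f -> influence_function psi_star Q g ->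
  \forall o \ae Q, g o = f o.
Proof.
move=> [/Lfun2P f2 fm fd] [/Lfun2P g2 gm gd].
have f1 := L2_L1 f2; have g1 := L2_L1 g2.
move/(expectation_Rintegral f1) : fm => fm.
move/(expectation_Rintegral g1) : gm => gm.
have ind B : measurable B -> \int[Q]_o (\1_B o * (g o - f o)) = 0.
  move=> mB; have bB := bm_indic R mB.
  pose q := \int[Q]_o (\1_B o : R).
  have q01 : 0 <= q <= 1.
    have i01 (o : O) : 0 <= (\1_B o : R) <= 1.
      by rewrite indicE; case: (_ \in _); rewrite ?lexx ler01.
    rewrite int_ge0 => [|o]; last by case/andP: (i01 o).
    rewrite -(int_cst Q 1); apply: le_int => [||o]; [exact: bm_L1|exact/bm_L1/bm_cst|].
    by case/andP: (i01 o).
  pose s (o : O) : R := \1_B o - q.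
  have bs : bm s by rewrite /s; bmt.
  have s1 o : `|s o| <= 1.
    rewrite /s indicE ler_norml; case/andP: q01 => ? ?.
    by case: (_ \in _) => /=; lra.
  have sm : \int[Q]_o s o = 0.
    rewrite /s intB; [|exact: bm_L1|exact/bm_L1/bm_cst].
    by rewrite int_cst subrr.
  have reg := tilted_regular Y2 e0 rel bs s1 sm.
  have := fd _ _ reg; have := gd _ _ reg.
  move=> [_ eg] [_ ef].
  have E : \int[Q]_o (f o * s o) = \int[Q]_o (g o * s o) by rewrite -ef -eg.
  have gs := L2M g2 (bm_L2 Q bs); have fs := L2M f2 (bm_L2 Q bs).
  (* The score is the indicator minus its mean [q]; the correction in [q] vanishes because both
     influence functions are centred. *)
  have : \int[Q]_o (\1_B o * (g o - f o)) =
      (\int[Q]_o (g o * s o) - \int[Q]_o (f o * s o)) +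
      q * (\int[Q]_o g o - \int[Q]_o f o).
    rewrite -intB// -[X in q * X]intB// -intZ; last exact: L1B.
    rewrite -intD; [|exact: L1B|exact/L1Z/L1B].
    by apply: eq_int => o; rewrite /s; ring.
  by rewrite -E subrr fm gm subrr mulr0 addr0.
have gf := L1B g1 f1.
(* Equal integrals over all events make [g] a version of the conditional expectation of [f] given
   the whole observation, and so is [f] itself. *)
have cg : cond_exp Q id f g.
  split => //; first by case: g2.
  move=> k bk; apply/eqP; rewrite -subr_eq0 -intB; [|exact: L1_bm|exact: L1_bm].
  rewrite (@eq_int _ _ _ _ _ (fun o => k o * (g o - f o))).
    by apply/eqP; exact: (pull_out0 (X := id) _ gf).
  by move=> o; rewrite mulrBr.
have cf : cond_exp Q id f f by split => //; case: f2.
exact: (cond_exp_unique _ f1 cg cf).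
Qed.

End uniqueness.

(** * Efficiency of [phi] under the law of the observed data *)

Section main.
Context {R : realType} {dZ dL} {TZ : measurableType dZ} {TL : measurableType dL}.

Lemma phi_efficient (Q : probability (TZ * bool * R * TL)%type R) (eps0 : R) :
  L2 Q oY -> 0 < eps0 -> strong_iv_relevance Q eps0 ->
  efficient_influence_function psi_star Q (phi (psi_star Q) (true_nuisance Q)).
Proof.
move=> Y2 e0 rel.
pose e := Num.min eps0 1.
have ep : 0 < e by rewrite lt_min e0 ltr01.
have e1 : e <= 1 by rewrite ge_min lexx orbT.
have ee : e <= eps0 by rewrite ge_min lexx.
have rele := strong_iv_relevance_le ee rel.
have phi2 := phi_L2 Y2 ep e1 rele.
have IF : influence_function psi_star Q (phi (psi_star Q) (true_nuisance Q)).
  split; first exact/Lfun2P.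
    by apply/expectation_Rintegral; [exact: L2_L1|exact: (phi_mean0 Y2 ep e1 rele)].
  by move=> Pt s; exact: (psi_star_derive Y2 ep rele).
split => // g IFg.
by apply: filterS (influence_function_unique Y2 ep rele IF IFg) => o.
Qed.

Lemma obs_law_L2 d (T : measurableType d) (P : probability T R)
    (Z : {mfun T >-> TZ}) (A : {mfun T >-> bool}) (Y : {mfun T >-> R})
    (L : {mfun T >-> TL}) : L2 P Y -> L2 (obs_law P Z A Y L) oY.
Proof.
move=> [mY Yi]; split; first exact: measurable_oY.
apply/integrableP; split.
  by apply/measurable_EFinP/measurable_funX; exact: measurable_oY.
have /integrableP[_] := Yi.
rewrite [X in _ -> (X < _)%E]ge0_integral_distribution//.
by apply: measurableT_comp => //; apply/measurable_EFinP/measurable_funX; exact: measurable_oY.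
Qed.

End main.

Theorem theorem3p2 (R : realType)
  (d dZ dL dU : measure_display)
  (T : measurableType d) (TZ : measurableType dZ)
  (TL : measurableType dL) (TU : measurableType dU)
  (P : probability T R)
  (Z : {RV P >-> TZ}) (A : {RV P >-> bool}) (Y : {RV P >-> R})
  (L : {RV P >-> TL}) (U : {RV P >-> TU}) (Ypot : bool -> {RV P >-> R})
  (Y_L2 : (Y : T -> R) \in Lfun P 2%:E)
  (consistency : \forall w \ae P, Y w = Ypot (A w) w)
  (latent_ignorability : forall a : bool,
    cond_indep P (Ypot a) (fun w => (A w, Z w)) (fun w => (U w, L w)))
  (iv_independence : cond_indep P Z U L)
  (eps0 : R) (eps0_gt0 : 0 < eps0)
  (iv_relevance : strong_iv_relevance (obs_law P Z A Y L) eps0) :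
  let Q := obs_law P Z A Y L in
  efficient_influence_function psi_star Q (phi (psi_star Q) (true_nuisance Q)).
Proof.
move=> Q; apply: (phi_efficient _ eps0_gt0 iv_relevance).
exact/obs_law_L2/Lfun2P.
Qed.
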